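(* Let $m\ge 1$, let $K=K(t,x,u,u_1,\dots,u_{2m+1})$ be smooth with $\partial K/\partial u_{2m+1}$ nowhere zero, and let $\Delta=u_t-K$ (an odd order scalar evolution equation). Let $\mathcal E=\sum_{i=0}^k r_i(t,x,u,u_1,\dots)D_x^i$ be a differential operator of order $k$. (1) $\mathcal E$ is a variational operator for $\Delta$ if and only if $\mathcal E$ is skew-adjoint and the form $$\omega = dx \wedge \theta^0 \wedge \epsilon -dt \wedge \sum _{j=1}^{2m+1} \sum_{a=1}^{j} (-X)^{a-1}\Big(\frac{\partial K}{\partial u_{j}}\, \epsilon\Big)\wedge \theta^{j-a},\qquad \epsilon=-\frac12\sum_{i=0}^k r_i\theta^i ,$$ satisfies $d_H\omega=0$ on $\mathcal R^\infty$. (2) Let $\mathcal V_{op}(\Delta)$ be the vector space of variational operators for $\Delta$. The map $\Phi:\mathcal V_{op}(\Delta)\to H^{1,2}(\mathcal R^\infty)$, $\Phi(\mathcal E)=[\omega]$, with $\omega$ the form in (1), is an isomorphism of vector spaces.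
   Context: Write $u_0=u$, $u_1=u_x$, $u_i=\partial_x^i u$. $J^\infty(\mathbb R^2,\mathbb R)$ is the infinite jet space with coordinates $(t,x,u_{a,i})_{a,i\ge 0}$, where $u_{a,i}$ corresponds to $\partial_t^a\partial_x^i u$ (so $u_{0,i}=u_i$, $u_{1,0}=u_t$); $D_t,D_x$ are the total derivatives; the Euler operator is $\mathbf E(L)=\sum_{a,i}(-1)^{a+i}D_x^iD_t^a(\partial L/\partial u_{a,i})$. Smooth functions depend on finitely many coordinates. Variational operator: $\mathcal E=\sum_i r_i D_x^i$, with $r_i$ smooth functions of $(t,x,u,u_1,u_2,\dots)$ only, is a variational operator for $\Delta$ if there is $L\in C^\infty(J^\infty(\mathbb R^2,\mathbb R))$ with $\mathcal E(\Delta)=\mathbf E(L)$ identically on $J^\infty(\mathbb R^2,\mathbb R)$ (the zero operator is included in $\mathcal V_{op}(\Delta)$). The formal adjoint is $\mathcal E^*(f)=\sum_i(-D_x)^i(r_if)$; skew-adjoint means $\mathcal E^*=-\mathcal E$. $\mathcal R^\infty$ is the infinitely prolonged equation manifold of $\Delta=0$, with coordinates $(t,x,u,u_1,u_2,\dots)$. Functions of $(t,x,u,u_1,\dots)$ are regarded both as functions on $\mathcal R^\infty$ and on $J^\infty(\mathbb R^2,\mathbb R)$. On $\mathcal R^\infty$: $X=\partial_x+\sum_i u_{i+1}\partial_{u_i}$, $T=\partial_t+\sum_i X^i(K)\partial_{u_i}$, $\theta^i=du_i-X^i(K)\,dt-u_{i+1}\,dx$. $\Omega^{r,s}(\mathcal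 R^\infty)$ is the space of differential forms that are finite sums of a function times $r$ of the forms $dt,dx$ wedged with $s$ of the forms $\theta^i$. $X$ and $T$ act on forms by Lie derivative (so they annihilate $dt,dx$ and $X(\theta^i)=\theta^{i+1}$). $d_H\omega=dx\wedge X(\omega)+dt\wedge T(\omega)$, $d_V=d-d_H$, and $H^{r,s}(\mathcal R^\infty)=\ker(d_H|_{\Omega^{r,s}})/d_H(\Omega^{r-1,s})$. *)

(* Defs.v *)
From HB Require Import structures.
From mathcomp Require Import all_boot all_order all_algebra finmap.
From mathcomp Require Import all_classical all_reals topology normedtype derive.

Set Implicit Arguments.
Unset Strict Implicit.
Unset Printing Implicit Defensive.

Import Order.TTheory GRing.Theory Num.Theory.
Import numFieldNormedType.Exports.

Local Open Scope classical_set_scope.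
Local Open Scope ring_scope.
Local Open Scope quotient_scope.

Section Calculus.
Variables (R : realType) (I : choiceType).
Local Notation point := (I -> R).

(* The curve through p in the direction of the coordinate c. *)
Definition upd (p : point) (c : I) (s : R) : point :=
  fun b => if b == c then s else p b.

Definition pd (c : I) (f : point -> R) : point -> R :=
  fun p => derive1 (fun s : R => f (upd p c s)) (p c).

Definition depends_on_finitely_many (f : point -> R) :=
  exists A : seq I, forall p q : point, {in A, p =1 q} -> f p = f q.

(* All iterated partial derivatives exist and are continuous; the topology on
   [I -> R] is the product one, which for a function of finitely many
   coordinates amounts to continuity in those coordinates. *)
Definition smooth (f : point -> R) :=
  depends_on_finitely_many f /\
  forall cs : seq I, let g := foldr pd f cs in
    continuous (g : {ptws I -> R} -> R) /\
    forall (c : I) (p : point), derivable (fun s : R => g (upd p c s)) (p c) 1.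

(* The sums over infinite index sets below are sums over the support (fsbigop);
   a smooth f has only finitely many partial derivatives that are not 0. *)
Definition vact (V : point -> point) (f : point -> R) : point -> R :=
  fun p => \sum_(c \in [set: I]) V p c * pd c f p.

(* Values of a differential n-form on a point and n tangent vectors. *)
Definition dform (n : nat) := point -> ('I_n -> point) -> R.

Definition wedge1 n (a : dform 1) (w : dform n) : dform n.+1 := fun p v =>
  \sum_(i < n.+1) (-1) ^+ i * a p (fun=> v i) * w p (fun j => v (lift i j)).

Definition fmul n (f : point -> R) (w : dform n) : dform n :=
  fun p v => f p * w p v.

(* Derivative of the components of V along the vector v. *)
Definition vderiv (V : point -> point) (p v : point) : point :=
  fun c => \sum_(b \in [set: I]) v b * pd b (fun q => V q c) p.

(* (L_V w)(v_1, ..., v_n) = V(w(v_1, ..., v_n)) - sum_j w(..., [V, v_j], ...)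
   for constant vector fields v_j, for which [V, v_j] = - vderiv V _ v_j. *)
Definition lie n (V : point -> point) (w : dform n) : dform n := fun p v =>
  vact V (fun q => w q v) p
  + \sum_(j < n) w p (fun l => if l == j then vderiv V p (v j) else v l).

End Calculus.

Section Smooth.
Variables (R : realType) (I : choiceType).
Local Notation point := (I -> R).
Implicit Types (f g : point -> R) (p q : point) (c : I).

Local Notation slice f p c := (fun s : R => f (upd p c s)).

Lemma upd_id p c : upd p c (p c) = p.
Proof. by apply/funext => b; rewrite /upd; case: eqP => [->|]. Qed.

Lemma smooth_derivable f p c : smooth f -> derivable (slice f p c) (p c) 1.
Proof. by case=> _ /(_ [::])[_]; exact. Qed.

Lemma upd_agree (A : seq I) p q c s :
  {in A, p =1 q} -> {in A, upd p c s =1 upd q c s}.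
Proof. by move=> pq b bA; rewrite /upd; case: eqP => // _; exact: pq. Qed.

Lemma pd_support f (A : seq I) c p :
  (forall p q, {in A, p =1 q} -> f p = f q) -> c \notin A -> pd c f p = 0.
Proof.
move=> fA cA; rewrite /pd.
have -> : slice f p c = cst (f p).
  apply/funext => s; apply: fA => b bA; rewrite /upd; case: eqP => // bc.
  by rewrite -bc bA in cA.
by rewrite derive1_cst.
Qed.

Lemma pd_depends f (A : seq I) c :
  (forall p q, {in A, p =1 q} -> f p = f q) ->
  forall p q, {in A, p =1 q} -> pd c f p = pd c f q.
Proof.
move=> fA p q pq; have [cA|cA] := boolP (c \in A); last first.
  by rewrite !(pd_support _ fA).
have e : slice f p c = slice f q c.
  by apply/funext => s; apply: fA; exact: upd_agree.
by rewrite /pd e (pq c cA).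
Qed.

Lemma smooth_pd c f : smooth f -> smooth (pd c f).
Proof.
move=> [[A fA] sf]; split; first by exists A; exact: pd_depends.
by move=> cs; have := sf (rcons cs c); rewrite foldr_rcons.
Qed.

Lemma smooth_coind (P : (point -> R) -> Prop) :
  (forall f, P f -> [/\ depends_on_finitely_many f,
     continuous (f : {ptws I -> R} -> R),
     forall c p, derivable (slice f p c) (p c) 1 &
     forall c, P (pd c f)]) ->
  forall f, P f -> smooth f.
Proof.
move=> PP f Pf; split; first by case: (PP f Pf).
move=> cs; elim/last_ind: cs f Pf => [|cs c ih] f Pf /=.
  by case: (PP f Pf).
by rewrite foldr_rcons; apply: ih; case: (PP f Pf).
Qed.

Lemma smooth_continuous f : smooth f -> continuous (f : {ptws I -> R} -> R).
Proof. by case=> _ /(_ [::])[]. Qed.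

Lemma pdD' f g c :
  (forall c p, derivable (slice f p c) (p c) 1) ->
  (forall c p, derivable (slice g p c) (p c) 1) ->
  pd c (f + g) = pd c f + pd c g.
Proof.
move=> df dg; apply/funext => p; rewrite /pd !fctE !derive1E.
exact: (deriveD (df c p) (dg c p)).
Qed.

Lemma pdD f g c : smooth f -> smooth g -> pd c (f + g) = pd c f + pd c g.
Proof. by move=> sf sg; apply: pdD' => *; exact: smooth_derivable. Qed.

Lemma pdZ (a : R) f c : smooth f -> pd c (a *: f) = a *: pd c f.
Proof.
move=> sf; apply/funext => p; rewrite /pd !fctE.
rewrite derive1E [in RHS]derive1E; apply: deriveMl.
exact: smooth_derivable.
Qed.

Lemma pdM f g c : smooth f -> smooth g ->
  pd c (f * g) = pd c f * g + f * pd c g.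
Proof.
move=> sf sg; apply/funext => p; rewrite /pd !fctE.
rewrite !derive1E.
have -> : (fun s : R => f (upd p c s) * g (upd p c s)) = slice f p c * slice g p c.
  by [].
rewrite deriveM; [|exact: smooth_derivable..].
rewrite !upd_id addrC; congr (_ + _); exact: mulrC.
Qed.

Lemma dependsD f g : depends_on_finitely_many f -> depends_on_finitely_many g ->
  depends_on_finitely_many (f + g).
Proof.
move=> [A fA] [B gB]; exists (A ++ B) => p q pq; rewrite !fctE.
rewrite (fA p q) ?(gB p q)// => b bA; apply: pq; rewrite mem_cat bA ?orbT//.
Qed.

Lemma dependsM f g : depends_on_finitely_many f -> depends_on_finitely_many g ->
  depends_on_finitely_many (f * g).
Proof.
move=> [A fA] [B gB]; exists (A ++ B) => p q pq; rewrite !fctE.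
rewrite (fA p q) ?(gB p q)// => b bA; apply: pq; rewrite mem_cat bA ?orbT//.
Qed.

Lemma smooth_cst (a : R) : smooth (cst a : point -> R).
Proof.
apply: (@smooth_coind (fun f => exists b : R, f = cst b)); last by exists a.
move=> _ [b ->]; split.
- by exists [::].
- exact: cst_continuous.
- by move=> c p; exact: derivable_cst.
- by move=> c; exists 0; apply/funext => p; rewrite /pd derive1_cst.
Qed.

Lemma smooth_proj c : smooth (fun p => p c).
Proof.
apply: (@smooth_coind (fun f => f = (fun p => p c) \/ smooth f)); last by left.
move=> f [->|sf]; last first.
  split; [by case: sf| exact: smooth_continuous
         | by move=> *; exact: smooth_derivable|].
  by move=> d; right; exact: smooth_pd.
split.
- by exists [:: c] => p q; apply; rewrite inE.
- exact: (@proj_continuous I (fun=> R) c).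
- move=> d p; rewrite /upd; case: eqP => _; first exact: derivable_id.
  exact: derivable_cst.
- move=> d; right; rewrite (_ : pd d _ = cst (c == d)%:R); last first.
    apply/funext => p; rewrite /pd /upd; case: eqP => _.
      by rewrite derive1E derive_id.
    by rewrite derive1_cst.
  exact: smooth_cst.
Qed.

Lemma smooth_depends f : smooth f -> depends_on_finitely_many f.
Proof. by case. Qed.

Opaque pd smooth.

Inductive smooth_comb : (point -> R) -> Prop :=
| comb_mul f g : smooth f -> smooth g -> smooth_comb (f * g)
| comb_add f g : smooth_comb f -> smooth_comb g -> smooth_comb (f + g).

Lemma smooth_comb_smooth f : smooth_comb f -> smooth f.
Proof.
apply: smooth_coind => {}f.
elim=> {f} [f g sf sg|f g _ [fd fc fder fpd] _ [gd gc gder gpd]].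
- split.
  + by apply: dependsM; exact: smooth_depends.
  + move=> p; apply: (@continuousM _ {ptws I -> R} f g p);
      exact: smooth_continuous.
  + by move=> c p; apply: derivableM; exact: smooth_derivable.
  + move=> c; rewrite (pdM c sf sg).
    exact: comb_add (comb_mul (smooth_pd c sf) sg)
                    (comb_mul sf (smooth_pd c sg)).
- split.
  + exact: dependsD.
  + move=> p; exact: (@continuousD R R {ptws I -> R} f g p (fc p) (gc p)).
  + by move=> c p; apply: derivableD.
  + move=> c; rewrite (pdD' c fder gder).
    exact: comb_add.
Qed.

Lemma smoothM f g : smooth f -> smooth g -> smooth (f * g).
Proof. by move=> sf sg; apply/smooth_comb_smooth/comb_mul. Qed.

Lemma smoothZ (a : R) f : smooth f -> smooth (a *: f).
Proof. by move=> sf; apply: (smoothM (smooth_cst a) sf). Qed.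

Lemma smoothD f g : smooth f -> smooth g -> smooth (f + g).
Proof.
move=> sf sg; rewrite -[f]mul1r -[g]mul1r; apply: smooth_comb_smooth.
have s1 : smooth (1 : point -> R) := smooth_cst 1.
exact: comb_add (comb_mul s1 sf) (comb_mul s1 sg).
Qed.

Lemma smooth0 : smooth (0 : point -> R). Proof. exact: (smooth_cst 0). Qed.

Lemma smoothN f : smooth f -> smooth (- f).
Proof. by move=> sf; rewrite -scaleN1r; exact: smoothZ. Qed.

Lemma smooth_sum (T : Type) (r : seq T) (F : T -> point -> R) :
  (forall i, smooth (F i)) -> smooth (\sum_(i <- r) F i).
Proof.
move=> sF; apply: (big_ind _ smooth0 smoothD) => i _; exact: sF.
Qed.

Lemma vactE (V : point -> point) f (A : {fset I}) :
  (forall p q, {in A, p =1 q} -> f p = f q) ->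
  vact V f = \sum_(c <- A) (fun p => V p c) * pd c f.
Proof.
move=> fA; apply/funext => p; rewrite /vact (fsbigTE A); last first.
  move=> i iA; rewrite (@pd_support f (enum_fset A))// ?mulr0//.
by rewrite fct_sumE.
Qed.

Lemma smooth_fset f : smooth f -> exists A : {fset I},
  forall p q, {in A, p =1 q} -> f p = f q.
Proof.
move=> /smooth_depends[A fA]; exists [fset x in A]%fset => p q pq; apply: fA => b bA.
by apply: pq; rewrite in_fset.
Qed.

Definition smooth_vf (V : point -> point) := forall c, smooth (fun p => V p c).

Lemma smooth_vact V f : smooth_vf V -> smooth f -> smooth (vact V f).
Proof.
move=> sV sf; have [A fA] := smooth_fset sf; rewrite (vactE _ fA).
by apply: smooth_sum => c; exact: smoothM (sV c) (smooth_pd c sf).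
Qed.

Lemma smooth_fset2 f g : smooth f -> smooth g -> exists A : {fset I},
  [/\ forall p q, {in A, p =1 q} -> f p = f q &
      forall p q, {in A, p =1 q} -> g p = g q].
Proof.
move=> /smooth_fset[A fA] /smooth_fset[B gB]; exists (A `|` B)%fset.
split=> p q pq; [apply: fA|apply: gB] => b bA; apply: pq;
  by rewrite in_fsetU bA ?orbT.
Qed.

Lemma vact_lin V (a : R) f g : smooth f -> smooth g ->
  vact V (a *: f + g) = a *: vact V f + vact V g.
Proof.
move=> sf sg; have [A [fA gA]] := smooth_fset2 sf sg.
rewrite (vactE _ fA) (vactE _ gA) (@vactE _ _ A); last first.
  by move=> p q pq; rewrite !fctE (fA p q)// (gA p q).
rewrite scaler_sumr -big_split; apply: eq_bigr => c _ /=.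
rewrite (pdD c (smoothZ a sf) sg) (pdZ a c sf).
by apply/funext => p; rewrite !fctE mulrDr mulrCA.
Qed.

End Smooth.

(* U indexes the derivatives of u: Cu (a, i) is u_{a,i} on J^oo(R^2, R), where
   U = nat * nat, and Cu i is u_i on the equation manifold, where U = nat. *)
Variant jet_coord (U : Type) := Ct | Cx | Cu of U.
Arguments Ct {U}.
Arguments Cx {U}.

Section CoordChoice.
Variable U : choiceType.

Definition jet_coord_code (c : jet_coord U) : bool + U :=
  match c with Ct => inl false | Cx => inl true | Cu k => inr k end.

Definition jet_coord_decode (x : bool + U) : jet_coord U :=
  match x with inl b => if b then Cx else Ct | inr k => Cu k end.

Lemma jet_coord_codeK : cancel jet_coord_code jet_coord_decode.
Proof. by case. Qed.

HB.instance Definition _ := Choice.copy (jet_coord U) (can_type jet_coord_codeK).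

End CoordChoice.

Section Submodule.
Variables (R : pzRingType) (V : lmodType R) (S : submodClosed V).

Record submod := Submod { submod_val : V; _ : submod_val \in S }.

HB.instance Definition _ := [isSub for submod_val].
HB.instance Definition _ := [Choice of submod by <:].
HB.instance Definition _ := [SubChoice_isSubLmodule of submod by <:].

End Submodule.

Section QuotientModule.
Variables (R : pzRingType) (V : lmodType R) (S : submodClosed V).

Definition submod_pred : V -> bool := fun x => x \in S.

Fact submod_pred_zmod_closed : zmod_closed submod_pred.
Proof. exact: GRing.submod_closedB (GRing.submodClosedP S). Qed.

HB.instance Definition _ :=
  GRing.isZmodClosed.Build V submod_pred submod_pred_zmod_closed.

Definition quotmod := Quotient.quot (GRing.ZmodClosed.clone V submod_pred _).

HB.instance Definition _ := ZmodQuotient.on quotmod.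

Definition quotmod_scale (a : R) (x : quotmod) : quotmod :=
  \pi_quotmod (a *: repr x).

Lemma quotmod_eqP (x y : V) :
  reflect (\pi_quotmod x = \pi_quotmod y) (x - y \in S).
Proof.
have -> : (x - y \in S) = (\pi_quotmod x == \pi_quotmod y).
  exact: (Quotient.idealrBE (GRing.ZmodClosed.clone V submod_pred _)).
exact: eqP.
Qed.

Lemma pi_quotmodZ a x : \pi_quotmod (a *: x) = quotmod_scale a (\pi_quotmod x).
Proof.
apply/quotmod_eqP; rewrite -scalerBr rpredZ//.
by apply/quotmod_eqP; rewrite reprK.
Qed.

Lemma quotmodP (x : quotmod) : exists y : V, x = \pi_quotmod y.
Proof. by exists (repr x); rewrite reprK. Qed.

Lemma pi_quotmodD x y :
  \pi_quotmod (x + y) = \pi_quotmod x + \pi_quotmod y.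
Proof. by rewrite raddfD. Qed.

Fact quotmod_scaleA a b x :
  quotmod_scale a (quotmod_scale b x) = quotmod_scale (a * b) x.
Proof.
have [y ->] := quotmodP x.
by rewrite -(pi_quotmodZ b y) -(pi_quotmodZ a) -(pi_quotmodZ _ y) scalerA.
Qed.

Fact quotmod_scale1 : left_id 1 quotmod_scale.
Proof.
by move=> x; have [y ->] := quotmodP x; rewrite -(pi_quotmodZ 1 y) scale1r.
Qed.

Fact quotmod_scaleDr : right_distributive quotmod_scale +%R.
Proof.
move=> a x z; have [y ->] := quotmodP x; have [t ->] := quotmodP z.
rewrite -pi_quotmodD -(pi_quotmodZ a (y + t)) -(pi_quotmodZ a y).
by rewrite -(pi_quotmodZ a t) -pi_quotmodD scalerDr.
Qed.

Fact quotmod_scaleDl x : {morph quotmod_scale^~ x : a b / a + b}.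
Proof.
move=> a b; have [y ->] := quotmodP x.
rewrite -(pi_quotmodZ _ y) -(pi_quotmodZ a y) -(pi_quotmodZ b y).
by rewrite -pi_quotmodD scalerDl.
Qed.

HB.instance Definition _ := GRing.Zmodule_isLmodule.Build R quotmod
  quotmod_scaleA quotmod_scale1 quotmod_scaleDr quotmod_scaleDl.

End QuotientModule.

Section Jets.
Variable R : realType.
Local Notation jpoint := (jet_coord (nat * nat) -> R).
Local Notation epoint := (jet_coord nat -> R).
Implicit Types (f L D : jpoint -> R) (r : nat -> epoint -> R).

Definition Dt_vf (p : jpoint) : jpoint := fun c =>
  match c with Ct => 1 | Cx => 0 | Cu (a, i) => p (Cu (a.+1, i)) end.

Definition Dx_vf (p : jpoint) : jpoint := fun c =>
  match c with Ct => 0 | Cx => 1 | Cu (a, i) => p (Cu (a, i.+1)) end.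

Definition Dt := vact Dt_vf.
Definition Dx := vact Dx_vf.

Definition euler L : jpoint -> R := fun p =>
  \sum_(k \in [set: nat * nat])
    (-1) ^+ (k.1 + k.2) * iter k.2 Dx (iter k.1 Dt (pd (Cu k) L)) p.

(* A function of (t, x, u, u_1, ...) regarded as a function on J^oo(R^2, R). *)
Definition pull (h : epoint -> R) : jpoint -> R := fun p =>
  h (fun c => match c with Ct => p Ct | Cx => p Cx | Cu i => p (Cu (0%N, i)) end).

(* r stands for sum_i r_i D_x^i. *)
Definition is_diffop r :=
  (forall i, smooth (r i)) /\ exists k : nat, forall i, (k < i)%N -> r i = 0.

Definition opact r f : jpoint -> R := fun p =>
  \sum_(i \in [set: nat]) pull (r i) p * iter i Dx f p.

Definition opadj r f : jpoint -> R := fun p =>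
  \sum_(i \in [set: nat]) iter i (fun g => - Dx g) (pull (r i) * f) p.

Definition skew_adjoint r := forall f, smooth f -> opadj r f = - opact r f.

Definition is_variational D r :=
  is_diffop r /\ exists L, smooth L /\ opact r D = euler L.

Definition evolution (K : epoint -> R) : jpoint -> R :=
  fun p => p (Cu (1, 0)%N) - pull K p.

End Jets.

Section EquationManifold.
Variable R : realType.
Local Notation epoint := (jet_coord nat -> R).
Local Notation eform := (dform R (jet_coord nat)).
Variable K : epoint -> R.

Definition X_vf (p : epoint) : epoint := fun c =>
  match c with Ct => 0 | Cx => 1 | Cu i => p (Cu i.+1) end.

Definition T_vf (p : epoint) : epoint := fun c =>
  match c with Ct => 1 | Cx => 0 | Cu i => iter i (vact X_vf) K p end.

Definition dt : eform 1 := fun p v => v ord0 Ct.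

Definition dx : eform 1 := fun p v => v ord0 Cx.

Definition theta (i : nat) : eform 1 := fun p v =>
  v ord0 (Cu i) - iter i (vact X_vf) K p * dt p v - p (Cu i.+1) * dx p v.

Definition dH n (w : eform n) : eform n.+1 :=
  wedge1 dx (lie X_vf w) + wedge1 dt (lie T_vf w).

Fixpoint contact_monomial (s : nat) : eform s -> Prop :=
  match s with
  | 0 => fun w => exists2 f, smooth f & w = fun p _ => f p
  | s'.+1 => fun w => exists i : nat,
      exists2 w', contact_monomial w' & w = wedge1 (theta i) w'
  end.

Fixpoint monomial (r s : nat) : eform (r + s) -> Prop :=
  match r with
  | 0 => @contact_monomial s
  | r'.+1 => fun w => exists2 w', @monomial r' s w' &
      w = wedge1 dt w' \/ w = wedge1 dx w'
  end.

(* Omega^{r,s}, as forms of degree r + s. *)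
Definition Omega (r s : nat) (w : eform (r + s)) := exists l : seq (eform (r + s)),
  (forall w', w' \in l -> monomial w') /\ w = \sum_(w' <- l) w'.

Definition dH_exact (r s : nat) : eform (r + s) -> Prop :=
  match r with
  | 0 => fun w => w = 0
  | r'.+1 => fun w => exists2 h : eform (r' + s), @Omega r' s h & w = dH h
  end.

Definition epsilon (r : nat -> epoint -> R) : eform 1 := fun p v =>
  - 2^-1 * \sum_(i \in [set: nat]) r i p * theta i p v.

Definition omega (n : nat) (r : nat -> epoint -> R) : eform 3 :=
  wedge1 dx (wedge1 (theta 0) (epsilon r))
  - wedge1 dt (\sum_(1 <= j < n.+1) \sum_(1 <= a < j.+1)
      wedge1 (iter a.-1 (fun e => - lie X_vf e) (fmul (pd (Cu j) K) (epsilon r)))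
            (theta (j - a))).

End EquationManifold.

Record smooth_fun (R : realType) (I : choiceType) := SmoothFun {
  smooth_fun_val :> (I -> R) -> R;
  smooth_funP : smooth smooth_fun_val }.

Section VariationalOperators.
Variables (R : realType) (D : (jet_coord (nat * nat) -> R) -> R).
Local Notation jpoint := (jet_coord (nat * nat) -> R).
Local Notation epoint := (jet_coord nat -> R).
Local Notation Dt := (@Dt R).
Local Notation Dx := (@Dx R).
Opaque pd smooth.

Lemma smooth_Dx_vf : smooth_vf (@Dx_vf R).
Proof.
case=> [||[a i]] /=; [exact: smooth_cst|exact: smooth_cst|].
exact: smooth_proj.
Qed.

Lemma smooth_Dt_vf : smooth_vf (@Dt_vf R).
Proof.
case=> [||[a i]] /=; [exact: smooth_cst|exact: smooth_cst|].
exact: smooth_proj.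
Qed.

Lemma smooth_iter_vact (I : choiceType) (V : (I -> R) -> I -> R) f i :
  smooth_vf V -> smooth f -> smooth (iter i (vact V) f).
Proof.
by move=> sV sf; elim: i => [|i sfi]; [exact: sf|exact: smooth_vact sV sfi].
Qed.

Lemma vact0 (I : choiceType) (V : (I -> R) -> I -> R) : vact V 0 = 0.
Proof.
have := vact_lin V (-1) (@smooth0 R I) (@smooth0 R I).
by rewrite scaler0 addr0 scaleN1r addNr.
Qed.

Lemma iter_vact0 (I : choiceType) (V : (I -> R) -> I -> R) i :
  iter i (vact V) 0 = 0.
Proof. by elim: i => //= i ->; exact: vact0. Qed.

Lemma iter_vact_lin (I : choiceType) (V : (I -> R) -> I -> R) (a : R) f g i :
  smooth_vf V -> smooth f -> smooth g ->
  iter i (vact V) (a *: f + g) = a *: iter i (vact V) f + iter i (vact V) g.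
Proof.
move=> sV sf sg; elim: i => [//|i ih]; rewrite !iterS ih.
exact: vact_lin (smooth_iter_vact i sV sf) (smooth_iter_vact i sV sg).
Qed.

Lemma euler_support (A : {fset jet_coord (nat * nat)}) (L : jpoint -> R) p :
  (forall p q, {in A, p =1 q} -> L p = L q) ->
  let B := [fset k in pmap (fun c => if c is Cu k then Some k else None) A]%fset in
  euler L p = \sum_(k <- B)
    (-1) ^+ (k.1 + k.2) * iter k.2 Dx (iter k.1 Dt (pd (Cu k) L)) p.
Proof.
move=> LA B; rewrite /euler (fsbigTE B)// => k kB.
have -> : pd (Cu k) L = 0.
  apply/funext => q; apply: (@pd_support _ _ _ (enum_fset A)) => //.
  apply: contra kB => kA; rewrite in_fset mem_pmap; apply/mapP.
  by exists (Cu k).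
by rewrite /Dt /Dx !iter_vact0 mulr0.
Qed.

Lemma euler_lin (a : R) (L M : jpoint -> R) : smooth L -> smooth M ->
  euler (a *: L + M) = a *: euler L + euler M.
Proof.
move=> sL sM; have [A [LA MA]] := smooth_fset2 sL sM.
apply/funext => p; rewrite !fctE (euler_support p LA) (euler_support p MA).
rewrite (@euler_support A (a *: L + M)); last first.
  by move=> q q' qq'; rewrite !fctE (LA q q')// (MA q q').
rewrite scaler_sumr -big_split; apply: eq_bigr => k _ /=.
have sdL := smooth_pd (Cu k) sL; have sdM := smooth_pd (Cu k) sM.
rewrite (pdD (Cu k) (smoothZ a sL) sM) (pdZ a (Cu k) sL) /Dt /Dx.
rewrite (iter_vact_lin a k.1 smooth_Dt_vf sdL sdM).
rewrite (iter_vact_lin a k.2 smooth_Dx_vf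
  (smooth_iter_vact k.1 smooth_Dt_vf sdL) (smooth_iter_vact k.1 smooth_Dt_vf sdM)).
by rewrite !fctE mulrDr mulrCA.
Qed.

Lemma opact_support (A : {fset nat}) (r : nat -> epoint -> R) f p :
  (forall i, i \notin A -> r i = 0) ->
  opact r f p = \sum_(i <- A) pull (r i) p * iter i Dx f p.
Proof.
by move=> rA; rewrite /opact (fsbigTE A)// => i /rA ->; rewrite mul0r.
Qed.

Lemma diffop_support2 (r r' : nat -> epoint -> R) :
  is_diffop r -> is_diffop r' ->
  exists A : {fset nat}, forall i, i \notin A -> r i = 0 /\ r' i = 0.
Proof.
move=> [_ [k rk]] [_ [k' rk']]; exists [fset i in iota 0 (k + k').+1]%fset => i.
rewrite in_fset mem_iota add0n/= -leqNgt => ki.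
by split; [apply: rk|apply: rk']; apply: leq_trans ki; rewrite ltnS ?leq_addr ?leq_addl.
Qed.

Lemma opact_lin (a : R) r r' f : is_diffop r -> is_diffop r' ->
  opact (a *: r + r') f = a *: opact r f + opact r' f.
Proof.
move=> dr dr'; have [A rA] := diffop_support2 dr dr'.
apply/funext => p; rewrite !fctE.
rewrite (@opact_support A r) => [|i /rA[]//].
rewrite (@opact_support A r') => [|i /rA[]//].
rewrite (@opact_support A (a *: r + r')) ; last first.
  move=> i /rA[ri ri'].
  by rewrite addrfctE scalrfctE ri ri' scaler0 addr0.
rewrite scaler_sumr -big_split; apply: eq_bigr => i _ /=.
have -> : pull ((a *: r + r') i) p = a * pull (r i) p + pull (r' i) p by [].
by rewrite mulrDl -mulrA.
Qed.

Lemma diffop0 : is_diffop (0 : nat -> epoint -> R).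
Proof. by split; [move=> i; exact: smooth0|exists 0]. Qed.

Lemma diffop_lin (a : R) (r r' : nat -> epoint -> R) :
  is_diffop r -> is_diffop r' -> is_diffop (a *: r + r').
Proof.
move=> [sr [k rk]] [sr' [k' rk']]; split.
  by move=> i; exact: smoothD (smoothZ a (sr i)) (sr' i).
exists (k + k')%N => i ki; rewrite addrfctE scalrfctE.
rewrite rk ?rk' ?scaler0 ?addr0//.
  exact: leq_ltn_trans (leq_addl _ _) ki.
exact: leq_ltn_trans (leq_addr _ _) ki.
Qed.

Definition variational_pred : (nat -> epoint -> R) -> bool :=
  fun r => `[< is_variational D r >].

Fact variational_submod_closed : submod_closed variational_pred.
Proof.
have opact0 : opact (0 : nat -> epoint -> R) D = 0.
  have := opact_lin (-1) D diffop0 diffop0.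
  by rewrite scaler0 addr0 scaleN1r addNr.
have euler0 : euler (0 : jpoint -> R) = 0.
  have := euler_lin (-1) (@smooth0 R _) (@smooth0 R _).
  by rewrite scaler0 addr0 scaleN1r addNr.
split.
  apply/asboolP; split; first exact: diffop0.
  by exists 0; rewrite opact0 euler0; split; first exact: smooth0.
move=> a r r' /asboolP[dr [L [sL rL]]] /asboolP[dr' [M [sM rM]]].
apply/asboolP; split; first exact: diffop_lin.
exists (a *: L + M); split; first exact: smoothD (smoothZ a sL) sM.
by rewrite (opact_lin a D dr dr') rL rM (euler_lin a sL sM).
Qed.

HB.instance Definition _ :=
  GRing.isSubmodClosed.Build R (nat -> epoint -> R) variational_pred
    variational_submod_closed.

(* V_op(D), as a vector space over R. *)
Definition Vop := submod (GRing.SubmodClosed.clone R _ variational_pred _).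

HB.instance Definition _ := GRing.Lmodule.on Vop.
HB.instance Definition _ := SubType.on Vop.

End VariationalOperators.


Section FormTheory.
Variables (R : realType) (I : choiceType).
Local Notation point := (I -> R).
Opaque pd smooth.

Definition smooth_form n (w : dform R I n) := forall v, smooth (fun p => w p v).

Lemma wedge_lin n (e : dform R I 1) (a : R) (w w' : dform R I n) :
  wedge1 e (a *: w + w') = a *: wedge1 e w + wedge1 e w'.
Proof.
apply/funext => p; apply/funext => v.
transitivity (a * wedge1 e w p v + wedge1 e w' p v); last by [].
rewrite /wedge1.
rewrite mulr_sumr -big_split; apply: eq_bigr => i _ /=.
have -> : (a *: w + w') p (fun j => v (lift i j)) =
  a * w p (fun j => v (lift i j)) + w' p (fun j => v (lift i j)) by [].
by rewrite mulrDr mulrCA.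
Qed.

Lemma lie_lin n V (a : R) (w w' : dform R I n) : smooth_form w -> smooth_form w' ->
  lie V (a *: w + w') = a *: lie V w + lie V w'.
Proof.
move=> sw sw'; apply/funext => p; apply/funext => v.
transitivity (a * lie V w p v + lie V w' p v); last by [].
rewrite /lie.
rewrite mulrDr addrACA; congr (_ + _).
  rewrite [X in vact V X](_ : _ =
    a *: (fun q => w q v) + (fun q => w' q v))//.
  by rewrite (vact_lin V a (sw v) (sw' v)).
by rewrite mulr_sumr -big_split.
Qed.

Lemma wedge0 n (e : dform R I 1) : wedge1 e (0 : dform R I n) = 0.
Proof.
have := wedge_lin e (-1) (0 : dform R I n) 0.
by rewrite scaler0 addr0 scaleN1r addNr.
Qed.

Lemma wedgeZ n (e : dform R I 1) (a : R) (w : dform R I n) :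
  wedge1 e (a *: w) = a *: wedge1 e w.
Proof. by have := wedge_lin e a w 0; rewrite !addr0 wedge0 addr0. Qed.

Lemma smooth_wedge n (e : dform R I 1) (w : dform R I n) :
  smooth_form e -> smooth_form w -> smooth_form (wedge1 e w).
Proof.
move=> se sw v.
have -> : (fun p => wedge1 e w p v) = \sum_(i < n.+1)
    ((-1) ^+ i *: ((fun p => e p (fun=> v i)) *
                   (fun p => w p (fun j => v (lift i j))))).
  apply/funext => p; rewrite fct_sumE; apply: eq_bigr => i _ /=.
  by rewrite -mulrA.
by apply: smooth_sum => i; exact: smoothZ (smoothM (se _) (sw _)).
Qed.

Lemma smooth_form_lin n (a : R) (w w' : dform R I n) :
  smooth_form w -> smooth_form w' -> smooth_form (a *: w + w').
Proof. by move=> sw sw' v; exact: smoothD (smoothZ a (sw v)) (sw' v). Qed.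

Lemma smooth_form0 n : smooth_form (0 : dform R I n).
Proof. by move=> v; exact: smooth0. Qed.

End FormTheory.

Section Cohomology.
Variables (R : realType) (K : smooth_fun R (jet_coord nat)) (r s : nat).
Local Notation epoint := (jet_coord nat -> R).
Local Notation eform := (dform R (jet_coord nat)).
Opaque pd smooth.

Lemma smooth_X_vf : smooth_vf (@X_vf R).
Proof.
case=> [||i] /=; [exact: smooth_cst|exact: smooth_cst|exact: smooth_proj].
Qed.

Lemma smooth_theta i : smooth_form (theta K i).
Proof.
move=> v.
have sKi := smooth_iter_vact i smooth_X_vf (smooth_funP K).
have -> : (fun p => theta K i p v) =
    cst (v ord0 (Cu i)) + - (v ord0 Ct *: iter i (vact (@X_vf R)) K)
    + - (v ord0 Cx *: (fun p => p (Cu i.+1))).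
  apply/funext => p; rewrite /theta /dt /dx.
  by rewrite [X in _ - X - _]mulrC [X in _ - X]mulrC.
have s0 := @smooth_cst R (jet_coord nat) (v ord0 (Cu i)).
have s1 := smoothN (smoothZ (v ord0 Ct) sKi).
have s2 := smoothN (smoothZ (v ord0 Cx) (@smooth_proj R _ (Cu i.+1))).
exact: smoothD (smoothD s0 s1) s2.
Qed.

Lemma smooth_dt : smooth_form (@dt R).
Proof. by move=> v; exact: smooth_cst. Qed.

Lemma smooth_dx : smooth_form (@dx R).
Proof. by move=> v; exact: smooth_cst. Qed.

Lemma smooth_contact_monomial n (w : eform n) :
  contact_monomial K w -> smooth_form w.
Proof.
elim: n w => [|n ih] w /=; first by move=> [f sf ->] v.
by move=> [i [w' /ih sw' ->]]; exact: smooth_wedge (smooth_theta i) sw'.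
Qed.

Lemma smooth_monomial m n (w : eform (m + n)) : monomial K w -> smooth_form w.
Proof.
elim: m w => [|m ih] w /=; first exact: smooth_contact_monomial.
by move=> [w' /ih sw' [->|->]];
  [exact: smooth_wedge smooth_dt sw'|exact: smooth_wedge smooth_dx sw'].
Qed.

Lemma smooth_Omega m n (w : eform (m + n)) : Omega K w -> smooth_form w.
Proof.
move=> [l [lm ->]]; elim: l lm => [|x l ih] lm.
  by rewrite big_nil; exact: smooth_form0.
rewrite big_cons -[x]scale1r; apply: smooth_form_lin.
  by apply: smooth_monomial; apply: lm; rewrite mem_head.
by apply: ih => y yl; apply: lm; rewrite inE yl orbT.
Qed.

Lemma contact_monomialZ (a : R) n (w : eform n) :
  contact_monomial K w -> contact_monomial K (a *: w).
Proof.
elim: n w => [|n ih] w /=.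
  by move=> [f sf ->]; exact: ex_intro2 _ _ (a *: f) (smoothZ a sf) erefl.
move=> [i [w' /ih w'm ->]]; exists i; exists (a *: w') => //.
by rewrite wedgeZ.
Qed.

Lemma monomialZ (a : R) m n (w : eform (m + n)) :
  monomial K w -> monomial K (a *: w).
Proof.
elim: m w => [|m ih] w /=; first exact: contact_monomialZ.
move=> [w' /ih w'm w_]; exists (a *: w') => //.
by case: w_ => ->; [left|right]; rewrite wedgeZ.
Qed.

Lemma Omega0 m n : Omega K (0 : eform (m + n)).
Proof. by exists [::]; rewrite big_nil. Qed.

Lemma Omega_lin m n (a : R) (w w' : eform (m + n)) :
  Omega K w -> Omega K w' -> Omega K (a *: w + w').
Proof.
move=> [l [lm ->]] [l' [l'm ->]]; exists ([seq a *: x | x <- l] ++ l').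
split; last by rewrite big_cat big_map scaler_sumr.
move=> x; rewrite mem_cat => /orP[/mapP[y yl ->]|]; last exact: l'm.
by apply: monomialZ; exact: lm.
Qed.

Lemma smooth_T_vf : smooth_vf (T_vf K).
Proof.
case=> [||i] /=; [exact: smooth_cst|exact: smooth_cst|].
exact: smooth_iter_vact smooth_X_vf (smooth_funP K).
Qed.

Lemma dH_lin n (a : R) (w w' : eform n) : smooth_form w -> smooth_form w' ->
  dH K (a *: w + w') = a *: dH K w + dH K w'.
Proof.
move=> sw sw'; rewrite /dH (lie_lin _ a sw sw') (lie_lin _ a sw sw').
by rewrite !wedge_lin scalerDr addrACA.
Qed.

Lemma dH0 n : dH K (0 : eform n) = 0.
Proof.
have := dH_lin (-1) (@smooth_form0 R _ n) (@smooth_form0 R _ n).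
by rewrite scaler0 addr0 scaleN1r addNr.
Qed.

Definition closed_pred : eform (r + s) -> bool :=
  fun w => `[< Omega K w /\ dH K w = 0 >].

Fact closed_submod_closed : submod_closed closed_pred.
Proof.
split; first by apply/asboolP; split; [exact: Omega0|exact: dH0].
move=> a w w' /asboolP[Ow dw] /asboolP[Ow' dw']; apply/asboolP.
split; first exact: Omega_lin.
by rewrite (dH_lin a (smooth_Omega Ow) (smooth_Omega Ow')) dw dw' scaler0 addr0.
Qed.

HB.instance Definition _ :=
  GRing.isSubmodClosed.Build R (eform (r + s)) closed_pred closed_submod_closed.

(* ker (d_H restricted to Omega^{r,s}) *)
Definition closed_forms := submod (GRing.SubmodClosed.clone R _ closed_pred _).

HB.instance Definition _ := GRing.Lmodule.on closed_forms.
HB.instance Definition _ := SubType.on closed_forms.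

Lemma dH_exact0 m n : dH_exact K (0 : eform (m + n)).
Proof.
case: m => [//|m] /=; exists 0; first exact: Omega0.
by rewrite (dH0 (m + n)).
Qed.

Lemma dH_exact_lin m n (a : R) (w w' : eform (m + n)) :
  dH_exact K w -> dH_exact K w' -> dH_exact K (a *: w + w').
Proof.
case: m w w' => [|m] w w' /=; first by move=> -> ->; rewrite scaler0 addr0.
move=> [h Oh ->] [h' Oh' ->]; exists (a *: h + h'); first exact: Omega_lin.
by rewrite (dH_lin a (smooth_Omega Oh) (smooth_Omega Oh')).
Qed.

Definition exact_pred : closed_forms -> bool :=
  fun z => `[< dH_exact K (val z) >].

Fact exact_submod_closed : submod_closed exact_pred.
Proof.
split; first by apply/asboolP; exact: dH_exact0.
move=> a z z' /asboolP zE /asboolP z'E; apply/asboolP.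
have -> : \val (a *: z + z') = a *: \val z + \val z' by rewrite linearP.
exact: dH_exact_lin zE z'E.
Qed.

HB.instance Definition _ :=
  GRing.isSubmodClosed.Build R closed_forms exact_pred exact_submod_closed.

(* H^{r,s}, with Omega^{-1,s} = 0. *)
Definition cohomology := quotmod (GRing.SubmodClosed.clone R _ exact_pred _).

HB.instance Definition _ := GRing.Lmodule.on cohomology.

Definition cohomology_class (z : closed_forms) : cohomology :=
  \pi_(quotmod (GRing.SubmodClosed.clone R _ exact_pred _)) z.

Lemma cohomology_classP (z z' : closed_forms) :
  cohomology_class z = cohomology_class z' <-> dH_exact K (val z - val z').
Proof.
have -> : \val z - \val z' = \val (z - z') by rewrite raddfB.
have eqP' := @quotmod_eqP _ _ (GRing.SubmodClosed.clone R _ exact_pred _) z z'.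
by split=> [/eqP'/asboolW|zz'] //; apply/eqP'/asboolT.
Qed.

End Cohomology.

(* Main.v *)
Require Import Defs.
From HB Require Import structures.
From mathcomp Require Import all_boot all_order all_algebra finmap ring lra zify.
From mathcomp Require Import all_classical all_reals topology normedtype derive.
From mathcomp Require Import realfun measure lebesgue_measure lebesgue_integral ftc.

Set Implicit Arguments.
Unset Strict Implicit.
Unset Printing Implicit Defensive.

Import Order.TTheory GRing.Theory Num.Theory.
Import numFieldNormedType.Exports.

Local Open Scope classical_set_scope.
Local Open Scope ring_scope.

(** Let R be the operator sum r_i X^i, let pr v be the evolutionary derivation
   with characteristic v, and put T = d/dt + pr K. Write L for the linearization
   v |-> pr v K and L+ for its formal adjoint. Both parts of the theorem turn on
   one identity between operators in X, called [symmetry] below: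

     (T + L+) R = R (T - L).

   A skew-adjoint R is variational if and only if it satisfies this identity, and
   the same identity says that the form omega is closed.

   Variational implies symmetry. The linearization of an Euler expression is
   self-adjoint ([helmholtz]). For R (u_t - K) this gives three things: comparing
   the condition at v and at t v shows that R is skew-adjoint
   ([variational_skewJ]); the coefficients of the derivatives of u_t say that a
   certain bidifferential operator built from R, its [defect], vanishes; what
   remains does not involve u_t and, given the vanishing of the defect, is
   [symmetry] ([symmetry_residue]).

   Symmetry implies variational. The function P = R (u_t - K) has the Lagrangian
   int_0^1 u P(s u) ds, provided that its linearization is self-adjoint, which
   requires the defect to vanish. For an equation of odd order at least three this
   is automatic. The symmetry condition makes the defect Z a solution of the
   transport equation (T + L+) Z(w, v) = Z(l w, v) + Z(w, l v) with l = T - L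
   ([defect_transport]). If (X^i w)(X^j v) is the leading monomial of Z, where fewer
   derivatives in total, and then fewer derivatives on w, count as lower, then the
   symbol xi^n + eta^n - (xi + eta)^n of the transport operator multiplies it by
   - n xi^(n-1) eta up to lower terms and a factor, the derivative of K in u_n. As
   this factor has no zeros and n = 2 m + 1 >= 3, it follows that Z = 0
   ([bidiff_transport0], [defect_vanishes]).

   The forms. Contracting with evolutionary vector fields identifies the contact
   form sum c_i theta^i with the operator sum c_i X^i and contact two-forms with
   alternating bidifferential operators ([rep1], [rep2]); X and T act on the latter
   by formulas in which the forms no longer occur. The dt-part of omega is made so
   that its X-derivative telescopes, whence d_H omega = dt /\ dx /\ theta^0 /\ sigma,
   where sigma corresponds to a multiple of (T + L+) R - R (T - L)
   ([presymplectic_defect]). A skew-adjoint operator S with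
   phi S(psi) - psi S(phi) in the image of X vanishes ([skew_divergence]): integrate
   by parts against 1. This shows that omega is closed only if the symmetry
   condition holds, and that omega is exact only if R = 0. Conversely, integration by
   parts brings the dx-part of any class into the form theta^0 /\ epsilon with
   epsilon skew-adjoint, and the dt-part is then determined because X is injective on
   contact two-forms ([closed_normal_form]). *)


(** * Calculus in coordinates *)

Section Analysis.
Variables (R : realType).

(** Increments estimated by the mean value theorem come in this form. *)
Lemma is_derive_littleo (f : R -> R) (x l : R) :
  (forall e : R, 0 < e -> \forall y \near x, `|f y - f x - l * (y - x)| <= e * `|y - x|) ->
  is_derive x 1 f l.
Proof.
move=> H.
have cv : h^-1 *: (f (h + x) - f x) @[h --> 0^'] --> l.
  apply/cvgrPdist_le => e e0.
  have /nbhs_ballP[d /= d0 Hd] := H e e0.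
  apply/nbhs_ballP; exists d => //= h hd h0.
  have hx : ball x d (h + x).
    move: hd; rewrite /ball/= sub0r normrN => hd.
    by rewrite opprD addrCA subrr addr0 normrN.
  have := Hd _ hx; rewrite addrK => {}Hd.
  have h0' : 0 < `|h| by rewrite normr_gt0.
  rewrite -(ler_pM2r h0') -normrM; apply: le_trans Hd.
  rewrite -[leRHS]normrN le_eqVlt; apply/orP; left; apply/eqP; congr `|_|.
  rewrite /GRing.scale/= mulrBl mulrAC mulVf// mul1r; ring.
have dv : derivable f x 1.
  by apply/cvg_ex; exists l; under eq_fun do rewrite scaler1.
apply: DeriveDef => //; rewrite /derive.
by apply: cvg_lim => //; under eq_fun do rewrite scaler1.
Qed.

End Analysis.

Section SmoothCalculus.
Variables (R : realType) (I : choiceType).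
Local Notation point := (I -> R).
Implicit Types (f g : point -> R) (p q : point) (c : I).

Lemma upd_upd p c a b : upd (upd p c a) c b = upd p c b.
Proof. by apply/funext => d; rewrite /upd; case: eqP. Qed.

Lemma upd_same p c a : upd p c a c = a.
Proof. by rewrite /upd eqxx. Qed.

Lemma upd_comm p c d a b : c != d ->
  upd (upd p c a) d b = upd (upd p d b) c a.
Proof.
move=> cd; apply/funext => e; rewrite /upd; case: (eqVneq e d) => // ->.
by rewrite eq_sym (negbTE cd).
Qed.

(** Convergence of the points may be checked one coordinate at a time. *)
Lemma smooth_cvg f (T : Type) (F : set_system T) (phi : T -> point) p :
  Filter F -> smooth f -> (forall c, phi t c @[t --> F] --> p c) ->
  f (phi t) @[t --> F] --> f p.
Proof.
move=> FF sf H.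
have cf := smooth_continuous sf.
have : (phi @ F) --> (p : {ptws I -> R}).
  apply/cvg_sup => i U.
  have /= -> := @nbhsE (initial_topology (fun q : point => q i)) p.
  move=> [B [[C oC <-] Bp] BU].
  apply: filterS BU _; apply: (H i); apply: open_nbhs_nbhs; split=> //.
by move=> /(cvg_comp _ _) /(_ (cf p)).
Qed.

Lemma is_derive_slice f p c (s : R) : smooth f ->
  is_derive s (1 : R) (fun s => f (upd p c s)) (pd c f (upd p c s)).
Proof.
move=> sf; have := @smooth_derivable _ _ f (upd p c s) c sf.
have e : (fun s0 => f (upd (upd p c s) c s0)) = (fun s => f (upd p c s)).
  by apply/funext => s0; rewrite upd_upd.
rewrite upd_same e => d; apply: DeriveDef => //.
by rewrite /pd upd_same derive1E e.
Qed.

Lemma smooth_MVT f p c a b : smooth f ->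
  exists2 z, `|z - a| <= `|b - a| &
    f (upd p c b) - f (upd p c a) = pd c f (upd p c z) * (b - a).
Proof.
move=> sf.
have key (x y : R) : x <= y -> exists2 z, z \in `[x, y] &
    f (upd p c y) - f (upd p c x) = pd c f (upd p c z) * (y - x).
  move=> xy; apply: (@MVT_segment R (fun s => f (upd p c s))
    (fun s => pd c f (upd p c s))) => //.
    by move=> z _; exact: is_derive_slice.
  apply: continuous_subspaceT => z.
  apply: differentiable_continuous; apply/derivable1_diffP.
  by have [] := is_derive_slice p c z sf.
case: (leP a b) => ab.
  have [z] := key a b ab; rewrite in_itv/= => /andP[az zb] ->; exists z => //.
  by rewrite !ger0_norm ?subr_ge0// lerB.
have [z] := key b a (ltW ab); rewrite in_itv/= => /andP[bz za] e; exists z.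
  by rewrite !ler0_norm ?subr_le0 ?(ltW ab)// !opprB lerB.
by rewrite -[LHS]opprB e -mulrN opprB.
Qed.

Lemma continuous_upd f p c d : smooth f -> forall a b e, 0 < e ->
  \forall t \near 0^'+, forall x y, `|x - a| <= t -> `|y - b| <= t ->
    `|f (upd (upd p c x) d y) - f (upd (upd p c a) d b)| <= e.
Proof.
move=> sf a b e e0.
have : f (upd (upd p c z.1) d z.2) @[z --> (a, b)] --> f (upd (upd p c a) d b).
  apply: smooth_cvg => // i; rewrite /upd; case: eqP => _; first exact: cvg_snd.
  by case: eqP => _; [exact: cvg_fst | exact: cvg_cst].
move/cvgrPdist_le => /(_ _ e0) /nbhs_ballP[r /= r0 Hr].
near=> t => x y xt yt; rewrite distrC; apply: (Hr (x, y)); split => /=.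
  by rewrite /ball/= distrC; apply: le_lt_trans xt _; near: t; exact: nbhs_right_lt.
by rewrite /ball/= distrC; apply: le_lt_trans yt _; near: t; exact: nbhs_right_lt.
Unshelve. all: by end_near. Qed.

Lemma upd_id2 p c d : upd (upd p c (p c)) d (p d) = p.
Proof. by rewrite upd_id upd_id. Qed.

Lemma pd_coord c d p : pd c (fun q : point => q d) p = (c == d)%:R.
Proof.
rewrite /pd /upd; case: (eqVneq d c) => _; first by rewrite derive1E derive_id.
by rewrite derive1_cst.
Qed.

Opaque pd smooth upd.

(** The second difference quotient is a mixed derivative at a nearby point: the
   mean value theorem is applied in the direction d, then in the direction c. *)
Lemma second_difference f p c d a b t : smooth f -> c != d -> 0 < t ->
  let U x y := upd (upd p c x) d y in
  exists x y, [/\ `|x - a| <= t, `|y - b| <= t &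
    f (U (a + t) (b + t)) - f (U (a + t) b) - (f (U a (b + t)) - f (U a b)) =
    pd c (pd d f) (U x y) * (t * t)].
Proof.
move=> sf cd t0 U; have sdf := smooth_pd d sf.
have sg x (y : R) : is_derive y (1 : R) (fun s => f (U x s)) (pd d f (U x y)).
  exact: is_derive_slice.
have [y yab Ey] : exists2 y, y \in `[b, b + t]%R &
   (f (U (a + t) (b + t)) - f (U a (b + t))) - (f (U (a + t) b) - f (U a b)) =
   (pd d f (U (a + t) y) - pd d f (U a y)) * (b + t - b).
  apply: (@MVT_segment R (fun y => f (U (a + t) y) - f (U a y))
    (fun y => pd d f (U (a + t) y) - pd d f (U a y))).
    by rewrite lerDl; exact: ltW.
  apply: continuous_subspaceT => z.
  apply: differentiable_continuous; apply/derivable1_diffP.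
  by have [] := is_deriveB (sg (a + t) z) (sg a z).
have [x xa Ex] := @smooth_MVT _ (upd p d y) c a (a + t) sdf.
exists x, y; split.
- by apply: le_trans xa _; rewrite addrAC subrr add0r gtr0_norm.
- move: yab; rewrite in_itv/= => /andP[by_ yb].
  by rewrite ger0_norm ?subr_ge0// lerBlDl.
- have UE z : U z y = upd (upd p d y) c z by exact: upd_comm.
  move: Ey; rewrite (UE (a + t)) (UE a) Ex -UE => Ey.
  move: (f _) (f _) (f _) (f _) (pd c _ _) Ey => A B C D E.
  rewrite (addrAC a t) (addrAC b t) !subrr !add0r; lra.
Qed.

(** Schwarz: second differences are symmetric in the two directions. *)
Lemma pd_comm f c d : smooth f -> pd c (pd d f) = pd d (pd c f).
Proof.
have [->//|cd] := eqVneq c d.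
move=> sf; apply/funext => p.
have scd := smooth_pd c (smooth_pd d sf); have sdc := smooth_pd d (smooth_pd c sf).
set a := p c; set b := p d.
have pE : p = upd (upd p c a) d b.
  by rewrite upd_id2.
apply/eqP; rewrite -subr_eq0 -normr_le0; apply/ler_addgt0Pr => e e0.
rewrite add0r.
have e20 : 0 < e / 2 by rewrite divr_gt0.
have Hcd := @continuous_upd _ p c d scd a b _ e20.
have Hdc := @continuous_upd _ p c d sdc a b _ e20.
rewrite -pE in Hcd Hdc.
(* a common radius for the continuity of both mixed derivatives *)
have [t [[/= t0 Ht1] Ht2]] := filter_ex (filterI (filterI (nbhs_right_gt 0) Hcd) Hdc).
have [x1 [y1 [x1a y1b E1]]] := second_difference p a b sf cd t0.
have dc : d != c by rewrite eq_sym.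
have [y2 [x2 [y2b x2a E2]]] := second_difference p b a sf dc t0.
have E : pd c (pd d f) (upd (upd p c x1) d y1) = pd d (pd c f) (upd (upd p c x2) d y2).
  have tn0 : t * t != 0 by rewrite mulf_neq0// gt_eqF.
  have UE x y : upd (upd p d y) c x = upd (upd p c x) d y by exact: upd_comm.
  apply: (mulIf tn0); apply: etrans (esym E1) _.
  rewrite -(UE x2 y2); apply: etrans _ E2.
  rewrite /= (UE (a + t) (b + t)) (UE (a + t) b) (UE a (b + t)) (UE a b).
  by move: (f _) (f _) (f _) (f _) => A B C D; ring.
have h1 := Ht1 _ _ x1a y1b; have h2 := Ht2 _ _ x2a y2b.
rewrite -E in h2; rewrite distrC in h1.
apply: le_trans (ler_distD (pd c (pd d f) (upd (upd p c x1) d y1)) _ _) _.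
rewrite [leRHS](splitr e); exact: lerD h1 h2.
Qed.

End SmoothCalculus.

(** * Inverting k + 1 + N for a radial derivation N *)

Section Homotopy.
Variables (R : realType) (I : choiceType) (S : pred I).
Local Notation point := (I -> R).
Implicit Types (f g : point -> R) (p q : point) (c : I).

Definition scale (s : R) p : point := fun c => if S c then s * p c else p c.

Definition radial_vf p : point := fun c => if S c then p c else 0.

Lemma scale1 p : scale 1 p = p.
Proof. by apply/funext => c; rewrite /scale mul1r if_same. Qed.

Lemma scale_upd s p c a :
  scale s (upd p c a) = upd (scale s p) c (if S c then s * a else a).
Proof.
by apply/funext => d; rewrite /scale /upd; case: (eqVneq d c) => [->|_].
Qed.

Lemma cvg_scale (T : Type) (F : set_system T) (s : T -> R) (q : T -> point)
    (s0 : R) p : Filter F -> s t @[t --> F] --> s0 ->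
  (forall c, q t c @[t --> F] --> p c) ->
  forall c, scale (s t) (q t) c @[t --> F] --> scale s0 p c.
Proof.
move=> FF ss qp c; rewrite /scale; case: (S c); last exact: qp.
exact: cvgM.
Qed.

Lemma continuous_scale f p : smooth f -> continuous (fun s => f (scale s p)).
Proof.
move=> sf s; apply: smooth_cvg => //; apply: cvg_scale; first exact: cvg_id.
by move=> c; exact: cvg_cst.
Qed.

(** The chain rule along a ray. Only the coordinates in the finite set A matter,
   and they are released one at a time. *)
Lemma is_derive_scale f p (s0 : R) (A : {fset I}) : smooth f ->
  (forall p q, {in A, p =1 q} -> f p = f q) ->
  is_derive s0 (1 : R) (fun s => f (scale s p))
    (\sum_(c <- A) radial_vf p c * pd c f (scale s0 p)).
Proof.
move=> sf fA.
pose g (B : seq I) s : point := fun c => if c \in B then scale s p c else scale s0 p c.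
have gs0 B : g B s0 = scale s0 p.
  by apply/funext => c; rewrite /g if_same.
have cg B c : g B s c @[s --> s0] --> scale s0 p c.
  rewrite /g; case: (c \in B); last exact: cvg_cst.
  by apply: cvg_scale => [|d]; [exact: cvg_id|exact: cvg_cst].
suff key (B : seq I) : uniq B -> is_derive s0 (1 : R) (fun s => f (g B s))
    (\sum_(c <- B) radial_vf p c * pd c f (scale s0 p)).
  have := key (enum_fset A) (fset_uniq A).
  rewrite (_ : (fun s => f (g _ s)) = (fun s => f (scale s p)))//.
  by apply/funext => s; apply: fA => c cA; rewrite /g cA.
elim: B => [_|c B ih /= /andP[cB uB]].
  rewrite big_nil (_ : (fun s => _) = cst (f (scale s0 p))); last first.
    by apply/funext => s; congr f; apply/funext.
  exact: is_derive_cst.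
rewrite big_cons addrC.
rewrite (_ : (fun s => f (g (c :: B) s)) =
   (fun s => f (g B s)) + (fun s => f (g (c :: B) s) - f (g B s))); last first.
  by apply/funext => s; rewrite fctE addrC subrK.
apply: is_deriveD; first exact: ih.
have gcB s : g (c :: B) s = upd (g B s) c (scale s p c).
  by apply/funext => d; rewrite /g /upd inE; case: eqP => [->|].
have gB s : g B s = upd (g B s) c (scale s0 p c).
  by apply/funext => d; rewrite {2}/g /upd; case: eqP => [->|//]; rewrite /g (negbTE cB).
apply: is_derive_littleo => e e0.
have [Sc|Sc] := boolP (S c); last first.
  near=> s; rewrite /radial_vf (negbTE Sc) mul0r mul0r subr0 !gs0 subrr subr0.
  rewrite {1}gB gcB /scale (negbTE Sc) subrr normr0.
  by rewrite mulr_ge0// ltW.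
have pc1 : 0 < `|p c| + 1 by rewrite ltr_wpDl.
pose e' := e / (`|p c| + 1).
have e'0 : 0 < e' by rewrite divr_gt0.
have cvz : \forall s \near s0, forall z : R,
   `|z - scale s0 p c| <= `|scale s p c - scale s0 p c| ->
   `|pd c f (upd (g B s) c z) - pd c f (scale s0 p)| <= e'.
  have : pd c f (upd (g B sz.1) c sz.2) @[sz --> (s0, scale s0 p c)] --> pd c f (scale s0 p).
    apply: smooth_cvg; first exact: smooth_pd.
    move=> d; rewrite /upd; case: eqP => [->|_]; first exact: cvg_snd.
    exact: cvg_comp cvg_fst (cg B d).
  move/cvgrPdist_le => /(_ _ e'0) /nbhs_ballP[r /= r0 Hr].
  have cs : scale s p c @[s --> s0] --> scale s0 p c.
    by apply: cvg_scale => [|d]; [exact: cvg_id|exact: cvg_cst].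
  near=> s => z zs; rewrite distrC; apply: (Hr (s, z)); split => /=.
    by near: s; exact: nbhsx_ballx.
  rewrite /ball/= distrC; apply: le_lt_trans zs _.
  by near: s; exact: (cvgr_distC_lt _ _ cs).
near=> s.
rewrite !gs0 subrr subr0 gcB {2}gB.
have [z zs ->] := smooth_MVT (g B s) c (scale s0 p c) (scale s p c) sf.
have -> : scale s p c - scale s0 p c = p c * (s - s0).
  by rewrite /scale Sc; ring.
rewrite /radial_vf Sc (mulrC (p c) (pd _ _ _)) -(mulrA _ (p c)) -mulrBl normrM.
have Hz : `|pd c f (upd (g B s) c z) - pd c f (scale s0 p)| <= e'.
  by have := zs; move: z {zs}; near: s.
rewrite normrM mulrA ler_wpM2r//.
apply: (@le_trans _ _ (e' * `|p c|)); first by rewrite ler_wpM2r.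
rewrite /e' mulrAC ler_pdivrMr// ler_wpM2l ?ltW//.
by rewrite ltrDl.
Unshelve. all: by end_near. Qed.

Lemma vact_scale f p s : smooth f ->
  exists2 d, is_derive s (1 : R) (fun s => f (scale s p)) d &
    s * d = vact radial_vf f (scale s p).
Proof.
move=> sf; have [A fA] := smooth_fset sf.
exists (\sum_(c <- A) radial_vf p c * pd c f (scale s p)).
  exact: is_derive_scale.
rewrite (vactE _ fA) fct_sumE mulr_sumr; apply: eq_bigr => c _.
rewrite fctE mulrA; congr (_ * _); rewrite /radial_vf /scale; case: (S c) => //.
by rewrite mulr0.
Qed.

(** The function s^(k+1) g(s p) of s is constant and vanishes at s = 0. *)
Lemma radial_inj k g : smooth g -> k.+1%:R *: g + vact radial_vf g = 0 -> g = 0.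
Proof.
move=> sg H; apply/funext => p.
pose phi := fun s : R => s ^+ k.+1 * g (scale s p).
have dphi (s : R) : s != 0 -> is_derive s (1 : R) phi 0.
  move=> s0; have [d dd dE] := vact_scale p s sg.
  have dX : is_derive s (1 : R) ((fun x : R => x) ^+ k.+1) (k.+1%:R * s ^+ k).
    by apply: is_derive_eq (is_deriveX k.+1 (is_derive_id s (1 : R))) _; rewrite /GRing.scale/= mulr1.
  have := is_deriveM dX dd.
  rewrite (_ : GRing.mul _ _ = phi); last by apply/funext => x; rewrite /phi !fctE.
  rewrite (_ : _ + _ = 0)//; apply: (mulfI s0); rewrite mulr0.
  have := congr1 (fun h => h (scale s p)) H; rewrite !fctE -dE /GRing.scale/=.
  move: (g _) => gs {}H.
  transitivity (s ^+ k.+1 * (k.+1%:R * gs + s * d)); last first.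
    by rewrite [X in _ * X]H mulr0.
  by rewrite !exprS; ring.
have cphi : continuous phi.
  by move=> s; rewrite /phi; apply: cvgM; [exact: exprn_continuous|exact: continuous_scale].
have d01 (x : R) : x \in `]0, 1[%R -> is_derive x (1 : R) phi 0.
  by rewrite in_itv/= => /andP[x0 _]; apply: dphi; rewrite gt_eqF.
have [z _] := MVT ltr01 d01 (continuous_subspaceT cphi).
by rewrite mul0r /phi expr1n mul1r scale1 expr0n/= mul0r subr0 => ->.
Qed.

Local Notation mu := (@lebesgue_measure R).

Lemma continuous_integrable01 (h : R -> R) : continuous h ->
  mu.-integrable `[0, 1] (EFin \o h).
Proof.
move=> ch; apply: continuous_compact_integrable; first exact: segment_compact.
exact: continuous_subspaceT.
Qed.

Lemma le_Rintegral01 (h : R -> R) (e : R) : continuous h ->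
  (forall s : R, 0 <= s <= 1 -> `|h s| <= e) -> `|\int[mu]_(s in `[0, 1]) h s| <= e.
Proof.
move=> ch he; apply: le_trans (le_normr_Rintegral _ (continuous_integrable01 ch)) _ => //.
have -> : e = \int[mu]_(s in `[0, 1]) (fun=> e) s.
  have mu01 : mu `[0, 1] = 1%E.
    by rewrite lebesgue_measure_itv/= lte_fin ltr01 -EFinD subr0.
  by rewrite Rintegral_cst// [X in fine X]mu01 mulr1.
apply: le_Rintegral => //=.
- apply: (@continuous_integrable01 (fun s => `|h s|)) => s.
  by apply: cvg_norm; exact: ch.
- by apply: continuous_integrable01 => s; exact: cvg_cst.
Qed.

(** The inverse of k + 1 + N, where N is the radial derivation. *)
Definition homotopy k f : point -> R := fun p =>
  \int[mu]_(s in `[0, 1]) (s ^+ k * f (scale s p)).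

Lemma continuous_homotopy_integrand k f p : smooth f ->
  continuous (fun s : R => s ^+ k * f (scale s p)).
Proof.
by move=> sf s; apply: cvgM; [exact: exprn_continuous|exact: continuous_scale].
Qed.

(** Compactness of [0, 1] makes continuity uniform in the scaling parameter; this
   is what limits under the integral sign need. *)
Lemma near_scale f (T : Type) (F : set_system T) (q : T -> point) p e :
  Filter F -> smooth f -> (forall c, q t c @[t --> F] --> p c) -> 0 < e ->
  \forall t \near F, forall s : R, 0 <= s <= 1 -> `|f (scale s (q t)) - f (scale s p)| <= e.
Proof.
move=> FF sf qp e0; have e20 : 0 < e / 2 by rewrite divr_gt0.
have cov (s : R) : (`[0, 1]%classic : set R) s -> \forall s' \near s & t \near F,
    `|f (scale s' (q t)) - f (scale s' p)| <= e.
  move=> _.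
  have h1 : f (scale z.1 (q z.2)) @[z --> (nbhs s, F)] --> f (scale s p).
    apply: smooth_cvg => //; apply: cvg_scale; first exact: cvg_fst.
    by move=> c; exact: cvg_comp cvg_snd (qp c).
  have h2 : f (scale z.1 p) @[z --> (nbhs s, F)] --> f (scale s p).
    apply: smooth_cvg => //; apply: cvg_scale; first exact: cvg_fst.
    by move=> c; exact: cvg_cst.
  have H : (f (scale z.1 (q z.2)) - f (scale z.1 p)) @[z --> (nbhs s, F)] --> (0 : R).
    by rewrite -(subrr (f (scale s p))); exact: cvgB.
  have [P [P1 P2] PQ] : nbhs (nbhs s, F) (fun z : R * T =>
      `|0 - (f (scale z.1 (q z.2)) - f (scale z.1 p))| <= e).
    exact: (cvgr_dist_le _ _ H _ e0).
  by exists P => // z /PQ /=; rewrite sub0r normrN.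
have := (compact_near_coveringP _).1 (@segment_compact R 0 1) _ _ _ FF cov.
by apply: filterS => t H s s01; apply: H; rewrite /= in_itv.
Qed.

Lemma RintegralB01 (g h : R -> R) : continuous g -> continuous h ->
  \int[mu]_(s in `[0, 1]) (g s - h s) =
  \int[mu]_(s in `[0, 1]) g s - \int[mu]_(s in `[0, 1]) h s.
Proof. by move=> cg ch; apply: RintegralB => //; exact: continuous_integrable01. Qed.

Lemma expr01_le1 (s : R) k : 0 <= s <= 1 -> `|s ^+ k| <= 1.
Proof. by move=> /andP[s0 s1]; rewrite ger0_norm ?exprn_ge0// exprn_ile1. Qed.

Lemma cvg_homotopy k f (T : Type) (F : set_system T) (q : T -> point) p :
  Filter F -> smooth f -> (forall c, q t c @[t --> F] --> p c) ->
  homotopy k f (q t) @[t --> F] --> homotopy k f p.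
Proof.
move=> FF sf qp; apply/cvgrPdist_le => e e0.
have := near_scale FF sf qp e0; apply: filterS => t H /=.
rewrite distrC /homotopy -RintegralB01; try exact: continuous_homotopy_integrand.
apply: le_Rintegral01 => [s|s s01].
  by apply: cvgB; exact: continuous_homotopy_integrand.
rewrite -mulrBr normrM; apply: le_trans (H s s01).
by rewrite ler_piMl// expr01_le1.
Qed.

Lemma continuous_homotopy k f : smooth f ->
  continuous (homotopy k f : {ptws I -> R} -> R).
Proof.
move=> sf p; apply: (@cvg_homotopy k f _ (nbhs p) id) => // c.
exact: (@proj_continuous I (fun=> R) c).
Qed.

(* the factor by which scaling multiplies the coordinate c *)
Let wt c s : R := if S c then s else 1.

(** Differentiation under the integral sign; a scaled coordinate contributes one
   more factor s. *)
Lemma is_derive_homotopy k f p c (s0 : R) : smooth f ->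
  is_derive s0 (1 : R) (fun s => homotopy k f (upd p c s))
    (homotopy (k + S c) (pd c f) (upd p c s0)).
Proof.
move=> sf; have sdf := smooth_pd c sf.
apply: is_derive_littleo => e e0.
have qp d : upd p c y d @[y --> s0] --> upd p c s0 d.
  by rewrite /upd; case: eqP => _; [exact: cvg_id|exact: cvg_cst].
have := near_scale (nbhs_filter s0) sdf qp e0; move=> /nbhs_ballP[r /= r0 Hr].
near=> y.
have {Hr}Hr z : `|z - s0| <= `|y - s0| -> forall s : R, 0 <= s <= 1 ->
    `|pd c f (scale s (upd p c z)) - pd c f (scale s (upd p c s0))| <= e.
  move=> zy; apply: Hr; rewrite /ball/= distrC; apply: le_lt_trans zy _.
  by rewrite distrC; near: y; exact: nbhsx_ballx.
have cP q g j : smooth g -> continuous (fun s : R => s ^+ j * g (scale s q)).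
  exact: continuous_homotopy_integrand.
have cD : continuous (fun s : R => s ^+ (k + S c) * pd c f (scale s (upd p c s0)) * (y - s0)).
  by move=> s; apply: cvgM; [exact: cP|exact: cvg_cst].
have -> : homotopy k f (upd p c y) - homotopy k f (upd p c s0) -
    homotopy (k + S c) (pd c f) (upd p c s0) * (y - s0) =
  \int[mu]_(s in `[0, 1])
    (s ^+ k * f (scale s (upd p c y)) - s ^+ k * f (scale s (upd p c s0)) -
     s ^+ (k + S c) * pd c f (scale s (upd p c s0)) * (y - s0)).
  rewrite !RintegralB01//; try exact: cP.
    by rewrite RintegralZr//; apply: continuous_integrable01; exact: cP.
  by move=> s; apply: cvgB; exact: cP.
apply: le_Rintegral01 => [s|s s01].
  by apply: cvgB; [apply: cvgB; exact: cP|exact: cD].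
have wE : s ^+ (k + S c) = s ^+ k * wt c s.
  by rewrite exprD /wt; case: (S c).
have w1 : `|wt c s| <= 1.
  by rewrite /wt; case: (S c); rewrite ?normr1//; exact: (expr01_le1 1).
have uE z : scale s (upd p c z) = upd (scale s p) c (wt c s * z).
  by rewrite scale_upd /wt; case: (S c) => //; rewrite mul1r.
rewrite -mulrBr wE -!mulrA -mulrBr normrM.
apply: (@le_trans _ _ (1 * (e * `|y - s0|))); last by rewrite mul1r.
apply: ler_pM; rewrite ?expr01_le1//.
(* the mean value theorem for the rescaled coordinate; its intermediate point is
   again the rescaling of a point between s0 and y *)
have [z zy ->] : exists2 z, `|z - s0| <= `|y - s0| &
    f (scale s (upd p c y)) - f (scale s (upd p c s0)) =
    wt c s * pd c f (scale s (upd p c z)) * (y - s0).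
  have [w0|w0] := eqVneq (wt c s) 0.
    by exists s0; rewrite ?subrr ?normr0// !uE w0 !mul0r subrr.
  rewrite !uE; have [z] := smooth_MVT (scale s p) c (wt c s * s0) (wt c s * y) sf.
  rewrite -[z](mulVKf w0) -!mulrBr !normrM ler_pM2l ?normr_gt0// => zy ->.
  by exists ((wt c s)^-1 * z); rewrite // uE mulrCA mulrA.
rewrite -mulrA -mulrBr -mulrBl !normrM mulrA.
apply: ler_pM => //; first by rewrite mulr_ge0.
by rewrite -[leRHS]mul1r; apply: ler_pM => //; exact: Hr.
Unshelve. all: by end_near. Qed.

Lemma pd_homotopy k f c : smooth f ->
  pd c (homotopy k f) = homotopy (k + S c) (pd c f).
Proof.
move=> sf; apply/funext => p; rewrite /pd derive1E.
have [_ ->] := is_derive_homotopy k p c (p c) sf.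
by rewrite upd_id.
Qed.

Lemma homotopy_depends k f (A : seq I) :
  (forall p q, {in A, p =1 q} -> f p = f q) ->
  forall p q, {in A, p =1 q} -> homotopy k f p = homotopy k f q.
Proof.
move=> fA p q pq; apply: eq_Rintegral => s _; congr (_ * _).
by apply: fA => c cA; rewrite /scale pq.
Qed.

(** The integrals of this shape are closed under partial derivatives. *)
Lemma smooth_homotopy k f : smooth f -> smooth (homotopy k f).
Proof.
move=> sf; apply: (@smooth_coind _ _
  (fun g => exists j h, smooth h /\ g = homotopy j h)); last by exists k, f.
move=> _ [j [h [sh ->]]]; split.
- by have [A hA] := smooth_depends sh; exists A; exact: homotopy_depends.
- exact: continuous_homotopy.
- by move=> c p; have [] := is_derive_homotopy j p c (p c) sh.
- move=> c; exists (j + S c)%N, (pd c h); split; first exact: smooth_pd.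
  exact: pd_homotopy.
Qed.

Lemma continuous_bigsum (B : seq I) (g : I -> R -> R) :
  (forall c, continuous (g c)) -> continuous (fun s => \sum_(c <- B) g c s).
Proof.
move=> cg; elim: B => [|c B ih] s.
  by under eq_fun do rewrite big_nil; exact: cvg_cst.
under eq_fun do rewrite big_cons.
by apply: cvgD; [exact: cg|exact: ih].
Qed.

(** The left-hand side is the integral of the derivative of s^(k+1) f(s p). *)
Lemma radial_homotopy k f : smooth f ->
  k.+1%:R *: homotopy k f + vact radial_vf (homotopy k f) = f.
Proof.
move=> sf; have [A fA] := smooth_fset sf.
rewrite (vactE _ (homotopy_depends k fA)); apply/funext => p.
rewrite fctE fct_sumE.
pose der s := \sum_(c <- A) radial_vf p c * pd c f (scale s p).
pose dF s := k.+1%:R * (s ^+ k * f (scale s p)) + s ^+ k.+1 * der s.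
have cder : continuous der.
  apply: continuous_bigsum => c s; apply: cvgM; first exact: cvg_cst.
  by apply: continuous_scale; exact: smooth_pd.
have c1 : continuous (fun s : R => s ^+ k.+1 * der s).
  by move=> s; apply: cvgM; [exact: exprn_continuous|exact: cder].
have cI := @continuous_homotopy_integrand k _ p sf.
have cdF : continuous dF.
  by move=> s; apply: cvgD; [apply: cvgM; [exact: cvg_cst|exact: cI]|exact: c1].
transitivity (\int[mu]_(s in `[0, 1]) dF s).
  rewrite /dF RintegralD//; last 2 first.
  - apply: continuous_integrable01 => s.
    by apply: cvgM; [exact: cvg_cst|exact: cI].
  - exact: continuous_integrable01.
  rewrite RintegralZl//; last exact: continuous_integrable01.
  congr (_ + _).
  have E (B : seq I) : \int[mu]_(s in `[0, 1])
      (s ^+ k.+1 * (\sum_(c <- B) radial_vf p c * pd c f (scale s p))) =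
      \sum_(c <- B) radial_vf p c * homotopy k.+1 (pd c f) p.
    have cB (B' : seq I) : continuous (fun s : R =>
        s ^+ k.+1 * (\sum_(c <- B') radial_vf p c * pd c f (scale s p))).
      move=> s; apply: cvgM; first exact: exprn_continuous.
      apply: continuous_bigsum => c' s'; apply: cvgM; first exact: cvg_cst.
      by apply: continuous_scale; exact: smooth_pd.
    elim: B => [|c B ih].
      rewrite big_nil; under eq_Rintegral do rewrite big_nil mulr0.
      by rewrite Rintegral_cst// mul0r.
    under eq_Rintegral do rewrite big_cons mulrDr mulrCA.
    rewrite big_cons -ih RintegralD//; last 2 first.
    - apply: continuous_integrable01 => s; apply: cvgM; first exact: cvg_cst.
      by apply: continuous_homotopy_integrand; exact: smooth_pd.
    - by apply: continuous_integrable01; exact: cB.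
    congr (_ + _); rewrite RintegralZl//; apply: continuous_integrable01.
    by apply: continuous_homotopy_integrand; exact: smooth_pd.
  rewrite E; apply: eq_bigr => c _; rewrite fctE pd_homotopy// /radial_vf.
  by case: (S c); rewrite ?mul0r// addn1.
pose F s := s ^+ k.+1 * f (scale s p).
have dF' s : is_derive s (1 : R) F (dF s).
  have dX : is_derive s (1 : R) ((fun x : R => x) ^+ k.+1) (k.+1%:R * s ^+ k).
    by apply: is_derive_eq (is_deriveX k.+1 (is_derive_id s (1 : R))) _; rewrite /GRing.scale/= mulr1.
  have := is_deriveM dX (is_derive_scale p s sf fA).
  rewrite (_ : GRing.mul _ _ = F); last by apply/funext => x; rewrite /F !fctE.
  move=> h; apply: is_derive_eq h _.
  by rewrite /dF /GRing.scale/= addrC !fctE; congr (_ + _); rewrite mulrC mulrA.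
have cF : continuous F.
  move=> s; apply: differentiable_continuous; apply/derivable1_diffP.
  by have [] := dF' s.
rewrite /Rintegral (continuous_FTC2 ltr01 (F := F)).
- by rewrite /F expr1n mul1r scale1 expr0n/= mul0r subr0.
- exact: continuous_subspaceT.
- split; first by move=> x _; have [] := dF' x.
    by apply: cvg_at_right_filter; exact: cF.
  by apply: cvg_at_left_filter; exact: cF.
- by move=> x _; rewrite derive1E; have [] := dF' x.
Qed.

End Homotopy.

(** * The ring of smooth functions and its derivations *)

Opaque pd smooth upd.

Section SmoothRing.
Variables (R : realType) (I : choiceType).
Local Notation point := (I -> R).

Definition smooth_pred : {pred point -> R} := fun f => `[< smooth f >].

Fact smooth_subring_closed : subring_closed smooth_pred.
Proof.
split; first by apply/asboolP; exact: (@smooth_cst R I 1).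
  move=> f g /asboolP sf /asboolP sg; apply/asboolP.
  exact: smoothD sf (smoothN sg).
by move=> f g /asboolP sf /asboolP sg; apply/asboolP; exact: smoothM.
Qed.

HB.instance Definition _ :=
  GRing.isSubringClosed.Build (point -> R) smooth_pred smooth_subring_closed.

(** Smoothness is bundled, so that identities between functions become identities
   in a commutative ring. *)
Record sfun := Sfun { sfun_val :> point -> R; _ : sfun_val \in smooth_pred }.

HB.instance Definition _ := [isSub for sfun_val].
HB.instance Definition _ := [Choice of sfun by <:].
HB.instance Definition _ :=
  GRing.SubChoice_isSubComPzRing.Build (point -> R) smooth_pred sfun
    smooth_subring_closed.

Lemma sfun_smooth (f : sfun) : smooth f.
Proof. by case: f => f /= /asboolP. Qed.

Definition mk_sfun (f : point -> R) (sf : smooth f) : sfun :=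
  @Sfun f (asboolT sf).

Lemma sfunP (f g : sfun) : (forall p, f p = g p) <-> f = g.
Proof.
by split=> [fg|->//]; apply: val_inj; apply/funext.
Qed.

Lemma sfunD (f g : sfun) p : (f + g) p = f p + g p. Proof. by []. Qed.
Lemma sfunN (f : sfun) p : (- f) p = - f p. Proof. by []. Qed.
Lemma sfunM (f g : sfun) p : (f * g) p = f p * g p. Proof. by []. Qed.
Lemma sfun0 p : (0 : sfun) p = 0. Proof. by []. Qed.
Lemma sfun_sum (T : Type) (r : seq T) (F : T -> sfun) p :
  (\sum_(i <- r) F i) p = \sum_(i <- r) F i p.
Proof. by elim/big_rec2: _ => // i y1 y2 _ <-. Qed.

Definition cst_sf (a : R) : sfun := mk_sfun (@smooth_cst R I a).
Definition var c : sfun := mk_sfun (@smooth_proj R I c).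
Definition pdA c (f : sfun) : sfun := mk_sfun (smooth_pd c (sfun_smooth f)).

Definition vf (V : I -> sfun) : point -> point := fun p c => V c p.

Lemma smooth_vf_vf V : smooth_vf (vf V).
Proof. by move=> c; exact: sfun_smooth. Qed.

(** The derivation is given by its values on the coordinates. *)
Definition der (V : I -> sfun) (f : sfun) : sfun :=
  mk_sfun (smooth_vact (smooth_vf_vf V) (sfun_smooth f)).

Implicit Types (f g : sfun) (V W : I -> sfun).

Definition supported (A : {fset I}) f := forall p q, {in A, p =1 q} -> f p = f q.

Lemma supported_ex f : exists A, supported A f.
Proof. exact: smooth_fset (sfun_smooth f). Qed.

Lemma supportedS (A B : {fset I}) f : (A `<=` B)%fset -> supported A f -> supported B f.
Proof. by move=> AB fA p q pq; apply: fA => c /(fsubsetP AB) /pq. Qed.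

Lemma supported_pdA A c f : supported A f -> supported A (pdA c f).
Proof. by move=> fA p q pq; exact: (pd_depends c fA pq). Qed.

Lemma pdA_supported A c f : supported A f -> c \notin A -> pdA c f = 0.
Proof. by move=> fA cA; apply/sfunP => p; apply: (pd_support _ fA). Qed.

Lemma derE A V f : supported A f -> der V f = \sum_(c <- A) V c * pdA c f.
Proof.
move=> fA; apply/sfunP => p; rewrite sfun_sum /= (vactE _ fA) fct_sumE.
by apply: eq_bigr.
Qed.

Lemma supported2 f g : exists A, supported A f /\ supported A g.
Proof.
have [A [fA gA]] := smooth_fset2 (sfun_smooth f) (sfun_smooth g).
by exists A.
Qed.

Lemma pdA_D c f g : pdA c (f + g) = pdA c f + pdA c g.
Proof.
by apply: val_inj; rewrite /= (pdD c (sfun_smooth f) (sfun_smooth g)).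
Qed.

Lemma pdA_M c f g : pdA c (f * g) = pdA c f * g + f * pdA c g.
Proof.
by apply: val_inj; rewrite /= (pdM c (sfun_smooth f) (sfun_smooth g)).
Qed.

Lemma pdA_comm c d f : pdA c (pdA d f) = pdA d (pdA c f).
Proof. by apply: val_inj; rewrite /= (pd_comm c d (sfun_smooth f)). Qed.

Lemma der_D V f g : der V (f + g) = der V f + der V g.
Proof.
have [A [fA gA]] := supported2 f g.
rewrite (derE V fA) (derE V gA) -big_split (@derE A); last first.
  by move=> p q pq; rewrite !sfunD (fA p q)// (gA p q).
by apply: eq_bigr => c _; rewrite pdA_D mulrDr.
Qed.

Fact der_zmod V : zmod_morphism (der V).
Proof.
move=> f g; have := der_D V (f - g) g; rewrite subrK => ->.
by rewrite addrK.
Qed.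

HB.instance Definition _ V := GRing.isZmodMorphism.Build sfun sfun (der V) (der_zmod V).

Lemma derM V f g : der V (f * g) = der V f * g + f * der V g.
Proof.
have [A [fA gA]] := supported2 f g.
rewrite (derE V fA) (derE V gA) (@derE A); last first.
  by move=> p q pq; rewrite !sfunM (fA p q)// (gA p q).
rewrite mulr_suml mulr_sumr -big_split; apply: eq_bigr => c _ /=.
by rewrite pdA_M; ring.
Qed.

Lemma pdA_var c d : pdA c (var d) = (c == d)%:R.
Proof.
apply/sfunP => p; rewrite /= pd_coord; case: (c == d) => //.
Qed.

Lemma der_var V c : der V (var c) = V c.
Proof.
rewrite (@derE [fset c]%fset); last by move=> p q /(_ c); rewrite inE eqxx; exact.
by rewrite big_seq_fset1 pdA_var eqxx mulr1.
Qed.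

Lemma der1 V : der V 1 = 0.
Proof. by have := derM V 1 1; rewrite !mulr1 mul1r => /eqP; rewrite -subr_eq0 opprD addNKr oppr_eq0 => /eqP. Qed.

Lemma der_cst V a : der V (cst_sf a) = 0.
Proof.
by rewrite (@derE fset0) ?big_seq_fset0// => p q _.
Qed.

Lemma pdA_der c f : pdA c f = der (fun d => (d == c)%:R) f.
Proof.
have [A fA] := supported_ex f.
rewrite (derE _ fA); have [cA|cA] := boolP (c \in A); last first.
  rewrite (pdA_supported fA cA) big1_seq// => d /andP[_ dA].
  by case: eqP => [e|_]; [rewrite e (negbTE cA) in dA|rewrite mul0r].
rewrite (bigD1_seq c)//= eqxx mul1r big1 ?addr0// => d /negbTE ->.
by rewrite mul0r.
Qed.

(** Commutators may be checked on the coordinates, because the second order terms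
   cancel. *)
Lemma der_bracket V W Z : (forall c, der V (W c) - der W (V c) = Z c) ->
  forall f, der V (der W f) - der W (der V f) = der Z f.
Proof.
move=> VWZ f; have [A fA] := supported_ex f.
have E V' W' : der V' (der W' f) = \sum_(c <- A) der V' (W' c) * pdA c f +
    \sum_(c <- A) \sum_(d <- A) W' c * (V' d * pdA d (pdA c f)).
  rewrite (derE W' fA) raddf_sum -big_split; apply: eq_bigr => c _ /=.
  by rewrite derM (derE V' (supported_pdA c fA)) mulr_sumr.
rewrite (E V W) (E W V) (derE Z fA).
have -> : \sum_(c <- A) \sum_(d <- A) W c * (V d * pdA d (pdA c f)) =
    \sum_(c <- A) \sum_(d <- A) V c * (W d * pdA d (pdA c f)).
  rewrite exchange_big /=; apply: eq_bigr => c _; apply: eq_bigr => d _.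
  by rewrite pdA_comm mulrCA.
rewrite opprD addrACA subrr addr0 -sumrB; apply: eq_bigr => c _.
by rewrite -VWZ mulrBl.
Qed.

Lemma der_commute V W : (forall c, der V (W c) = der W (V c)) ->
  forall f, der V (der W f) = der W (der V f).
Proof.
move=> VW f; apply/eqP; rewrite -subr_eq0 (@der_bracket V W (fun=> 0)).
  have [A fA] := supported_ex f.
  by rewrite (derE _ fA) big1// => c _; rewrite mul0r.
by move=> c; rewrite VW subrr.
Qed.

Lemma der_linear V W Z : (forall c, V c + W c = Z c) ->
  forall f, der V f + der W f = der Z f.
Proof.
move=> VWZ f; have [A fA] := supported_ex f.
rewrite !(derE _ fA) -big_split; apply: eq_bigr => c _.
by rewrite /= -mulrDl VWZ.
Qed.

Lemma sfun_torsion n f : n.+1%:R * f = 0 -> f = 0.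
Proof.
move=> H; apply/sfunP => p; have := congr1 (fun g : sfun => g p) H.
rewrite sfunM => /eqP; rewrite mulf_eq0 => /orP[|/eqP->//].
have -> : (n.+1%:R : sfun) p = n.+1%:R.
  by elim: n {H} => // n ih; rewrite [n.+2%:R]mulrS sfunD ih [RHS]mulrS.
by rewrite pnatr_eq0.
Qed.

End SmoothRing.

(** * Differential operators and their adjoints *)

Section Additive.
Variables U V : zmodType.
Implicit Types (F : U -> V) (v w : U).

Lemma additive0 F : {morph F : v w / v + w} -> F 0 = 0.
Proof. by move=> FD; apply: (addrI (F 0)); rewrite -FD !addr0. Qed.

Lemma additiveN F v : {morph F : v w / v + w} -> F (- v) = - F v.
Proof.
by move=> FD; apply: (addrI (F v)); rewrite -FD !subrr (additive0 FD).
Qed.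

Lemma additiveB F v w : {morph F : v w / v + w} -> F (v - w) = F v - F w.
Proof. by move=> FD; rewrite FD (additiveN _ FD). Qed.

Lemma additive_sum (T : Type) (r : seq T) (g : T -> U) F :
  {morph F : v w / v + w} -> F (\sum_(i <- r) g i) = \sum_(i <- r) F (g i).
Proof.
move=> FD; elim: r => [|t r ih]; first by rewrite !big_nil additive0.
by rewrite !big_cons FD ih.
Qed.

End Additive.

Section Adjoint.
Variables (A : comPzRingType) (X : {additive A -> A}).
Hypothesis XM : forall a b, X (a * b) = X a * b + a * X b.
Implicit Types (a b v w : A) (F G : A -> A).

(** [adj F G]: F is a differential operator in X, and G is its formal adjoint.
   Operators are plain functions, so that equality of operators is pointwise. *)
Inductive adj : (A -> A) -> (A -> A) -> Prop :=
| adj_mul a : adj (fun v => a * v) (fun v => a * v)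
| adj_X F G : adj F G -> adj (fun v => X (F v)) (fun v => - G (X v))
| adj_add F G F' G' : adj F G -> adj F' G' ->
    adj (fun v => F v + F' v) (fun v => G v + G' v).

Lemma adj_ext F G F' G' : adj F G -> F =1 F' -> G =1 G' -> adj F' G'.
Proof. by move=> a /funext <- /funext <-. Qed.

Lemma adj_D F G : adj F G -> {morph F : v w / v + w} /\ {morph G : v w / v + w}.
Proof.
elim=> [a|{}F {}G _ [ihF ihG]|{}F {}G F' G' _ [ihF ihG] _ [ihF' ihG']];
  split=> v w.
- exact: mulrDr.
- exact: mulrDr.
- by rewrite ihF raddfD.
- by rewrite raddfD ihG opprD.
- by rewrite ihF ihF' addrACA.
- by rewrite ihG ihG' addrACA.
Qed.

Lemma adjDl F G v w : adj F G -> F (v + w) = F v + F w.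
Proof. by move=> /adj_D[]. Qed.

Lemma adjDr F G v w : adj F G -> G (v + w) = G v + G w.
Proof. by move=> /adj_D[]. Qed.

Lemma adj_mul_comp a F G : adj F G -> adj (fun v => a * F v) (fun v => G (a * v)).
Proof.
move=> FG; elim: FG a => {F G} [b|F G FG ih|F G F' G' FG ih FG' ih'] a.
- by apply: adj_ext (adj_mul (a * b)) _ _ => v; ring.
- apply: adj_ext (adj_add (adj_X (ih a)) (ih (- X a))) _ _ => v.
    by rewrite XM; ring.
  have [_ GD] := adj_D FG.
  rewrite XM GD mulNr (additiveN _ GD); ring.
- by apply: adj_ext (adj_add (ih a) (ih' a)) _ _ => v; rewrite ?mulrDr.
Qed.

Lemma adj_comp F G F' G' : adj F G -> adj F' G' ->
  adj (fun v => F (F' v)) (fun v => G' (G v)).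
Proof.
move=> FG FG'; elim: FG => {F G} [a|F G FG ih|F1 G1 F2 G2 FG1 ih1 FG2 ih2].
- exact: adj_mul_comp.
- apply: adj_ext (adj_X ih) _ _ => v //=.
  by have [_ GD] := adj_D FG'; rewrite (additiveN _ GD).
- apply: adj_ext (adj_add ih1 ih2) _ _ => v //=.
  by have [_ GD] := adj_D FG'; rewrite GD.
Qed.

Lemma adj_id : adj id id.
Proof. by apply: adj_ext (adj_mul 1) _ _ => v; rewrite mul1r. Qed.

Lemma adj0 : adj (fun=> 0) (fun=> 0).
Proof. by apply: adj_ext (adj_mul 0) _ _ => v; rewrite mul0r. Qed.

Lemma adjN F G : adj F G -> adj (fun v => - F v) (fun v => - G v).
Proof.
move=> FG; apply: adj_ext (adj_comp (adj_mul (-1)) FG) _ _ => v;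
  rewrite mulN1r//; have [_ GD] := adj_D FG; exact: additiveN.
Qed.

Lemma adjB F G F' G' : adj F G -> adj F' G' ->
  adj (fun v => F v - F' v) (fun v => G v - G' v).
Proof. by move=> FG /adjN; exact: adj_add. Qed.

Lemma adjX : adj X (fun v => - X v).
Proof. exact: adj_X adj_id. Qed.

Lemma adj_sym F G : adj F G -> adj G F.
Proof.
elim=> {F G} [a|F G FG ih|F G F' G' FG ih FG' ih']; first exact: adj_mul.
  apply: adj_ext (adj_comp (adjN ih) adjX) _ _ => v //=.
  by rewrite raddfN opprK.
exact: adj_add.
Qed.

Lemma adj_sum (T : Type) (r : seq T) (F G : T -> A -> A) :
  (forall t, adj (F t) (G t)) ->
  adj (fun v => \sum_(t <- r) F t v) (fun v => \sum_(t <- r) G t v).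
Proof.
move=> FG; elim: r => [|t r ih].
  by apply: adj_ext adj0 _ _ => v; rewrite big_nil.
by apply: adj_ext (adj_add (FG t) ih) _ _ => v; rewrite big_cons.
Qed.

Lemma adj_iterX i : adj (iter i X) (iter i (fun v => - X v)).
Proof.
elim: i => [|i ih]; first exact: adj_id.
apply: adj_ext (adj_comp adjX ih) _ _ => v //=.
by rewrite -iterSr.
Qed.

Lemma adj_mono a i :
  adj (fun v => a * iter i X v) (fun v => iter i (fun v => - X v) (a * v)).
Proof. exact: adj_comp (adj_mul a) (adj_iterX i). Qed.

Lemma iterXD i : {morph iter i X : v w / v + w}.
Proof. by have [] := adj_D (adj_iterX i). Qed.

Lemma iterNXD i : {morph iter i (fun v => - X v) : v w / v + w}.
Proof. by have [] := adj_D (adj_iterX i). Qed.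

(** Induction moves all derivatives in F to the right of the coefficients, and the
   same rewriting of G moves them to the left. *)
Lemma adj_normal F G : adj F G -> exists s : seq (nat * A),
  (forall v, F v = \sum_(t <- s) t.2 * iter t.1 X v) /\
  (forall v, G v = \sum_(t <- s) iter t.1 (fun v => - X v) (t.2 * v)).
Proof.
elim=> {F G} [a|F G FG [s [Fs Gs]]|F G F' G' _ [s [Fs Gs]] _ [s' [Fs' Gs']]].
- by exists [:: (0%N, a)]; split=> v; rewrite big_seq1.
- exists ([seq (t.1, X t.2) | t <- s] ++ [seq (t.1.+1, t.2) | t <- s]).
  split=> v; rewrite big_cat !big_map /= -big_split /=.
    by rewrite Fs raddf_sum; apply: eq_bigr => t _; rewrite /= XM.
  rewrite Gs -sumrN; apply: eq_bigr => t _ /=.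
  rewrite -[- X _]/(iter t.1.+1 (fun v => - X v) (t.2 * v)) iterSr -iterNXD.
  rewrite XM opprD addrA subrr add0r.
  by rewrite (additiveN _ (iterNXD _)).
- exists (s ++ s'); split=> v; rewrite big_cat.
    by rewrite Fs Fs'.
  by rewrite Gs Gs'.
Qed.

Variable x : A.
Hypothesis Xx : X x = 1.
Hypothesis torsion : forall n a, n.+1%:R * a = 0 -> a = 0.

Lemma torsion_fact i a : i`!%:R * a = 0 -> a = 0.
Proof.
by move=> H; apply: (@torsion (i`!).-1); rewrite prednK// fact_gt0.
Qed.

Lemma iterX_exp j k : iter j X (x ^+ k) = (k ^_ j)%:R * x ^+ (k - j).
Proof.
have X1 : X 1 = 0.
  by apply: (addrI (X 1)); rewrite addr0 -{3}(mul1r 1) XM mul1r mulr1.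
have XE n : X (x ^+ n) = n%:R * x ^+ n.-1.
  elim: n => [|n ih]; first by rewrite expr0 X1 mul0r.
  rewrite exprS XM Xx ih mul1r /= mulrCA -exprS.
  case: n {ih} => [|n]; first by rewrite mul0r addr0 mul1r.
  by rewrite /= mulrS; ring.
elim: j => [|j ih]; first by rewrite ffactn0 mul1r subn0.
rewrite iterS ih XM ffactnSr natrM subnS XE.
suff -> : X (k ^_ j)%:R = 0 by rewrite mul0r add0r mulrA.
by rewrite raddfMn X1 mul0rn.
Qed.

(** The values at 1, x, x^2, ... form a triangular system with i! on the diagonal. *)
Lemma coef_test N (c : nat -> A) :
  (forall k, \sum_(i < N) c i * iter i X (x ^+ k) = 0) ->
  forall i, (i < N)%N -> c i = 0.
Proof.
move=> H; elim/ltn_ind => i ih iN.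
have := H i; rewrite (bigD1 (Ordinal iN))//= big1 ?addr0 => [|j ji].
  by rewrite iterX_exp ffactnn subnn mulr1 mulrC => /torsion_fact.
have [lt_ji|le_ij] := ltnP j i; first by rewrite (ih j)// mul0r.
by rewrite iterX_exp ffact_small ?mul0r ?mulr0// ltn_neqAle le_ij andbT eq_sym.
Qed.

(** Collecting the terms of equal order, for all additive functions of the
   coefficients at once. *)
Lemma seq_array (s : seq (nat * A)) : exists N,
  forall (C : zmodType) (H : nat -> A -> C), (forall i, {morph H i : v w / v + w}) ->
  \sum_(t <- s) H t.1 t.2 = \sum_(i < N) H i (\sum_(t <- s | t.1 == i) t.2).
Proof.
exists (\max_(t <- s) t.1).+1 => C H HD.
have -> : \sum_(t <- s) H t.1 t.2 =
    \sum_(t <- s) \sum_(i < (\max_(t <- s) t.1).+1 | t.1 == i) H i t.2.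
  rewrite [LHS]big_seq [RHS]big_seq; apply: eq_bigr => t ts.
  have tN : (t.1 < (\max_(t <- s) t.1).+1)%N.
    by rewrite ltnS; exact: leq_bigmax_seq.
  rewrite (bigD1 (Ordinal tN))//= big1 ?addr0// => i /andP[/eqP ti].
  by rewrite -val_eqE/= ti eqxx.
rewrite (exchange_big_dep predT)//=; apply: eq_bigr => i _.
rewrite [LHS]big_mkcond (big_mkcond (fun t : nat * A => t.1 == i)) /=.
rewrite (additive_sum _ _ (HD i)).
by apply: eq_bigr => t _; case: ifP => // _; rewrite additive0.
Qed.

(** The coefficients vanish by the triangular test, and they determine both F and
   its adjoint. *)
Lemma adj_uniq F G : adj F G -> (forall k, F (x ^+ k) = 0) ->
  (forall v, F v = 0) /\ (forall v, G v = 0).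
Proof.
move=> /adj_normal[s [Fs Gs]] F0; have [N sN] := seq_array s.
have c0 : forall i, (i < N)%N -> \sum_(t <- s | t.1 == i) t.2 = 0.
  apply: coef_test => k.
  rewrite -[RHS](F0 k) Fs (sN _ (fun i a => a * iter i X (x ^+ k)))// => i a b.
  exact: mulrDl.
split=> v.
  rewrite Fs (sN _ (fun i a => a * iter i X v)) ?big1// => [i _|i a b].
    by rewrite c0// mul0r.
  exact: mulrDl.
rewrite Gs (sN _ (fun i a => iter i (fun v => - X v) (a * v))) ?big1// => [i _|i a b].
  by rewrite c0// mul0r (additive0 (iterNXD _)).
by rewrite mulrDl iterNXD.
Qed.

Lemma adj_eqr F G F' G' : adj F G -> adj F' G' ->
  (forall k, F (x ^+ k) = F' (x ^+ k)) -> G =1 G'.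
Proof.
move=> FG FG' FF' v; apply/eqP; rewrite -subr_eq0; apply/eqP.
by have [] := adj_uniq (adjB FG FG') _ => [k|_]; [rewrite FF' subrr|exact].
Qed.

Lemma adj_unique F G F' G' : adj F G -> adj F' G' -> F =1 F' -> G =1 G'.
Proof. by move=> FG FG' FF'; apply: adj_eqr FG FG' _ => k. Qed.

(** The commutator with such a derivation only differentiates the coefficients. *)
Lemma adj_commutator (D : {additive A -> A}) F G :
  (forall a b, D (a * b) = D a * b + a * D b) -> (forall a, D (X a) = X (D a)) ->
  adj F G -> adj (fun v => D (F v) - F (D v)) (fun v => D (G v) - G (D v)).
Proof.
move=> DM DX; elim=> {F G} [a|F G FG ih|F G F' G' FG ih FG' ih'].
- by apply: adj_ext (adj_mul (D a)) _ _ => v; rewrite DM; ring.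
- apply: adj_ext (adj_X ih) _ _ => v; first by rewrite raddfB DX.
  by rewrite raddfN DX; ring.
- by apply: adj_ext (adj_add ih ih') _ _ => v; rewrite raddfD; ring.
Qed.

(** Composition with X raises the order by one and keeps the leading coefficient. *)
Lemma X_inj_op F G : adj F G -> (forall v, X (F v) = 0) -> forall v, F v = 0.
Proof.
move=> FG XF.
(* the coefficients of X o F are X c_i + c_(i-1); they vanish from the top down *)
suff F0 k : F (x ^+ k) = 0 by have [] := adj_uniq FG F0.
have [s [Fs _]] := adj_normal FG.
have [N sN] := seq_array s.
pose c i := \sum_(t <- s | t.1 == i) t.2.
have Fc v : F v = \sum_(i < N) c i * iter i X v.
  by rewrite Fs (sN _ (fun i a => a * iter i X v))// => i a b; exact: mulrDl.
pose e i := (if (i < N)%N then X (c i) else 0) + (if i is j.+1 then c j else 0).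
have XFc v : \sum_(i < N.+1) e i * iter i X v = 0.
  rewrite -[RHS](XF v) Fc raddf_sum /=.
  transitivity (\sum_(i < N) (X (c i) * iter i X v + c i * iter i.+1 X v)); last first.
    by apply: eq_bigr => i _; rewrite XM.
  rewrite big_split /= (eq_bigr (fun i : 'I_N.+1 =>
    (if (i < N)%N then X (c i) else 0) * iter i X v +
    (if val i is j.+1 then c j else 0) * iter i X v)); last first.
    by move=> i _; rewrite -mulrDl.
  rewrite big_split /=; congr (_ + _).
    rewrite big_ord_recr /= ltnn mul0r addr0.
    by apply: eq_bigr => i _; rewrite ltn_ord.
  by rewrite big_ord_recl mul0r add0r.
have e0 := coef_test (fun k => XFc (x ^+ k)).
have c0 j : (j < N)%N -> c (N - j.+1)%N = 0.
  elim/ltn_ind: j => j ih jN.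
  have := e0 (N - j)%N; rewrite ltnS leq_subr /e => /(_ isT).
  case: j ih jN => [|j] ih jN.
    rewrite subn0 ltnn add0r; case: {sN Fc e XFc e0 ih} N jN => // n _.
    by rewrite subn1.
  rewrite ltn_subrL (leq_ltn_trans _ jN)// ih//; last exact: ltnW.
  rewrite raddf0 add0r -subnSK//.
rewrite Fc big1// => i _.
have iN := ltn_ord i; have -> : c i = c (N - (N - i.+1).+1)%N by congr c; lia.
by rewrite c0 ?mul0r//; lia.
Qed.

End Adjoint.

(** * Evolutionary derivations and linearizations *)

Opaque pd smooth upd der.

Section Evolution.
Variable R : realType.
Local Notation A := (sfun R (jet_coord nat)).
Implicit Types (a b f g v w : A).

Definition Xc (c : jet_coord nat) : A :=
  match c with Ct => 0 | Cx => 1 | Cu i => var R (Cu i.+1) end.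
Notation X := (der Xc).

Definition tauc (c : jet_coord nat) : A := if c is Ct then 1 else 0.
(** The derivation in the explicit variable t. *)
Notation tau := (der tauc).

Definition prc v (c : jet_coord nat) : A := if c is Cu i then iter i X v else 0.
(** The evolutionary derivation with characteristic v. *)
Notation pr v := (der (prc v)).

Definition xA : A := var R Cx.
Definition uA : A := var R (Cu 0%N).

Let XM : forall a b, X (a * b) = X a * b + a * X b := derM Xc.

Lemma X_x : X xA = 1. Proof. exact: der_var. Qed.
Lemma tau_x : tau xA = 0. Proof. exact: der_var. Qed.
Lemma pr_x v : pr v xA = 0. Proof. exact: der_var. Qed.
Lemma tau_u : tau uA = 0. Proof. exact: der_var. Qed.
Lemma pr_u v : pr v uA = v. Proof. exact: der_var. Qed.

Lemma der_exp (V : jet_coord nat -> A) f k : der V f = 0 -> der V (f ^+ k) = 0.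
Proof.
move=> Vf; elim: k => [|k ih]; first by rewrite expr0 der1.
by rewrite exprS derM Vf ih mul0r mulr0 addr0.
Qed.

Lemma tau_X f : tau (X f) = X (tau f).
Proof.
apply: der_commute => -[||i] /=.
- by rewrite raddf0 der1.
- by rewrite der1 raddf0.
- by rewrite der_var raddf0.
Qed.

Lemma der_iterX (V : jet_coord nat -> A) i f :
  (forall g, der V (X g) = X (der V g)) -> der V (iter i X f) = iter i X (der V f).
Proof. by move=> VX; elim: i => //= i ih; rewrite VX ih. Qed.

Lemma pr_X v f : pr v (X f) = X (pr v f).
Proof.
apply: der_commute => -[||i] /=.
- by rewrite !raddf0.
- by rewrite der1 raddf0.
- by rewrite der_var.
Qed.

Lemma tau_pr v f : tau (pr v f) = pr v (tau f) + pr (tau v) f.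
Proof.
apply/eqP; rewrite addrC -subr_eq; apply/eqP; apply: der_bracket => -[||i] /=.
- by rewrite raddf0 der1 subrr.
- by rewrite !raddf0 addr0.
- by rewrite raddf0 subr0 (der_iterX _ _ tau_X).
Qed.

(** The commutator of two evolutionary derivations is evolutionary. *)
Lemma pr_pr v w f : pr v (pr w f) - pr w (pr v f) = pr (pr v w - pr w v) f.
Proof.
apply: der_bracket => -[||i] /=.
- by rewrite !raddf0 addr0.
- by rewrite !raddf0 addr0.
- rewrite (der_iterX _ _ (pr_X v)) (der_iterX _ _ (pr_X w)).
  by rewrite (additiveB _ _ (iterXD XM i)).
Qed.

Lemma prD v w f : pr (v + w) f = pr v f + pr w f.
Proof.
apply/esym/der_linear => -[||i] /=; rewrite ?addr0//.
by rewrite (iterXD XM).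
Qed.

Lemma prB v w f : pr (v - w) f = pr v f - pr w f.
Proof. by rewrite (additiveB _ _ (fun v w => prD v w f)). Qed.

Definition pa i f : A := pdA (Cu i) f.

Lemma pa_comm i j f : pa i (pa j f) = pa j (pa i f).
Proof. exact: pdA_comm. Qed.

Definition u_order N f := forall l, (N <= l)%N -> pa l f = 0.

Definition vertc (W : nat -> A) (c : jet_coord nat) : A := if c is Cu i then W i else 0.

Lemma der_vertc N f W : u_order N f ->
  der (vertc W) f = \sum_(l < N) pa l f * W l.
Proof.
move=> fN; have [B fB] := supported_ex f.
pose C := (B `|` [fset Cu (val i) | i in 'I_N]%fset)%fset.
have fC : supported C f by apply: supportedS fB; exact: fsubsetUl.
rewrite (derE _ fC).
rewrite (bigID (fun c => c \in [fset Cu (val i) | i in 'I_N]%fset)) /= addrC big1_seq.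
  rewrite add0r -big_filter.
  rewrite (perm_big [seq Cu (val i) | i <- enum 'I_N]).
    by rewrite big_map big_enum /=; apply: eq_bigr => i _; rewrite mulrC.
  apply: uniq_perm; first by rewrite filter_uniq ?fset_uniq.
    rewrite map_inj_in_uniq ?enum_uniq// => i j _ _ [] ij; exact: val_inj.
  move=> c; rewrite mem_filter; apply/andP/mapP.
    by move=> [/imfsetP[/= i _ ->] _]; exists i => //; rewrite mem_enum.
  move=> [i _ ->]; have iN : Cu (val i) \in [fset Cu (val i) | i in 'I_N]%fset.
    by apply/imfsetP; exists i.
  by split=> //; rewrite /C in_fsetU iN orbT.
move=> c /andP[cN cC]; case: c cN cC => [||i] /= cN _; rewrite ?mul0r//.
rewrite [pdA _ f](fN i) ?mulr0// leqNgt; apply: contra cN => iN.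
by apply/imfsetP; exists (Ordinal iN).
Qed.

Lemma u_order_pr N f v : u_order N f ->
  pr v f = \sum_(l < N) pa l f * iter l X v.
Proof. exact: der_vertc. Qed.

Lemma u_order_ex f : exists N, u_order N f.
Proof.
have [B fB] := supported_ex f.
exists (\max_(c <- B) (if c is Cu i then i.+1 else 0%N)) => l Bl.
apply: (pdA_supported fB); apply/negP => lB.
have := @leq_bigmax_seq _ _ predT (fun c : jet_coord nat => if c is Cu i then i.+1 else 0%N) _ lB isT.
by move=> /leq_trans/(_ Bl); rewrite ltnn.
Qed.

Local Notation adj := (adj X).
Local Notation NX := (fun v : A => - X v).

Lemma pr_adj_order N f : u_order N f ->
  adj (fun v => pr v f) (fun v => \sum_(l < N) iter l NX (pa l f * v)).
Proof.
move=> fN.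
apply: adj_ext (adj_sum (index_enum 'I_N) (fun l => adj_mono XM (pa l f) l)) _ _ => v //.
by rewrite (u_order_pr _ fN).
Qed.

Lemma pr_adj_ex f : exists G, adj (fun v => pr v f) G.
Proof. by have [N fN] := u_order_ex f; eexists; exact: pr_adj_order fN. Qed.

(** The adjoint of the linearization v |-> pr v f of f. *)
Definition dual f : A -> A := sval (cid (pr_adj_ex f)).

Lemma pr_adj f : adj (fun v => pr v f) (dual f).
Proof. by rewrite /dual; case: cid. Qed.

Lemma adj_unique' F G F' G' : adj F G -> adj F' G' -> F =1 F' -> G =1 G'.
Proof. exact: (adj_unique XM X_x (@sfun_torsion _ _)). Qed.

Lemma dual_eq f F G v : adj F G -> (forall w, F w = pr w f) -> dual f v = G v.
Proof. by move=> FG Fpr; apply: adj_unique' (pr_adj f) FG _ v => w; rewrite Fpr. Qed.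

Lemma dualE N f v : u_order N f ->
  dual f v = \sum_(l < N) iter l NX (pa l f * v).
Proof. by move=> fN; exact: dual_eq (pr_adj_order fN) _. Qed.

Lemma dualD f v w : dual f (v + w) = dual f v + dual f w.
Proof. exact: adjDr (pr_adj f). Qed.
Lemma dualN f v : dual f (- v) = - dual f v.
Proof. exact: additiveN (dualD f). Qed.
Lemma dualB f v w : dual f (v - w) = dual f v - dual f w.
Proof. exact: additiveB (dualD f). Qed.

Lemma dual_addf f g v : dual (f + g) v = dual f v + dual g v.
Proof.
rewrite (dual_eq v (adj_add (pr_adj f) (pr_adj g)))// => w.
by rewrite raddfD.
Qed.

Lemma dual_oppf f v : dual (- f) v = - dual f v.
Proof.
rewrite (dual_eq v (adjN XM (pr_adj f)))// => w.
by rewrite raddfN.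
Qed.

Lemma dual_subf f g v : dual (f - g) v = dual f v - dual g v.
Proof. by rewrite dual_addf dual_oppf. Qed.

Lemma dual_sumf (T : Type) (r : seq T) (F : T -> A) v :
  dual (\sum_(t <- r) F t) v = \sum_(t <- r) dual (F t) v.
Proof.
rewrite (dual_eq v (adj_sum r (fun t => pr_adj (F t))))// => w.
by rewrite raddf_sum.
Qed.

Lemma dual_X f v : dual (X f) v = - dual f (X v).
Proof.
rewrite -dualN (dual_eq v (adj_comp XM (adjX _) (pr_adj f)))// => w.
by rewrite pr_X.
Qed.

Lemma dual_mul f g v : dual (f * g) v = dual f (g * v) + dual g (f * v).
Proof.
rewrite (dual_eq v (adj_add (adj_comp XM (adj_mul _ g) (pr_adj f))
  (adj_comp XM (adj_mul _ f) (pr_adj g))))// => w.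
by rewrite derM mulrC.
Qed.

Lemma dual_iterNX i f v : dual (iter i NX f) v = dual f (iter i X v).
Proof.
elim: i f v => [//|i ih] f v.
by rewrite iterSr ih dual_oppf dual_X opprK.
Qed.

Lemma dual_iterX i f v : dual (iter i X f) v = dual f (iter i NX v).
Proof.
elim: i f v => [//|i ih] f v.
by rewrite iterSr ih dual_X -dualN.
Qed.

Lemma pr_iterNX v i f : pr v (iter i NX f) = iter i NX (pr v f).
Proof. by elim: i => //= i ih; rewrite raddfN /= pr_X ih. Qed.

Lemma dual_u v : dual uA v = v.
Proof.
by rewrite (dual_eq v (adj_id _))// => w; rewrite pr_u.
Qed.

Lemma adj_pr_commutator v F G : adj F G ->
  adj (fun w => pr v (F w) - F (pr v w)) (fun w => pr v (G w) - G (pr v w)).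
Proof. exact: adj_commutator (derM _) (pr_X v). Qed.

Lemma adj_tau_commutator F G : adj F G ->
  adj (fun w => tau (F w) - F (tau w)) (fun w => tau (G w) - G (tau w)).
Proof. exact: adj_commutator (derM _) tau_X. Qed.

Section Transport.
Variable K : A.
Local Notation T f := (tau f + pr K f).
Local Notation Kl v := (pr v K).
Local Notation Kd := (dual K).

Lemma T_X f : T (X f) = X (T f).
Proof. by rewrite tau_X pr_X raddfD. Qed.

Lemma T_pr v f : T (pr v f) = pr v (T f) + pr (T v - Kl v) f.
Proof.
rewrite tau_pr raddfD (prB _ _ f) prD.
have := pr_pr K v f; rewrite prB => /eqP; rewrite subr_eq => /eqP ->; ring.
Qed.

(** The adjoint, in the direction v, of the commutator of pr v and pr w applied to
   K. *)
Lemma dual_Kl w b :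
  dual (Kl w) b = pr w (Kd b) - Kd (pr w b) + dual w (Kd b).
Proof.
rewrite (dual_eq b (adj_add (adj_pr_commutator w (pr_adj K))
  (adj_comp XM (pr_adj K) (pr_adj w))))// => v.
have := pr_pr v w K; rewrite prB => /eqP; rewrite subr_eq => /eqP ->; ring.
Qed.

(** The second variation of K is symmetric in its two directions. *)
Lemma dual_Kd a v : dual (Kd a) v = pr v (Kd a) - Kd (pr v a) + dual a (Kl v).
Proof.
have [N KN] := u_order_ex K.
have pN j : u_order N (pa j K).
  by move=> l Nl; rewrite pa_comm (KN l Nl) /pa pdA_der raddf0.
rewrite !(dualE _ KN) (u_order_pr v KN).
rewrite dual_sumf raddf_sum -sumrB.
under eq_bigr do rewrite dual_iterNX dual_mul.
rewrite big_split /= (additive_sum _ _ (dualD a)); congr (_ + _).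
under eq_bigr => j _ do rewrite (dualE _ (pN j)).
rewrite exchange_big /=; apply: eq_bigr => l _.
rewrite pr_iterNX derM (iterNXD XM) addrK (u_order_pr v (pN l)) mulr_suml.
rewrite (additive_sum _ _ (iterNXD XM l)); apply: eq_bigr => j _.
by rewrite pa_comm; congr (iter _ _ _); ring.
Qed.

(** The adjoint of [T_pr]. *)
Lemma T_dual f v : T (dual f v) + Kd (dual f v) = dual f (T v) + dual (T f) v.
Proof.
rewrite [dual (T f) v](dual_eq v (adj_add (adj_add (adj_tau_commutator (pr_adj f))
  (adj_pr_commutator K (pr_adj f))) (adj_comp XM (pr_adj f) (pr_adj K)))).
  by rewrite dualD; ring.
move=> w; have := T_pr w f; rewrite (prB _ _ f) prD => E.
rewrite [RHS](_ : _ = tau (pr w f) + pr K (pr w f) - (pr (tau w) f + pr (pr K w) f - pr (pr w K) f)).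
  ring.
by rewrite E; ring.
Qed.

Section Defect.
Variable Rop : A -> A.

(** The obstruction to Rop being closed: for skew-adjoint Rop, multiplying by a third
   function h and working modulo the image of X gives the cyclic sum of
   h (pr v Rop) w. *)
Definition defect w v := pr v (Rop w) - Rop (pr v w) - pr w (Rop v)
  + Rop (pr w v) - dual (Rop w) v - dual w (Rop v).

Hypothesis RD : {morph Rop : v w / v + w}.
Local Notation l v := (T v - Kl v).

Hypothesis S0 : forall w, T (Rop w) + Kd (Rop w) = Rop (l w).

Let RB v w : Rop (v - w) = Rop v - Rop w := additiveB v w RD.

(** The flow of the equation preserves the defect of an operator that intertwines
   the linearized equation with its adjoint. *)
Lemma defect_transport w v :
  T (defect w v) + Kd (defect w v) = defect (l w) v + defect w (l v).
Proof.
have TR b : T (Rop b) = Rop (l b) - Kd (Rop b) by rewrite -S0 addrK.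
have F6 (F : A -> A) : {morph F : a b / a + b} -> F (defect w v) = F (pr v (Rop w)) -
    F (Rop (pr v w)) - F (pr w (Rop v)) + F (Rop (pr w v)) - F (dual (Rop w) v) -
    F (dual w (Rop v)).
  by move=> FD; rewrite /defect !(additiveB _ _ FD, FD).
have T_add : {morph (fun f : A => T f) : a b / a + b}.
  by move=> a b; rewrite !raddfD addrACA.
have T6 := F6 _ T_add.
have K6 := F6 Kd (dualD K).
have H1 a b : T (pr b (Rop a)) = pr b (Rop (l a)) - pr b (Kd (Rop a)) + pr (l b) (Rop a).
  by rewrite T_pr TR raddfB.
have H2 a b : T (Rop (pr b a)) + Kd (Rop (pr b a)) =
    Rop (pr b (l a)) + Rop (pr (l b) a) + (Rop (pr b (Kl a)) - Rop (Kl (pr b a))).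
  rewrite S0 T_pr -RD -RB -RD; congr (Rop _); rewrite [pr b (l a)]raddfB; ring.
have H3 : Rop (pr v (Kl w)) - Rop (Kl (pr v w)) = Rop (pr w (Kl v)) - Rop (Kl (pr w v)).
  rewrite -!RB; congr (Rop _).
  have := pr_pr v w K; rewrite prB => /eqP; rewrite subr_eq => /eqP ->; ring.
have H2' a b : T (Rop (pr b a)) = Rop (pr b (l a)) + Rop (pr (l b) a)
    + (Rop (pr b (Kl a)) - Rop (Kl (pr b a))) - Kd (Rop (pr b a)).
  by rewrite -H2 addrK.
have H5 : T (dual (Rop w) v) = dual (Rop w) (T v) + dual (Rop (l w)) v
    - dual (Kd (Rop w)) v - Kd (dual (Rop w) v).
  have := T_dual (Rop w) v; rewrite TR dual_subf => E.
  by rewrite -[LHS](addrK (Kd (dual (Rop w) v))) E; ring.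
have H6 : T (dual w (Rop v)) = dual w (Rop (l v)) - dual w (Kd (Rop v))
    + dual (T w) (Rop v) - Kd (dual w (Rop v)).
  have := T_dual w (Rop v); rewrite TR dualB => E.
  by rewrite -[LHS](addrK (Kd (dual w (Rop v)))) E; ring.
rewrite K6 T6 (H1 w v) (H2' w v) (H1 v w) (H2' v w) H5 H6 /defect.
rewrite (dual_Kd (Rop w) v) (dual_subf (T w)) (dualB (Rop w) (T v)).
rewrite (dual_Kl w (Rop v)).
move: H3 => /eqP; rewrite subr_eq => /eqP ->; ring.
Qed.

End Defect.
End Transport.
End Evolution.

(** * Bidifferential operators preserved by an odd order evolution *)

Section Bidifferential.
Variables (A : comPzRingType) (X : {additive A -> A}).
Hypothesis XM : forall a b, X (a * b) = X a * b + a * X b.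
Implicit Types (a b v w : A) (Z : A -> A -> A) (P Q : pred (nat * nat)).

Definition bmono a k l w v := a * (iter k X w * iter l X v).

(** Bidifferential operators all of whose monomials (X^k w)(X^l v) satisfy P. *)
Definition bidiff P Z := exists s : seq ((nat * nat) * A),
  all (fun t => P t.1) s /\
  forall w v, Z w v = \sum_(t <- s) bmono t.2 t.1.1 t.1.2 w v.

Lemma bidiff_ext P Z Z' : bidiff P Z -> (forall w v, Z w v = Z' w v) -> bidiff P Z'.
Proof. by move=> [s [sP Zs]] ZZ'; exists s; split=> // w v; rewrite -ZZ'. Qed.

Lemma bidiffW P Q Z : subpred P Q -> bidiff P Z -> bidiff Q Z.
Proof.
move=> PQ [s [sP Zs]]; exists s; split=> //.
by apply: sub_all sP => t; exact: PQ.
Qed.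

Lemma bidiff_mono P a k l : P (k, l) -> bidiff P (bmono a k l).
Proof. by move=> Pkl; exists [:: ((k, l), a)]; rewrite /= Pkl; split=> // w v; rewrite big_seq1. Qed.

Lemma bidiff0 P : bidiff P (fun _ _ => 0).
Proof. by exists [::]; split=> // w v; rewrite big_nil. Qed.

Lemma bidiffD P Z Z' : bidiff P Z -> bidiff P Z' ->
  bidiff P (fun w v => Z w v + Z' w v).
Proof.
move=> [s [sP Zs]] [s' [s'P Zs']]; exists (s ++ s'); rewrite all_cat sP s'P.
by split=> // w v; rewrite big_cat Zs Zs'.
Qed.

Lemma bidiff_sum P (T : Type) (r : seq T) (F : T -> A -> A -> A) :
  (forall t, bidiff P (F t)) -> bidiff P (fun w v => \sum_(t <- r) F t w v).
Proof.
move=> FP; elim: r => [|t r ih].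
  by apply: bidiff_ext (bidiff0 P) _ => w v; rewrite big_nil.
by apply: bidiff_ext (bidiffD (FP t) ih) _ => w v; rewrite big_cons.
Qed.

(** For an additive transformation of operators it suffices to look at monomials. *)
Lemma bidiff_ind P Q (H : (A -> A -> A) -> A -> A -> A) Z :
  (forall Z1 Z2, (forall w v, Z1 w v = Z2 w v) -> forall w v, H Z1 w v = H Z2 w v) ->
  (forall w v, H (fun _ _ => 0) w v = 0) ->
  (forall Z1 Z2 w v, H (fun w v => Z1 w v + Z2 w v) w v = H Z1 w v + H Z2 w v) ->
  (forall a k l, P (k, l) -> bidiff Q (H (bmono a k l))) ->
  bidiff P Z -> bidiff Q (H Z).
Proof.
move=> Hext H0 HD Hm [s [sP Zs]].
suff: bidiff Q (H (fun w v => \sum_(t <- s) bmono t.2 t.1.1 t.1.2 w v)).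
  by move/bidiff_ext; apply => w v; apply: Hext => w' v'; rewrite Zs.
elim: s sP {Zs} => [_|[[k l] a] s ih /= /andP[Pt sP]].
  apply: bidiff_ext (bidiff0 Q) _ => w v; rewrite -[LHS](H0 w v).
  by apply: Hext => w' v'; rewrite big_nil.
apply: bidiff_ext (bidiffD (Hm a k l Pt) (ih sP)) _ => w v.
by rewrite -HD; apply: Hext => w' v'; rewrite big_cons.
Qed.

Lemma bidiffZ P a Z : bidiff P Z -> bidiff P (fun w v => a * Z w v).
Proof.
apply: (@bidiff_ind P P (fun Z w v => a * Z w v)).
- by move=> Z1 Z2 e w v; rewrite e.
- by move=> w v; rewrite mulr0.
- by move=> *; rewrite mulrDr.
- move=> b k l Pkl; apply: bidiff_ext (bidiff_mono (a * b) Pkl) _ => w v.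
  by rewrite /bmono; ring.
Qed.

Lemma bidiffN P Z : bidiff P Z -> bidiff P (fun w v => - Z w v).
Proof. by move=> /(bidiffZ (-1)) /bidiff_ext; apply => w v; rewrite mulN1r. Qed.

Lemma bidiffB P Z Z' : bidiff P Z -> bidiff P Z' ->
  bidiff P (fun w v => Z w v - Z' w v).
Proof. by move=> ZP /bidiffN; exact: bidiffD. Qed.

Lemma X_bmono a k l w v : X (bmono a k l w v) =
  bmono (X a) k l w v + bmono a k.+1 l w v + bmono a k l.+1 w v.
Proof. by rewrite /bmono !XM /= mulrDr addrA. Qed.

Lemma bidiffX P Q Z : (forall k l, P (k, l) -> [/\ Q (k, l), Q (k.+1, l) & Q (k, l.+1)]) ->
  bidiff P Z -> bidiff Q (fun w v => X (Z w v)).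
Proof.
move=> PQ; apply: (@bidiff_ind P Q (fun Z w v => X (Z w v))).
- by move=> Z1 Z2 e w v; rewrite e.
- by move=> w v; rewrite raddf0.
- by move=> *; rewrite raddfD.
- move=> a k l /PQ[Q0 Q1 Q2].
  have := bidiffD (bidiffD (bidiff_mono (X a) Q0) (bidiff_mono a Q1)) (bidiff_mono a Q2).
  by move/bidiff_ext; apply => w v; rewrite X_bmono.
Qed.

(** The Leibniz formula; only the leading coefficient of the result is made explicit. *)
Lemma iterX_mul k a : exists c : nat -> A, c k = a /\
  forall w, iter k X (a * w) = \sum_(j < k.+1) c j * iter j X w.
Proof.
elim: k => [|k [c [ck cE]]].
  by exists (fun=> a); split=> // w; rewrite big_ord1.
exists (fun j => (if (j <= k)%N then X (c j) else 0) + (if j is j'.+1 then c j' else 0)).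
split=> [|w]; first by rewrite ltnn add0r ck.
rewrite iterS cE raddf_sum /=.
under eq_bigr do rewrite XM.
rewrite big_split /=; under [in RHS]eq_bigr do rewrite mulrDl.
rewrite [in RHS]big_split /=; congr (_ + _).
  rewrite [in RHS]big_ord_recr /= ltnn mul0r addr0.
  by apply: eq_bigr => i _; rewrite -ltnS ltn_ord.
by rewrite [in RHS]big_ord_recl mul0r add0r.
Qed.

Lemma bidiff_precomp_l P Q a m Z :
  (forall k l, P (k, l) -> forall j, (j <= k)%N -> Q (j + m, l)%N) ->
  bidiff P Z -> bidiff Q (fun w v => Z (a * iter m X w) v).
Proof.
move=> PQ; apply: (@bidiff_ind P Q (fun Z w v => Z (a * iter m X w) v)) => //.
move=> b k l /PQ {}PQ; have [c [_ cE]] := iterX_mul k a.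
have := @bidiff_sum Q _ (index_enum 'I_k.+1)
  (fun j => bmono (b * c j) (j + m) l) (fun j => bidiff_mono _ (PQ j (ltn_ord j))).
move/bidiff_ext; apply => w v; rewrite /bmono cE mulr_suml mulr_sumr.
by apply: eq_bigr => j _; rewrite iterD; ring.
Qed.

Lemma bidiff_precomp_r P Q a m Z :
  (forall k l, P (k, l) -> forall j, (j <= l)%N -> Q (k, j + m)%N) ->
  bidiff P Z -> bidiff Q (fun w v => Z w (a * iter m X v)).
Proof.
move=> PQ; apply: (@bidiff_ind P Q (fun Z w v => Z w (a * iter m X v))) => //.
move=> b k l /PQ {}PQ; have [c [_ cE]] := iterX_mul l a.
have := @bidiff_sum Q _ (index_enum 'I_l.+1)
  (fun j => bmono (b * c j) k (j + m)) (fun j => bidiff_mono _ (PQ j (ltn_ord j))).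
move/bidiff_ext; apply => w v; rewrite /bmono cE mulr_sumr mulr_sumr.
by apply: eq_bigr => j _; rewrite iterD; ring.
Qed.

Variable x : A.
Hypothesis Xx : X x = 1.
Hypothesis torsion : forall n a, n.+1%:R * a = 0 -> a = 0.

(** Powers of x separate the monomials, by the one-variable test in each slot. *)
Lemma bidiff_coef (s : seq ((nat * nat) * A)) :
  (forall k l, \sum_(t <- s) bmono t.2 t.1.1 t.1.2 (x ^+ k) (x ^+ l) = 0) ->
  forall i j, \sum_(t <- s | t.1 == (i, j)) t.2 = 0.
Proof.
move=> H i j.
have key (r : seq (nat * A)) :
    (forall k, \sum_(t <- r) t.2 * iter t.1 X (x ^+ k) = 0) ->
    forall i, \sum_(t <- r | t.1 == i) t.2 = 0.
  move=> Hr i'; have [N rN] := seq_array r.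
  have c0 : forall i, (i < N)%N -> \sum_(t <- r | t.1 == i) t.2 = 0.
    apply: (coef_test XM Xx torsion) => k.
    rewrite -[RHS](Hr k) (rN _ (fun i a => a * iter i X (x ^+ k)))// => i0 a b.
    exact: mulrDl.
  have [/c0//|Ni] := ltnP i' N.
  pose Hi k a := if k == i' then a else 0.
  have := rN _ Hi; rewrite /Hi -big_mkcond /= => ->.
    rewrite big1// => k _; case: eqP => // e.
    by move: (ltn_ord k); rewrite e ltnNge Ni.
  by move=> k a b; case: eqP => _; rewrite ?addr0.
have H1 l : forall i, \sum_(t <- s | t.1.1 == i) t.2 * iter t.1.2 X (x ^+ l) = 0.
  move=> i0.
  have := @key [seq (t.1.1, t.2 * iter t.1.2 X (x ^+ l)) | t <- s] _ i0.
  rewrite big_map; apply => k; rewrite big_map -[RHS](H k l).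
  by apply: eq_bigr => t _; rewrite /bmono /=; ring.
have := @key [seq (t.1.2, t.2) | t <- s & t.1.1 == i] _ j.
rewrite big_map big_filter_cond /= => E.
rewrite -[RHS]E => [|l]; last by rewrite big_map big_filter -[RHS](H1 l i).
by apply: eq_bigl => -[[k l] a] /=; rewrite xpair_eqE.
Qed.

(** The monomials that precede (X^i w)(X^(d-i) v): lower total order, or the
   same total order and fewer derivatives on w. *)
Definition below d i : pred (nat * nat) := fun t =>
  (t.1 + t.2 < d)%N || ((t.1 + t.2 == d)%N && (t.1 < i)%N).

Lemma bidiff_lead i j c Z : bidiff (below (i + j) i) Z ->
  (forall k l, bmono c i j (x ^+ k) (x ^+ l) + Z (x ^+ k) (x ^+ l) = 0) -> c = 0.
Proof.
move=> [s [sP Zs]] H.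
have := @bidiff_coef (((i, j), c) :: s) _ i j; rewrite big_cons eqxx => <-.
  rewrite big1_seq ?addr0// => t /andP[/eqP tij ts].
  by move: (allP sP _ ts); rewrite tij /below /= ltnn eqxx ltnn.
by move=> k l; rewrite big_cons -Zs H.
Qed.

Lemma bidiff_below_ext Z : bidiff (below 0 0) Z -> forall w v, Z w v = 0.
Proof.
move=> [s [sP Zs]] w v; rewrite Zs big1_seq// => t /andP[_ /(allP sP)].
by rewrite /below !ltn0 andbF.
Qed.

(** By the Leibniz rule X^n (c (X^k w)(X^l v)) begins with all n derivatives on w,
   followed by n times the term with one of them on v. *)
Lemma iterX_bmono n c k l : bidiff (below (k + l + n) (k + n).-1)
  (fun w v => iter n X (bmono c k l w v) - bmono c (k + n) l w v
    - bmono (n%:R * c) (k + n).-1 l.+1 w v).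
Proof.
elim: n => [|n ih].
  apply: bidiff_ext (bidiff0 _) _ => w v; rewrite addn0 /bmono /= mulr0n !mul0r; ring.
have h : bidiff (below (k + l + n.+1) (k + n))
  (fun w v => X (iter n X (bmono c k l w v) - bmono c (k + n) l w v
    - bmono (n%:R * c) (k + n).-1 l.+1 w v)).
  by apply: bidiffX ih => k' l'; rewrite /below /= => H; split; lia.
rewrite (addnS k n) /=.
have h1 : bidiff (below (k + l + n.+1) (k + n)) (bmono (X c) (k + n) l).
  by apply: bidiff_mono; rewrite /below /=; lia.
have h2 : bidiff (below (k + l + n.+1) (k + n)) (bmono (X (n%:R * c)) (k + n).-1 l.+1).
  case: n {ih h h1} => [|n].
    by apply: bidiff_ext (bidiff0 _) _ => w v; rewrite /bmono mulr0n mul0r raddf0 mul0r.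
  by apply: bidiff_mono; rewrite /below /=; lia.
have h3 : bidiff (below (k + l + n.+1) (k + n))
    (bmono (if n is 0 then 0 else n%:R * c) (k + n).-1 l.+2).
  case: n {ih h h1 h2} => [|n].
    by apply: bidiff_ext (bidiff0 _) _ => w v; rewrite /bmono mul0r.
  by apply: bidiff_mono; rewrite /below /=; lia.
have := bidiffD h (bidiffD h1 (bidiffD h2 h3)); move/bidiff_ext; apply => w v.
rewrite !raddfB /= !X_bmono.
have -> : bmono (n.+1%:R * c) (k + n) l.+1 w v =
    bmono (n%:R * c) (k + n) l.+1 w v + bmono c (k + n) l.+1 w v.
  by rewrite /bmono mulrS; ring.
case: n {ih h h1 h2 h3} => [|n]; first by rewrite addn0 /bmono mulr0n !mul0r; ring.
by rewrite !addnS /=; ring.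
Qed.

Local Notation commX n a Z :=
  (fun w v : A => iter n X (a * Z w v) - Z (a * iter n X w) v).

(** Letting the n derivatives act on the first slot only cancels the leading term. *)
Lemma commX_bmono n a c k l : (0 < n)%N -> bidiff (below (k + l + n) (k + n).-1)
  (fun w v => commX n a (bmono c k l) w v - bmono (n%:R * (a * c)) (k + n).-1 l.+1 w v).
Proof.
move=> n0; have [e [ek eE]] := iterX_mul k a.
have low : bidiff (below (k + l + n) (k + n).-1)
    (fun w v => \sum_(j < k) bmono (c * e j) (j + n) l w v).
  apply: bidiff_sum => j; apply: bidiff_mono.
  by rewrite /below /=; have := ltn_ord j; lia.
have := bidiffB (iterX_bmono n (a * c) k l) low; move/bidiff_ext; apply => w v.
have -> : bmono c k l (a * iter n X w) v =
    bmono (a * c) (k + n) l w v + \sum_(j < k) bmono (c * e j) (j + n) l w v.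
  rewrite {1}/bmono eE big_ord_recr /= ek mulrDl mulrDr mulr_suml mulr_sumr addrC.
  rewrite -iterD /bmono; congr (_ + _); first ring.
  by apply: eq_bigr => j _; rewrite iterD; ring.
have -> : a * bmono c k l w v = bmono (a * c) k l w v by rewrite /bmono mulrA.
ring.
Qed.

Lemma commX_below n a d i Z : (0 < n)%N -> bidiff (below d i) Z ->
  bidiff (below (d + n) (i + n).-1) (commX n a Z).
Proof.
move=> n0; apply: (@bidiff_ind (below d i) _ (fun Z => commX n a Z)).
- by move=> Z1 Z2 e w v; rewrite !e.
- by move=> w v; rewrite mulr0 (additive0 (iterXD XM n)) subr0.
- by move=> Z1 Z2 w v; rewrite mulrDr (iterXD XM); ring.
- move=> c k l kl.
  have h1 : bidiff (below (d + n) (i + n).-1) (bmono (n%:R * (a * c)) (k + n).-1 l.+1).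
    by apply: bidiff_mono; move: kl; rewrite /below /=; lia.
  have h2 := commX_bmono a c k l n0.
  have h3 : bidiff (below (d + n) (i + n).-1) _ := bidiffW _ h2.
  apply: bidiff_ext (bidiffD (h3 _) h1) _ => [[k' l']|w v]; last by rewrite subrK.
  by move: kl; rewrite /below /=; lia.
Qed.

Lemma bidiff_lead_split d i Z : bidiff (below d i.+1) Z -> (i <= d)%N ->
  exists c, bidiff (below d i) (fun w v => Z w v - bmono c i (d - i) w v).
Proof.
move=> [s [sP Zs]] id; exists (\sum_(t <- s | t.1 == (i, d - i)%N) t.2).
exists [seq t <- s | t.1 != (i, d - i)%N]; split.
  apply/allP => -[[k l] b]; rewrite mem_filter /= => /andP[kl /(allP sP)].
  by move: kl; rewrite xpair_eqE /below /=; lia.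
move=> w v; rewrite Zs big_filter (bigID (fun t => t.1 == (i, d - i)%N)) /=.
rewrite addrC; apply/eqP; rewrite subr_eq; apply/eqP; congr (_ + _).
by rewrite /bmono mulr_suml; apply: eq_bigr => -[[k l] b] /= /eqP[-> ->].
Qed.

Lemma iter_NX n f : iter n (fun v => - X v) f = (-1) ^+ n * iter n X f.
Proof.
elim: n => [|n ih]; first by rewrite mul1r.
rewrite /= ih exprS -mulrA mulN1r; congr (- _).
have X1 : X 1 = 0.
  by apply: (addrI (X 1)); rewrite addr0 -{3}(mul1r 1) XM mul1r mulr1.
have -> : X ((-1) ^+ n * iter n X f) = X ((-1) ^+ n) * iter n X f + (-1) ^+ n * X (iter n X f).
  exact: XM.
suff -> : X ((-1) ^+ n) = 0 by rewrite mul0r add0r.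
by rewrite -signr_odd; case: odd; rewrite ?expr0// expr1 raddfN X1 oppr0.
Qed.

Lemma bidiffDl P Z u w v : bidiff P Z -> Z (u + w) v = Z u v + Z w v.
Proof.
move=> [s [_ Zs]]; rewrite !Zs -big_split; apply: eq_bigr => t _.
by rewrite /bmono (iterXD XM) /=; ring.
Qed.

Lemma bidiffDr P Z u w v : bidiff P Z -> Z u (w + v) = Z u w + Z u v.
Proof.
move=> [s [_ Zs]]; rewrite !Zs -big_split; apply: eq_bigr => t _.
by rewrite /bmono (iterXD XM) /=; ring.
Qed.

Section Vanishing.
Variables (D : {additive A -> A}) (n : nat) (kappa : nat -> A).
Hypothesis DM : forall a b, D (a * b) = D a * b + a * D b.
Hypothesis DX : forall a, D (X a) = X (D a).
Hypothesis Dx : forall k, D (x ^+ k) = 0.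
Hypothesis n_odd : odd n.
Hypothesis n_ge2 : (2 <= n)%N.
Hypothesis kappa_reg : forall a, kappa n * a = 0 -> a = 0.
Local Notation L v := (\sum_(m < n.+1) kappa m * iter m X v).
Local Notation L' v := (\sum_(m < n.+1) iter m (fun b => - X b) (kappa m * v)).

Lemma bidiff_der P Z : bidiff P Z ->
  bidiff P (fun w v => D (Z w v) - Z (D w) v - Z w (D v)).
Proof.
have DXi m f : D (iter m X f) = iter m X (D f) by elim: m => //= m ih; rewrite DX ih.
apply: (@bidiff_ind P P (fun Z w v => D (Z w v) - Z (D w) v - Z w (D v))).
- by move=> Z1 Z2 e w v; rewrite !e.
- by move=> w v; rewrite raddf0 !subr0.
- by move=> Z1 Z2 w v; rewrite raddfD; ring.
- move=> c k l kl; apply: bidiff_ext (bidiff_mono (D c) kl) _ => w v.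
  by rewrite /bmono !DM !DXi; ring.
Qed.

(** The leading monomial c (X^i w)(X^j v) of Z produces the coefficient
   - n kappa_n c of (X^(i+n-1) w)(X^(j+1) v). For n >= 2 no other term of the
   equation reaches that monomial, so c = 0. Oddness of n is what makes the terms
   kappa_n (X^(i+n) w)(X^j v) cancel. *)
Lemma bidiff_transport0 P Z : bidiff P Z ->
  (forall k l, let w := x ^+ k in let v := x ^+ l in
    D (Z w v) + L' (Z w v) + Z (L w) v + Z w (L v) = 0) ->
  forall w v, Z w v = 0.
Proof.
move=> ZP HZ.
have step d i : bidiff (below d i.+1) Z -> bidiff (below d i) Z.
  move=> Zdi; have [id|di] := leqP i d; last first.
    by apply: bidiffW Zdi => -[k l]; rewrite /below /=; lia.
  have [c Zc] := bidiff_lead_split Zdi id.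
  suff c0 : c = 0 by apply: bidiff_ext Zc _ => w v; rewrite c0 /bmono mul0r subr0.
  set Q := below (d + n) (i + n).-1.
  have n0 : (0 < n)%N by exact: ltnW.
  (* the terms that cannot contribute to the leading monomial *)
  have h1 : bidiff Q (fun w v => D (Z w v) - Z (D w) v - Z w (D v)).
    apply: bidiffW (bidiff_der Zdi) => -[k l]; rewrite /Q /below /=; lia.
  have h2 : bidiff Q (fun w v => \sum_(m < n) iter m (fun v => - X v) (kappa m * Z w v)).
    apply: bidiff_sum => m.
    have hm j : bidiff (below (d + j).+1 0) (fun w v => iter j X (kappa m * Z w v)).
      elim: j => [|j ih] /=.
        by apply: bidiffW (bidiffZ (kappa m) Zdi) => -[k l]; rewrite /below /=; lia.
      by apply: bidiffX ih => k l; rewrite /below /= => kl; split; lia.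
    have := bidiffZ ((-1) ^+ m) (hm m); have mn := ltn_ord m.
    move=> h; apply: bidiff_ext (bidiffW _ h) _ => [[k l]|w v]; last by rewrite iter_NX.
    by rewrite /Q /below /=; lia.
  have h3 : bidiff Q (fun w v => \sum_(m < n) Z (kappa m * iter m X w) v).
    apply: bidiff_sum => m; apply: bidiff_precomp_l Zdi => k l kl j jk.
    by have := ltn_ord m; move: kl; rewrite /Q /below /=; lia.
  have h4 : bidiff Q (fun w v => \sum_(m < n.+1) Z w (kappa m * iter m X v)).
    apply: bidiff_sum => m; apply: bidiff_precomp_r Zdi => k l kl j jk.
    by have := ltn_ord m; move: kl; rewrite /Q /below /=; lia.
  (* the two terms that do contribute *)
  have h5 := commX_below (kappa n) n0 Zc.
  have h6 := commX_bmono (kappa n) c i (d - i) n0; rewrite subnKC// in h6.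
  have h := bidiffB (bidiffD h5 h6) (bidiffD (bidiffD h1 h2) (bidiffD h3 h4)).
  have id' : ((i + n).-1 + (d - i).+1)%N = (d + n)%N by lia.
  rewrite -/Q (_ : Q = below ((i + n).-1 + (d - i).+1) (i + n).-1) in h; last by rewrite id'.
  have E : n%:R * (kappa n * c) = 0.
    apply: (bidiff_lead h) => k l; set w := x ^+ k; set v := x ^+ l.
    have /= := HZ k l; rewrite -/w -/v => Hwv.
    have ZL : Z (L w) v = \sum_(m < n.+1) Z (kappa m * iter m X w) v.
      exact: (additive_sum _ _ (fun a b => bidiffDl a b v ZP)).
    have ZR : Z w (L v) = \sum_(m < n.+1) Z w (kappa m * iter m X v).
      exact: (additive_sum _ _ (fun a b => bidiffDr w a b ZP)).
    rewrite ZL ZR big_ord_recr /= iter_NX -signr_odd n_odd expr1 in Hwv.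
    rewrite [\sum_(m < n.+1) Z (_ * _) v]big_ord_recr /= in Hwv.
    have Z0l a : Z 0 a = 0 := additive0 (fun b b' => bidiffDl b b' a ZP).
    have Z0r a : Z a 0 = 0 := additive0 (fun b b' => bidiffDr a b b' ZP).
    rewrite !Dx Z0l Z0r mulrBr (additiveB _ _ (iterXD XM n)) -[RHS]oppr0 -[in RHS]Hwv.
    ring.
  have : n.-1.+1%:R * (kappa n * c) = 0 by rewrite prednK.
  by move=> /torsion /kappa_reg.
have down d : bidiff (below d 0) Z -> forall w v, Z w v = 0.
  elim: d => [|d ih] Zd; first exact: bidiff_below_ext.
  apply: ih; have : bidiff (below d d.+1) Z.
    by apply: bidiffW Zd => -[k l]; rewrite /below /=; lia.
  by elim: d.+1 => // i ih /step.
case: ZP => s [_ Zs].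
apply: (down (\max_(t <- s) (t.1.1 + t.1.2)).+1); exists s; split=> //.
apply/allP => t ts; rewrite /below ltnS.
by rewrite (leq_bigmax_seq (F := fun t => t.1.1 + t.1.2)%N).
Qed.

End Vanishing.
End Bidifferential.

(** * Closedness of skew-adjoint solutions of the symmetry condition *)

Section Closedness.
Variable R : realType.
Local Notation A := (sfun R (jet_coord nat)).
Implicit Types (a b f g v w : A) (r : nat -> A).
Local Notation X := (der (@Xc R)).
Local Notation tau := (der (@tauc R)).
Local Notation pr v := (der (prc v)).
Local Notation adj := (adj X).
Local Notation NX := (fun v : A => - X v).
Let XM : forall a b, X (a * b) = X a * b + a * X b := derM (@Xc R).

Definition op N r v : A := \sum_(i < N) r i * iter i X v.
Definition opT N r v : A := \sum_(i < N) iter i NX (r i * v).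

Lemma adj_op N r : adj (op N r) (opT N r).
Proof. exact: (adj_sum (index_enum 'I_N) (fun i : 'I_N => adj_mono XM (r i) i)). Qed.

Lemma opD N r : {morph op N r : v w / v + w}.
Proof. by move=> v w; exact: adjDl (adj_op N r). Qed.

Lemma adj_eq0 F G : adj F G -> (forall k, F (xA R ^+ k) = 0) -> forall v, F v = 0.
Proof. by move=> FG /(adj_uniq XM (X_x R) (@sfun_torsion _ _) FG)[]. Qed.

Lemma op_inj N r : (forall k, op N r (xA R ^+ k) = 0) -> forall i, (i < N)%N -> r i = 0.
Proof. exact: (coef_test XM (X_x R) (@sfun_torsion _ _)). Qed.

Lemma der_op N r (V : jet_coord nat -> A) v : (forall f, der V (X f) = X (der V f)) ->
  der V (op N r v) = op N (fun i => der V (r i)) v + op N r (der V v).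
Proof.
move=> VX; rewrite /op raddf_sum -big_split; apply: eq_bigr => i _ /=.
by rewrite derM (der_iterX _ _ VX).
Qed.

(** The derivatives of the arguments cancel, by skew-adjointness. *)
Lemma defectE N r w v : (forall v, opT N r v = - op N r v) ->
  defect (op N r) w v = op N (fun i => pr v (r i)) w - op N (fun i => pr w (r i)) v
    - \sum_(i < N) dual (r i) (iter i X w * v).
Proof.
move=> sk; rewrite /defect (der_op _ _ _ (@pr_X R v)) (der_op _ _ _ (@pr_X R w)).
have -> : dual (op N r w) v =
    \sum_(i < N) dual (r i) (iter i X w * v) + dual w (opT N r v).
  rewrite /op dual_sumf (additive_sum _ _ (dualD w)) -big_split.
  by apply: eq_bigr => i _ /=; rewrite dual_mul dual_iterX.
rewrite sk dualN; ring.
Qed.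

Lemma bidiff_defect N r : (forall v, opT N r v = - op N r v) ->
  bidiff (der (@Xc R)) predT (defect (op N r)).
Proof.
move=> sk; have [M rM] : exists M, forall i, (i < N)%N -> u_order M (r i).
  elim: {sk} N => [|N [M rM]]; first by exists 0%N.
  have [M' rM'] := u_order_ex (r N).
  exists (M + M')%N => i; rewrite ltnS leq_eqVlt => /orP[/eqP->|iN] l Ml.
    by apply: rM'; apply: leq_trans Ml; exact: leq_addl.
  by apply: rM iN _ _; apply: leq_trans Ml; exact: leq_addr.
have h1 : bidiff (der (@Xc R)) predT (fun w v => op N (fun i => pr v (r i)) w).
  apply: (bidiff_ext (bidiff_sum (index_enum 'I_N) (fun i : 'I_N =>
    bidiff_sum (index_enum 'I_M) (fun l : 'I_M =>
      @bidiff_mono _ (der (@Xc R)) predT (pa l (r i)) i l isT)))) => w v.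
  apply: eq_bigr => i _; rewrite (u_order_pr v (rM i (ltn_ord i))) mulr_suml.
  by apply: eq_bigr => l _; rewrite /bmono; ring.
have h2 : bidiff (der (@Xc R)) predT (fun w v => op N (fun i => pr w (r i)) v).
  apply: (bidiff_ext (bidiff_sum (index_enum 'I_N) (fun i : 'I_N =>
    bidiff_sum (index_enum 'I_M) (fun l : 'I_M =>
      @bidiff_mono _ (der (@Xc R)) predT (pa l (r i)) l i isT)))) => w v.
  apply: eq_bigr => i _; rewrite (u_order_pr w (rM i (ltn_ord i))) mulr_suml.
  by apply: eq_bigr => l _; rewrite /bmono; ring.
have hN l Z : bidiff (der (@Xc R)) predT Z ->
    bidiff (der (@Xc R)) predT (fun w v => iter l NX (Z w v)).
  move=> hZ; elim: l => //= l ih; apply: bidiffN.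
  by apply: (bidiffX XM _ ih).
have h3 : bidiff (der (@Xc R)) predT
    (fun w v => \sum_(i < N) dual (r i) (iter i X w * v)).
  apply: bidiff_sum => i.
  have := bidiff_sum (index_enum 'I_M) (fun l : 'I_M => hN l _
    (@bidiff_mono _ (der (@Xc R)) predT (pa l (r i)) i 0 isT)).
  by move/bidiff_ext; apply => w v; rewrite (dualE _ (rM i (ltn_ord i))).
apply: (bidiff_ext (bidiffB (bidiffB h1 h2) h3)) => w v.
by rewrite (defectE _ _ sk).
Qed.

Lemma op_bidiff_defect N r v : (forall v, opT N r v = - op N r v) ->
  exists G, adj (fun w => defect (op N r) w v) G.
Proof.
move=> /bidiff_defect [s [_ Zs]]; eexists.
apply: adj_ext (adj_sum s (fun t => adj_mono XM (t.2 * iter t.1.2 X v) t.1.1)) _ (fun=> erefl).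
by move=> w; rewrite Zs; apply: eq_bigr => t _; rewrite /bmono; ring.
Qed.

(** A bidifferential operator is determined by its values on powers of x. *)
Lemma defect_eq0 N r : (forall v, opT N r v = - op N r v) ->
  (forall k l, defect (op N r) (xA R ^+ k) (xA R ^+ l) = 0) ->
  forall w v, defect (op N r) w v = 0.
Proof.
move=> sk H w v; have [s [_ Zs]] := bidiff_defect sk.
have Z0 k v' : defect (op N r) (xA R ^+ k) v' = 0.
  apply: (@adj_eq0 _ (fun b => \sum_(t <- s) iter t.1.2 NX (t.2 * iter t.1.1 X (xA R ^+ k) * b))) => [|l]; last exact: H.
  apply: adj_ext (adj_sum s (fun t => adj_mono XM (t.2 * iter t.1.1 X (xA R ^+ k)) t.1.2)) _ (fun=> erefl).
  by move=> b; rewrite Zs; apply: eq_bigr => t _; rewrite /bmono; ring.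
have [G ZG] := op_bidiff_defect v sk.
by apply: (adj_eq0 ZG) => k.
Qed.

Section Symplectic.
Variables (K : A) (m : nat).
Hypothesis hm : (1 <= m)%N.
Hypothesis K_order : u_order (2 * m).+2 K.
Hypothesis K_top : forall p, pd (Cu (2 * m).+1) K p != 0.
Local Notation T f := (tau f + pr K f).
Local Notation Kl v := (pr v K).
Local Notation Kd := (dual K).

(** The defect is transported by the linearized equation, so its leading term
   vanishes. *)
Lemma defect_vanishes N r : (forall v, opT N r v = - op N r v) ->
  (forall w, T (op N r w) + Kd (op N r w) = op N r (T w - Kl w)) ->
  forall w v, defect (op N r) w v = 0.
Proof.
move=> sk S0.
have TE f : der (fun c => tauc R c + prc K c) f = T f.
  by apply/esym/der_linear.
have Tx k : T (xA R ^+ k) = 0.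
  by rewrite !der_exp ?addr0//; [exact: pr_x|exact: tau_x].
have kreg a : pa (2 * m).+1 K * a = 0 -> a = 0.
  move=> H; apply/sfunP => p; have := congr1 (fun f : A => f p) H.
  rewrite sfunM => /eqP; rewrite mulf_eq0 => /orP[|/eqP//].
  by rewrite (negbTE (K_top p)).
pose D := der (fun c => tauc R c + prc K c).
have DX f : D (X f) = X (D f) by rewrite /D !TE T_X.
have Dx k : D (xA R ^+ k) = 0 by rewrite /D TE Tx.
have n_odd : odd (2 * m).+1 by rewrite /= mul2n odd_double.
have n_ge2 : (2 <= (2 * m).+1)%N by rewrite ltnS muln_gt0.
apply: (bidiff_transport0 (kappa := fun l => pa l K) XM (X_x R) (@sfun_torsion _ _) (derM _) DX Dx n_odd
  n_ge2 kreg (bidiff_defect sk) _) => k l w v.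
have sk' := bidiff_defect sk.
suff E : T (defect (op N r) w v) + Kd (defect (op N r) w v) +
    defect (op N r) (Kl w) v + defect (op N r) w (Kl v) = 0.
  by rewrite /= TE -[RHS]E (dualE _ K_order) !(u_order_pr _ K_order).
rewrite (defect_transport (@opD N r) S0) !Tx !sub0r.
have N1 : defect (op N r) (- Kl w) v = - defect (op N r) (Kl w) v.
  exact: (additiveN _ (fun a b => bidiffDl XM a b v sk')).
have N2 : defect (op N r) w (- Kl v) = - defect (op N r) w (Kl v).
  exact: (additiveN _ (fun a b => bidiffDr XM w a b sk')).
by rewrite N1 N2; ring.
Qed.

End Symplectic.
End Closedness.

(** * Primitives with respect to the scaling in u *)

Section Primitives.
Variable R : realType.
Local Notation A := (sfun R (jet_coord nat)).
Implicit Types (a b f g v w h : A) (r : nat -> A).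
Local Notation X := (der (@Xc R)).
Local Notation tau := (der (@tauc R)).
Local Notation pr v := (der (prc v)).
Local Notation u := (uA R).
Let XM : forall a b, X (a * b) = X a * b + a * X b := derM (@Xc R).

Lemma iterX_u i : iter i X u = var R (Cu i).
Proof. by elim: i => //= i ->; rewrite der_var. Qed.

(** The scaling u |-> s u, under which pr u is the radial derivation. *)
Definition is_Cu (c : jet_coord nat) := if c is Cu _ then true else false.

Lemma pr_uE f p : pr u f p = vact (radial_vf (R := R) is_Cu) f p.
Proof.
rewrite [LHS](_ : _ = vact (vf (prc u)) f p); last by [].
congr (vact _ _ _); apply/funext => q; apply/funext => -[||i] //=.
by rewrite /vf /= iterX_u.
Qed.

Lemma natmul_sfun n f p : (n%:R * f) p = n%:R * f p.
Proof.
elim: n => [|n ih]; first by rewrite !mul0r.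
by rewrite !mulrS !mulrDl !mul1r sfunD ih.
Qed.

Lemma radial_zero n g : n.+1%:R * g + pr u g = 0 -> g = 0.
Proof.
move=> H; apply/val_inj; apply: (radial_inj (S := is_Cu) (k := n) (sfun_smooth g)).
apply/funext => p; have := congr1 (fun f : A => f p) H.
by rewrite sfunD natmul_sfun pr_uE.
Qed.

Lemma radial_solve n f : exists g, n.+1%:R * g + pr u g = f.
Proof.
exists (mk_sfun (smooth_homotopy is_Cu n (sfun_smooth f))).
apply/sfunP => p; rewrite sfunD natmul_sfun pr_uE.
have H := radial_homotopy is_Cu n (sfun_smooth f).
by rewrite -[X in _ = X p]H.
Qed.

Lemma pru_pr v f : pr u (pr v f) = pr v (pr u f) + pr (pr u v) f - pr v f.
Proof.
have := pr_pr u v f; rewrite pr_u prB => /eqP; rewrite subr_eq => /eqP ->; ring.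
Qed.

Lemma pru_tau f : pr u (tau f) = tau (pr u f).
Proof.
rewrite tau_pr tau_u -[LHS]addr0; congr (_ + _).
by have := prB u u f; rewrite !subrr => ->.
Qed.

Lemma pru_dual f v : pr u (dual f v) = dual f (pr u v) + dual (pr u f) v - dual f v.
Proof.
have E : dual (pr u f) v = pr u (dual f v) - dual f (pr u v) + dual f v.
  rewrite (dual_eq v (adj_add (adj_pr_commutator u (pr_adj f)) (pr_adj f)))// => w.
  by rewrite pru_pr; ring.
by rewrite E; ring.
Qed.

Lemma pr0 f : pr 0 f = 0.
Proof. by have := prB u u f; rewrite !subrr. Qed.

Lemma dual_f0 f : dual f 0 = 0.
Proof. exact: additive0 (dualD f). Qed.

Lemma pr_exp v k : pr v (xA R ^+ k) = 0.
Proof. by rewrite der_exp// pr_x. Qed.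

Lemma tau_exp k : tau (xA R ^+ k) = 0.
Proof. by rewrite der_exp// tau_x. Qed.

(** Up to the defect, the symmetry condition is the u_t-free part of the
   self-adjointness of the linearization of Rop (u_t - K). *)
Lemma symmetry_residue K (Rop : A -> A) w : {morph Rop : v w / v + w} ->
  tau (Rop w) + pr K (Rop w) + dual K (Rop w) - Rop (tau w + pr K w - pr w K)
    + defect Rop K w =
  tau (Rop w) - Rop (tau w) + pr w (Rop K) - dual (Rop K) w.
Proof.
by move=> RD; rewrite /defect (additiveB _ _ RD) RD; ring.
Qed.

Section Primitive.
Variables (K : A) (N : nat) (r : nat -> A).
Hypothesis sk : forall v, opT N r v = - op N r v.
Hypothesis closed : forall w v, defect (op N r) w v = 0.
Hypothesis residue : forall w,
  tau (op N r w) - op N r (tau w) + pr w (op N r K) - dual (op N r K) w = 0.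

Variables (b : nat -> A) (k : A).
Hypothesis bE : forall i, 2%:R * b i + pr u (b i) = r i.
Hypothesis kE : 1%:R * k + pr u k = op N r K.

Lemma pru_op v : pr u (op N b v) = op N b (pr u v) + op N r v - 2%:R * op N b v.
Proof.
have E : op N (fun i => pr u (b i)) v = op N r v - 2%:R * op N b v.
  rewrite /op mulr_sumr -sumrB; apply: eq_bigr => i _.
  by rewrite -bE; ring.
by rewrite (der_op _ _ _ (@pr_X R u)) E; ring.
Qed.

(** Taking adjoints commutes with pr u, so 2 + pr u annihilates B + B^T on powers of
   x. *)
Lemma primitive_skew v : opT N b v = - op N b v.
Proof.
apply/eqP; rewrite -addr_eq0 addrC; apply/eqP; move: v.
have adjY := adj_add (adj_op N b) (adj_sym XM (adj_op N b)).
apply: (adj_eq0 adjY) => j; set w := xA R ^+ j.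
(* taking adjoints in the previous identity *)
have E : pr u (opT N b w) - opT N b (pr u w) = opT N r w - 2%:R * opT N b w.
  apply: (adj_unique XM (X_x R) (@sfun_torsion _ _)
    (adj_pr_commutator u (adj_op N b))
    (adjB XM (adj_op N r) (adj_comp XM (adj_op N b) (adj_mul _ 2%:R))) _ w) => v.
  by rewrite pru_op [op N b (_ * _)](_ : _ = 2%:R * op N b v); [ring|rewrite !(mulr_natl _ 2) !mulr2n opD].
have pw : pr u w = 0 by exact: pr_exp.
apply: (@radial_zero 1); rewrite raddfD /= pru_op pw.
move: E; rewrite pw (additive0 (adj_D (adj_op N b)).2) subr0 => ->.
by rewrite sk (additive0 (opD N b)); ring.
Qed.

(** On powers of x, 3 + pr u maps the defect of B to the defect of R. *)
Lemma primitive_closed v w : defect (op N b) v w = 0.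
Proof.
apply: (defect_eq0 primitive_skew) => i j {v w}.
set w := xA R ^+ i; set v := xA R ^+ j.
have o0 r' : op N r' 0 = 0 := additive0 (opD N r').
(* on powers of x only three terms of the defect survive *)
have defectx r' : defect (op N r') w v =
    pr v (op N r' w) - pr w (op N r' v) - dual (op N r' w) v.
  rewrite /defect /w /v !pr_exp !o0 subr0 addr0 (dual_eq (op N r' _) (adj0 _)) ?subr0//.
  by move=> h; rewrite pr_exp.
have pB a : pr u a = 0 -> pr u (op N b a) = op N r a - 2%:R * op N b a.
  by move=> pa0; rewrite pru_op pa0 o0 add0r.
have [pw pv] : pr u w = 0 /\ pr u v = 0 by rewrite !pr_exp.
apply: (@radial_zero 2); rewrite -[RHS](closed w v) !defectx !raddfB /=.
rewrite !pru_pr pru_dual !pB// pw pv !pr0 dual_f0 !raddfB /= dual_subf.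
rewrite !(mulr_natl _ 2) !raddfMn /= mulr2n dual_addf; ring.
Qed.

(** On powers of x, 2 + pr u maps this identity for k and B to the one for R. *)
Lemma primitive_residue h : dual k h = pr h k + (tau (op N b h) - op N b (tau h)).
Proof.
have adjG := adjB XM (adjB XM (adj_sym XM (pr_adj k)) (pr_adj k))
  (adj_tau_commutator (adj_op N b)).
suff G0 : forall h, dual k h - pr h k - (tau (op N b h) - op N b (tau h)) = 0.
  by have := G0 h => /eqP; rewrite !subr_eq add0r => /eqP ->; rewrite addrC.
apply: (adj_eq0 adjG) => j {h}; set h := xA R ^+ j.
have ph : pr u h = 0 by exact: pr_exp.
have th : tau h = 0 by exact: tau_exp.
have o0 r' : op N r' 0 = 0 := additive0 (opD N r').
have pB : pr u (op N b h) = op N r h - 2%:R * op N b h.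
  by rewrite pru_op ph o0 add0r.
have pk : pr u k = op N r K - k by rewrite -kE mul1r addrC addKr.
apply: (@radial_zero 1); have := residue h; rewrite th !o0 !subr0 => res.
rewrite !raddfB /= pru_dual pru_pr pru_tau pB pk ph pr0 dual_f0 !raddfB /= dual_subf.
rewrite !(mulr_natl _ 2) raddfMn /= !mulr2n -[RHS]oppr0 -[in RHS]res; ring.
Qed.

(** The coefficients of the derivatives of u_t in the Euler expression of
   u (B u_t - k). *)
Lemma primitive_linear w :
  dual (u * op N b w) 1 + dual w (op N b u) + pr w (op N b u) = op N r w.
Proof.
rewrite dual_mul dual_u !mulr1.
have := primitive_closed w u; rewrite /defect pru_op pr_u.
move=> /eqP; rewrite !subr_eq add0r => /eqP E.
have {}E : dual (op N b w) u = op N r w - op N b w - pr w (op N b u) - dual w (op N b u).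
  rewrite -[LHS](addrK (dual w (op N b u))) [X in X - _]addrC -E; ring.
by rewrite E; ring.
Qed.

(** The terms without u_t in the same Euler expression. *)
Lemma primitive_constant : tau (op N b u) - dual (u * k) 1 = - op N r K.
Proof.
rewrite dual_mul dual_u !mulr1 primitive_residue tau_u (additive0 (opD N b)).
by rewrite -kE; ring.
Qed.

End Primitive.

(** The coefficients of B are the integrals of s r_i(s u), and k is the integral of
   (R K)(s u), over 0 <= s <= 1. *)
Lemma primitive_ex K N r : (forall v, opT N r v = - op N r v) ->
  (forall w v, defect (op N r) w v = 0) ->
  (forall w, tau (op N r w) - op N r (tau w) + pr w (op N r K) - dual (op N r K) w = 0) ->
  exists (b : nat -> A) (k : A), [/\ forall v, opT N b v = - op N b v,
    forall w, dual (u * op N b w) 1 + dual w (op N b u) + pr w (op N b u) = op N r w &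
    tau (op N b u) - dual (u * k) 1 = - op N r K].
Proof.
move=> sk cl res; have [b bE] := choice (fun i => radial_solve 1 (r i)).
have [k kE] := radial_solve 0 (op N r K).
exists b, k; split.
- exact: (primitive_skew sk bE).
- exact: (primitive_linear sk cl bE).
- exact: (primitive_constant res bE kE).
Qed.

End Primitives.

(** * Lifting operators to the jet space of the plane *)

Section JetSpace.
Variable R : realType.
Local Notation J := (jet_coord (nat * nat)).
Local Notation A := (sfun R (jet_coord nat)).
Local Notation B := (sfun R J).
Implicit Types (f g : A) (P : B) (p : J -> R) (h : (jet_coord nat -> R) -> R).

(** The function u and its x-derivatives among the coordinates of the full jet
   space. *)
Definition emb (c : jet_coord nat) : J :=
  match c with Ct => Ct | Cx => Cx | Cu i => Cu (0%N, i) end.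

Lemma emb_inj : injective emb.
Proof. by move=> [||i] [||j] //= [->]. Qed.

Definition restr (p : J -> R) : jet_coord nat -> R := fun c => p (emb c).

Lemma pullE (h : (jet_coord nat -> R) -> R) p : pull h p = h (restr p).
Proof. by congr h; apply/funext => -[]. Qed.

Transparent upd.
Lemma restr_upd p c s : restr (upd p (emb c) s) = upd (restr p) c s.
Proof.
apply/funext => d; rewrite /restr /upd.
by rewrite (inj_eq emb_inj).
Qed.

Lemma restr_upd1 p a i s : restr (upd p (Cu (a.+1, i)) s) = restr p.
Proof. by apply/funext => -[||j]. Qed.

Opaque upd.

Lemma embP c : (exists d, c = emb d) \/ (exists a i, c = Cu (a.+1, i)).
Proof.
case: c => [||[[|a] i]]; [left; exists Ct|left; exists Cx|left; exists (Cu i)|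
  right; exists a, i] => //.
Qed.

Transparent pd.
Lemma pd_pull h c p : pd (emb c) (pull h) p = pull (pd c h) p.
Proof.
rewrite pullE /pd; congr (derive1 _ _).
by apply/funext => s; rewrite pullE restr_upd.
Qed.

Lemma pd_pull1 h a i p : pd (Cu (a.+1, i)) (pull h) p = 0.
Proof.
rewrite /pd (_ : (fun s => _) = cst (h (restr p))) ?derive1_cst//.
by apply/funext => s; rewrite pullE restr_upd1.
Qed.
Opaque pd.

Lemma smooth_pull h : smooth h -> smooth (pull h).
Proof.
move=> sh; pose Q (g : (J -> R) -> R) := exists2 h, smooth h & g = pull h.
suff QQ : forall g : (J -> R) -> R, Q g -> smooth g by apply: QQ; exists h.
apply: smooth_coind.
move=> _ [{sh}h sh ->]; split.
- have [C hC] := smooth_depends sh; exists [seq emb c | c <- C] => p q pq.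
  by rewrite !pullE; apply: hC => c cC; apply: pq; exact: map_f.
- move=> p; rewrite (_ : pull h = h \o restr); last by apply/funext => q; rewrite pullE.
  apply: (@smooth_cvg _ _ h _ (nbhs (p : {ptws J -> R})) restr (restr p)) => // c.
  exact: (@proj_continuous _ (fun=> R) (emb c)).
- move=> c p; have [[d ->]|[a [i ->]]] := embP c.
    rewrite (_ : (fun s => _) = (fun s => h (upd (restr p) d s))).
      exact: smooth_derivable.
    by apply/funext => s; rewrite pullE restr_upd.
  rewrite (_ : (fun s => _) = cst (h (restr p))); first exact: derivable_cst.
  by apply/funext => s; rewrite pullE restr_upd1.
- move=> c; have [[d ->]|[a [i ->]]] := embP c.
    by exists (pd d h); [exact: smooth_pd|apply/funext => p; rewrite pd_pull].
  exists (cst 0); first exact: smooth_cst.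
  by apply/funext => p; rewrite pd_pull1.
Qed.

Definition pullA f : B := mk_sfun (smooth_pull (sfun_smooth f)).

Lemma pullAE f p : pullA f p = f (restr p).
Proof. by rewrite -pullE. Qed.

Lemma pullA_D f g : pullA (f + g) = pullA f + pullA g.
Proof. by apply/sfunP => p; rewrite sfunD !pullAE. Qed.

Fact pullA_zmod : zmod_morphism pullA.
Proof. by move=> f g; apply/sfunP => p; rewrite sfunD sfunN !pullAE. Qed.

HB.instance Definition _ := GRing.isZmodMorphism.Build A B pullA pullA_zmod.

Lemma pullA_M f g : pullA (f * g) = pullA f * pullA g.
Proof. by apply/sfunP => p; rewrite sfunM !pullAE. Qed.

Lemma pullA1 : pullA 1 = 1.
Proof. by apply/sfunP => p; rewrite pullAE. Qed.

Lemma pullA_inj f : pullA f = 0 -> f = 0.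
Proof.
move=> H; apply/sfunP => p.
pose q : J -> R := fun c => match c with Ct => p Ct | Cx => p Cx | Cu (_, i) => p (Cu i) end.
have := congr1 (fun h : B => h q) H; rewrite pullAE.
by rewrite (_ : restr q = p)//; apply/funext => -[].
Qed.

Lemma pullA_var c : pullA (var R c) = var R (emb c).
Proof. by apply/sfunP => p; rewrite pullAE. Qed.

Lemma pdA_pull c f : pdA (emb c) (pullA f) = pullA (pdA c f).
Proof. by apply/sfunP => p; rewrite pullAE -pullE /= pd_pull. Qed.

Lemma pdA_pull1 a i f : pdA (Cu (a.+1, i)) (pullA f) = 0.
Proof. by apply/sfunP => p; rewrite /= pd_pull1. Qed.

Opaque der.

Lemma der_pull (V : J -> B) f (C : {fset jet_coord nat}) : supported C f ->
  der V (pullA f) = \sum_(c <- C) V (emb c) * pullA (pdA c f).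
Proof.
move=> fC; rewrite (@derE _ _ [fset emb c | c in C]%fset); last first.
  move=> p q pq; rewrite !pullAE; apply: fC => c cC; apply: pq.
  by apply/imfsetP; exists c.
rewrite big_imfset/=; last by move=> c d _ _; exact: emb_inj.
by apply: eq_bigr => c _; rewrite pdA_pull.
Qed.

Lemma der_pull_lift (V : J -> B) (W : jet_coord nat -> A) f :
  (forall c, V (emb c) = pullA (W c)) -> der V (pullA f) = pullA (der W f).
Proof.
move=> VW; have [C fC] := supported_ex f.
rewrite (der_pull _ fC) (derE _ fC) raddf_sum; apply: eq_bigr => c _ /=.
by rewrite pullA_M VW.
Qed.

Definition DXc (c : J) : B :=
  match c with Ct => 0 | Cx => 1 | Cu (a, i) => var R (Cu (a, i.+1)) end.
Definition DTc (c : J) : B :=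
  match c with Ct => 1 | Cx => 0 | Cu (a, i) => var R (Cu (a.+1, i)) end.
Notation DX := (der DXc).
Notation DT := (der DTc).
Local Notation NDX := (fun v : B => - DX v).
Local Notation X := (der (@Xc R)).
Local Notation NX := (fun v : A => - X v).

Transparent der.
Lemma DxE P : Dx P = DX P :> (_ -> _).
Proof.
rewrite /Dx /der /=; congr (vact _ _).
by apply/funext => p; apply/funext => -[||[a i]].
Qed.

Lemma DtE P : Dt P = DT P :> (_ -> _).
Proof.
rewrite /Dt /der /=; congr (vact _ _).
by apply/funext => p; apply/funext => -[||[a i]].
Qed.
Opaque der.

Lemma iter_DxE i P : iter i (@Dx R) P = iter i DX P :> (_ -> _).
Proof. by elim: i => //= i ->; rewrite DxE. Qed.

Lemma iter_DtE i P : iter i (@Dt R) P = iter i DT P :> (_ -> _).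
Proof. by elim: i => //= i ->; rewrite DtE. Qed.

Lemma DX_pull f : DX (pullA f) = pullA (X f).
Proof.
by apply: der_pull_lift => -[||i] /=; rewrite ?raddf0 ?pullA1 ?pullA_var.
Qed.

Lemma iter_DX_pull i f : iter i DX (pullA f) = pullA (iter i X f).
Proof. by elim: i => //= i ->; rewrite DX_pull. Qed.

Lemma iter_NDX_pull i f : iter i NDX (pullA f) = pullA (iter i NX f).
Proof. by elim: i => //= i ->; rewrite DX_pull raddfN. Qed.

Definition ut : B := var R (Cu (1%N, 0%N)).

Lemma iter_DX_ut i : iter i DX ut = var R (Cu (1%N, i)).
Proof. by elim: i => //= i ->; rewrite der_var. Qed.

Lemma DT_DX P : DT (DX P) = DX (DT P).
Proof.
apply: der_commute => -[||[a i]] /=.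
- by rewrite der1 raddf0.
- by rewrite der1 raddf0.
- by rewrite !der_var.
Qed.

(** [lifts F F']: F' has the coefficients of F, with the total derivative in place of
   X. As a bare function F' is not determined by F, so the common coefficients are
   part of the definition. *)
Definition lifts (F : A -> A) (F' : B -> B) := exists s : seq (nat * A),
  (forall v, F v = \sum_(t <- s) t.2 * iter t.1 X v) /\
  (forall v, F' v = \sum_(t <- s) pullA t.2 * iter t.1 DX v).

Lemma lifts_ext F F' G G' : lifts F F' -> F =1 G -> F' =1 G' -> lifts G G'.
Proof. by move=> FF' /funext <- /funext <-. Qed.

Lemma lifts_mul a F F' : lifts F F' ->
  lifts (fun v => a * F v) (fun v => pullA a * F' v).
Proof.
move=> [s [Fs F's]]; exists [seq (t.1, a * t.2) | t <- s]; split=> v.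
  by rewrite Fs mulr_sumr big_map; apply: eq_bigr => t _; rewrite mulrA.
by rewrite F's mulr_sumr big_map; apply: eq_bigr => t _; rewrite pullA_M mulrA.
Qed.

Lemma lifts_X F F' : lifts F F' -> lifts (fun v => X (F v)) (fun v => DX (F' v)).
Proof.
move=> [s [Fs F's]].
exists ([seq (t.1, X t.2) | t <- s] ++ [seq (t.1.+1, t.2) | t <- s]).
split=> v; rewrite big_cat !big_map /= -big_split /=.
  by rewrite Fs raddf_sum; apply: eq_bigr => t _ /=; rewrite derM.
by rewrite F's raddf_sum; apply: eq_bigr => t _ /=; rewrite derM DX_pull.
Qed.

Lemma lifts_add F F' G G' : lifts F F' -> lifts G G' ->
  lifts (fun v => F v + G v) (fun v => F' v + G' v).
Proof.
move=> [s [Fs F's]] [s' [Gs G's]]; exists (s ++ s').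
by split=> v; rewrite big_cat ?Fs ?Gs ?F's ?G's.
Qed.

Lemma lifts_opp F F' : lifts F F' -> lifts (fun v => - F v) (fun v => - F' v).
Proof.
move=> /(lifts_mul (-1)) FF'; apply: lifts_ext FF' _ _ => v; rewrite ?mulN1r//.
by rewrite raddfN /= pullA1 mulN1r.
Qed.

Lemma lifts_sub F F' G G' : lifts F F' -> lifts G G' ->
  lifts (fun v => F v - G v) (fun v => F' v - G' v).
Proof. by move=> FF' /lifts_opp; exact: lifts_add. Qed.

Lemma lifts_id : lifts id id.
Proof.
by exists [:: (0%N, 1)]; split=> v; rewrite big_seq1 /= ?pullA1 mul1r.
Qed.

Lemma lifts_0 : lifts (fun=> 0) (fun=> 0).
Proof. by exists [::]; split=> v; rewrite big_nil. Qed.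

Lemma lifts_iterX i F F' : lifts F F' ->
  lifts (fun v => iter i X (F v)) (fun v => iter i DX (F' v)).
Proof. by move=> FF'; elim: i => //= i; exact: lifts_X. Qed.

Lemma lifts_iterNX i F F' : lifts F F' ->
  lifts (fun v => iter i NX (F v)) (fun v => iter i NDX (F' v)).
Proof. by move=> FF'; elim: i => //= i; move=> /lifts_X; exact: lifts_opp. Qed.

Lemma lifts_sum (T : Type) (r : seq T) (F : T -> A -> A) (F' : T -> B -> B) :
  (forall t, lifts (F t) (F' t)) ->
  lifts (fun v => \sum_(t <- r) F t v) (fun v => \sum_(t <- r) F' t v).
Proof.
move=> FF'; elim: r => [|t r ih].
  by apply: lifts_ext lifts_0 _ _ => v; rewrite big_nil.
by apply: lifts_ext (lifts_add (FF' t) ih) _ _ => v; rewrite big_cons.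
Qed.

Lemma lifts_pull F F' f : lifts F F' -> F' (pullA f) = pullA (F f).
Proof.
move=> [s [-> ->]]; rewrite raddf_sum; apply: eq_bigr => t _ /=.
by rewrite pullA_M iter_DX_pull.
Qed.

Lemma pullA_inj2 : injective pullA.
Proof.
by move=> f g /eqP; rewrite -subr_eq0 -raddfB => /eqP/pullA_inj/eqP; rewrite subr_eq0 => /eqP.
Qed.

Lemma lifts_array F F' : lifts F F' -> exists N c,
  F =1 op N c /\ forall v, F' v = \sum_(i < N) pullA (c i) * iter i DX v.
Proof.
move=> [s [Fs F's]].
have [N sN] := seq_array s; exists N, (fun i => \sum_(t <- s | t.1 == i) t.2).
split=> v.
  by rewrite Fs (sN _ (fun i a => a * iter i X v))// => i a b; exact: mulrDl.
rewrite F's (sN _ (fun i a => pullA a * iter i DX v))// => i a b.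
by rewrite pullA_D mulrDl.
Qed.

Lemma lifts_eq0 F F' : lifts F F' -> (forall k, F (xA R ^+ k) = 0) -> forall v, F' v = 0.
Proof.
move=> /lifts_array[N [c [Fc F'c]]] F0 v; rewrite F'c big1// => i _.
by rewrite (@op_inj _ N c)// ?raddf0 ?mul0r// => k; rewrite -Fc.
Qed.

Lemma lifts_unique F F' G G' : lifts F F' -> lifts G G' ->
  (forall k, F (xA R ^+ k) = G (xA R ^+ k)) -> F' =1 G'.
Proof.
move=> FF' GG' FG v; apply/eqP; rewrite -subr_eq0; apply/eqP.
by apply: (lifts_eq0 (lifts_sub FF' GG')) => k; rewrite FG subrr.
Qed.

(** Differentiating with respect to the coordinate of D_x^i u_t isolates the i-th
   coefficient. *)
Lemma lifts_ut F F' z : lifts F F' -> F' ut = pullA z ->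
  (forall v, F v = 0) /\ z = 0.
Proof.
move=> FF'; have [N [c [Fc F'c]]] := lifts_array FF' => F'z.
have F0 v : F v = 0.
  rewrite Fc /op big1// => i _; rewrite (@pullA_inj (c i)) ?mul0r//.
  have := pdA_pull1 0 i z; rewrite -F'z F'c.
  rewrite (big_morph (pdA _) (pdA_D _) (_ : pdA _ 0 = 0)); last first.
    by have := pdA_D (Cu (1, val i)%N) (0 : B) 0; rewrite addr0 => /esym/eqP; rewrite -subr_eq0 addrK => /eqP.
  rewrite (bigD1 i)//= big1 => [|j ji].
    by rewrite addr0 pdA_M pdA_pull1 mul0r add0r iter_DX_ut pdA_var eqxx mulr1.
  rewrite pdA_M pdA_pull1 mul0r add0r iter_DX_ut pdA_var.
  rewrite (_ : _ == _ = false) ?mulr0//; apply/eqP => -[] /val_inj ij.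
  by rewrite ij eqxx in ji.
split=> //; apply: pullA_inj; rewrite -F'z.
by apply: (lifts_eq0 FF') => k.
Qed.

End JetSpace.

(** * The Euler operator and the Helmholtz conditions *)

Opaque pd smooth der upd.

Section Euler.
Variable R : realType.
Local Notation J := (jet_coord (nat * nat)).
Local Notation A := (sfun R (jet_coord nat)).
Local Notation B := (sfun R J).
Local Notation DX := (der (@DXc R)).
Local Notation DT := (der (@DTc R)).
Local Notation NDX := (fun v : B => - DX v).
Local Notation NDT := (fun v : B => - DT v).
Local Notation X := (der (@Xc R)).
Local Notation tau := (der (@tauc R)).
Local Notation pr v := (der (prc v)).
Implicit Types (f g v w : B) (h : A).

Lemma iter_DT_DX i f : iter i DT (DX f) = DX (iter i DT f).
Proof. by elim: i => //= i ->; rewrite DT_DX. Qed.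

Lemma iter_NDT_DX i f : iter i NDT (DX f) = DX (iter i NDT f).
Proof. by elim: i => //= i ->; rewrite DT_DX raddfN. Qed.

Definition adjD (k : nat * nat) f : B := iter k.2 NDX (iter k.1 NDT f).

Lemma adjDD k : {morph adjD k : f g / f + g}.
Proof.
move=> f g; rewrite /adjD; set F := iter k.1 NDT.
have -> : F (f + g) = F f + F g.
  by rewrite /F; elim: k.1 => //= i ->; rewrite raddfD opprD.
by elim: k.2 => //= i ->; rewrite raddfD opprD.
Qed.

Lemma adjD0 k : adjD k 0 = 0. Proof. exact: additive0 (adjDD k). Qed.

Lemma adjD_DX a i f : adjD (a, i) (DX f) = - adjD (a, i.+1) f.
Proof.
rewrite /adjD /= iter_NDT_DX; set w := iter a NDT f.
elim: i => [|i ih] /=; first by rewrite opprK.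
by rewrite [in LHS]ih raddfN.
Qed.

Lemma adjD_DT a i f : adjD (a, i) (DT f) = - adjD (a.+1, i) f.
Proof.
have C b : iter b NDT (DT f) = DT (iter b NDT f).
  by elim: b => //= b ->; rewrite raddfN.
rewrite /adjD /= C; move: (iter a NDT f) => w.
elim: i => [|i ih] /=; first by rewrite opprK.
by rewrite [in LHS]ih raddfN.
Qed.

Definition dA (k : nat * nat) f : B := pdA (Cu k) f.

Lemma dA0 k : dA k 0 = 0.
Proof. exact: additive0 (pdA_D (Cu k)). Qed.

Lemma dA_comm k l f : dA k (dA l f) = dA l (dA k f).
Proof. exact: pdA_comm. Qed.

(** The commutator of a coordinate derivation with a total derivative shifts the
   index. *)
Lemma dA_DX a i f :
  dA (a, i) (DX f) = DX (dA (a, i) f) + (if i is j.+1 then dA (a, j) f else 0).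
Proof.
apply/eqP; rewrite addrC -subr_eq; apply/eqP; rewrite /dA !pdA_der.
rewrite (@der_bracket _ _ _ _ (fun d => if i is j.+1 then (d == Cu (a, j))%:R else 0)).
  case: i => [|i]; last by rewrite pdA_der.
  have [C fC] := supported_ex f; rewrite (derE _ fC) big1// => c _.
  by rewrite mul0r.
have dN (n : bool) : DX n%:R = 0 by case: n; rewrite ?raddf0 ?der1.
case=> [||[b j]] /=; rewrite ?raddf0 ?der1 ?dN ?sub0r ?subr0 ?oppr0.
- by rewrite addr0; case: i.
- by rewrite addr0; case: i.
rewrite der_var; case: i => [|i].
  rewrite (_ : _ == _ = false)//; apply/eqP => -[_] //.
by congr (_ %:R); congr nat_of_bool; apply/eqP/eqP => -[-> ->].
Qed.

Lemma dA_DT a i f :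
  dA (a, i) (DT f) = DT (dA (a, i) f) + (if a is b.+1 then dA (b, i) f else 0).
Proof.
apply/eqP; rewrite addrC -subr_eq; apply/eqP; rewrite /dA !pdA_der.
rewrite (@der_bracket _ _ _ _ (fun d => if a is b.+1 then (d == Cu (b, i))%:R else 0)).
  case: a => [|a]; last by rewrite pdA_der.
  have [C fC] := supported_ex f; rewrite (derE _ fC) big1// => c _.
  by rewrite mul0r.
have dN (n : bool) : DT n%:R = 0 by case: n; rewrite ?raddf0 ?der1.
case=> [||[b j]] /=; rewrite ?raddf0 ?der1 ?dN ?sub0r ?subr0 ?oppr0.
- by rewrite addr0; case: a.
- by rewrite addr0; case: a.
rewrite der_var; case: a => [|a].
  rewrite (_ : _ == _ = false)//; apply/eqP => -[] //.
by congr (_ %:R); congr nat_of_bool; apply/eqP/eqP => -[-> ->].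
Qed.

Definition j_order N f := forall a i, (N <= a)%N || (N <= i)%N -> dA (a, i) f = 0.

Lemma j_order_ex f : exists N, j_order N f.
Proof.
have [C fC] := supported_ex f.
pose h (c : J) := if c is Cu (a, i) then (a + i).+1 else 0%N.
exists (\max_(c <- C) h c) => a i aN.
apply: (pdA_supported fC); apply/negP => lC.
have := @leq_bigmax_seq _ _ predT h _ lC isT.
by rewrite /= => H; move: aN H; case: (\max_(c <- C) h c) => [|n]; lia.
Qed.

Lemma j_orderW N M f : (N <= M)%N -> j_order N f -> j_order M f.
Proof.
by move=> NM fN a i /orP[] Ma; apply: fN; rewrite (leq_trans NM Ma) ?orbT.
Qed.

Lemma j_order2 f g : exists N, j_order N f /\ j_order N g.
Proof.
have [N fN] := j_order_ex f; have [M gM] := j_order_ex g.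
exists (N + M)%N; split; first exact: j_orderW (leq_addr _ _) fN.
exact: j_orderW (leq_addl _ _) gM.
Qed.

Definition dualJn N f v : B :=
  \sum_(a < N) \sum_(i < N) adjD (val a, val i) (dA (val a, val i) f * v).

(** The summation bound is immaterial once it exceeds the order of f. *)
Lemma dualJnW N M f v : (N <= M)%N -> j_order N f -> dualJn M f v = dualJn N f v.
Proof.
move=> NM fN; rewrite /dualJn.
rewrite [RHS](big_ord_widen M
  (fun a => \sum_(i < N) adjD (a, val i) (dA (a, val i) f * v)) NM).
rewrite [RHS]big_mkcond; apply: eq_bigr => a _ /=; case: ltnP => aN; last first.
  by rewrite big1// => i _; rewrite fN ?aN// mul0r adjD0.
rewrite [RHS](big_ord_widen M
  (fun i => adjD (val a, i) (dA (val a, i) f * v)) NM).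
rewrite [RHS]big_mkcond; apply: eq_bigr => i _ /=; case: ltnP => // iN.
by rewrite fN ?iN ?orbT// mul0r adjD0.
Qed.

(** The adjoint of the linearization of f. *)
Definition dualJ f v := dualJn (sval (cid (j_order_ex f))) f v.

Lemma dualJE N f v : j_order N f -> dualJ f v = dualJn N f v.
Proof.
move=> fN; rewrite /dualJ; case: cid => M /= fM.
rewrite -(@dualJnW M (M + N)) ?leq_addr// -[RHS](@dualJnW N (M + N)) ?leq_addl//.
Qed.

Lemma dualJ_Dl f g v : dualJ (f + g) v = dualJ f v + dualJ g v.
Proof.
have [N [fN gN]] := j_order2 f g.
rewrite (dualJE v fN) (dualJE v gN) (@dualJE N); last first.
  by move=> a i ai; rewrite /dA pdA_D [pdA _ f](fN a i ai) [pdA _ g](gN a i ai) addr0.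
rewrite /dualJn -big_split; apply: eq_bigr => a _ /=.
rewrite -big_split; apply: eq_bigr => i _ /=.
by rewrite -adjDD -mulrDl /dA pdA_D.
Qed.

Lemma dualJ_Dr f v w : dualJ f (v + w) = dualJ f v + dualJ f w.
Proof.
rewrite /dualJ /dualJn -big_split; apply: eq_bigr => a _ /=.
rewrite -big_split; apply: eq_bigr => i _ /=.
by rewrite -adjDD -mulrDr.
Qed.

Lemma dualJ_Nl f v : dualJ (- f) v = - dualJ f v.
Proof. exact: (@additiveN _ _ (dualJ^~ v) f (fun f g => dualJ_Dl f g v)). Qed.
Lemma dualJ_Nr f v : dualJ f (- v) = - dualJ f v.
Proof. exact: additiveN (dualJ_Dr f). Qed.
Lemma dualJ_Bl f g v : dualJ (f - g) v = dualJ f v - dualJ g v.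
Proof. by rewrite dualJ_Dl dualJ_Nl. Qed.
Lemma dualJ_suml (T : Type) (r : seq T) (F : T -> B) v :
  dualJ (\sum_(t <- r) F t) v = \sum_(t <- r) dualJ (F t) v.
Proof. exact: (@additive_sum _ _ _ r F (dualJ^~ v) (fun f g => dualJ_Dl f g v)). Qed.

Lemma dualJ_M f g v : dualJ (f * g) v = dualJ f (g * v) + dualJ g (f * v).
Proof.
have [N [fN gN]] := j_order2 f g.
rewrite (dualJE _ fN) (dualJE _ gN) (@dualJE N); last first.
  move=> a i ai; rewrite /dA pdA_M [pdA _ f](fN a i ai) [pdA _ g](gN a i ai).
  by rewrite mul0r mulr0 addr0.
rewrite /dualJn -big_split; apply: eq_bigr => a _ /=.
rewrite -big_split; apply: eq_bigr => i _ /=.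
rewrite -adjDD; congr adjD; rewrite /dA pdA_M.
by move: (pdA _ f) (pdA _ g) => f' g'; ring.
Qed.

Let telescope N (F : nat -> B) : F N = 0 ->
  \sum_(i < N.+1) (- F i + (if val i is j.+1 then F j else 0)) = 0.
Proof.
move=> FN; rewrite big_split /= [X in _ + X]big_ord_recl /= add0r.
rewrite big_ord_recr /= FN oppr0 addr0 -big_split big1//= => i _.
by rewrite addNr.
Qed.

(** The shift of indices telescopes against the total derivative. *)
Lemma dualJ_DX f v : dualJ (DX f) v = - dualJ f (DX v).
Proof.
have [N fN] := j_order_ex f.
rewrite (dualJE _ (j_orderW (leqnSn N) fN)) (@dualJE N.+1); last first.
  move=> a [|i] ai; rewrite dA_DX fN ?raddf0 ?add0r//.
  - by move: ai; rewrite orbF; move/ltnW=> ->.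
  - by rewrite fN//; move: ai => /orP[/ltnW ->|]//; rewrite ltnS => ->; rewrite orbT.
  - by move: ai => /orP[] /ltnW ->; rewrite ?orbT.
apply/eqP; rewrite -subr_eq0 opprK -big_split; apply/eqP; apply: big1 => a _ /=.
rewrite -big_split /= -[RHS](@telescope N (fun i => adjD (val a, i.+1) (dA (val a, i) f * v))).
  apply: eq_bigr => i _; rewrite -adjD_DX derM dA_DX /=.
  case: (nat_of_ord i) => [|j] /=.
    by rewrite -adjDD !addr0.
  by rewrite -!adjDD; congr adjD; rewrite mulrDl addrAC.
by rewrite fN ?leqnn ?orbT// mul0r adjD0.
Qed.

Lemma dualJ_DT f v : dualJ (DT f) v = - dualJ f (DT v).
Proof.
have [N fN] := j_order_ex f.
rewrite (dualJE _ (j_orderW (leqnSn N) fN)) (@dualJE N.+1); last first.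
  move=> [|a] i ai; rewrite dA_DT fN ?raddf0 ?add0r//.
  - by move: ai => /orP[|/ltnW ->]//; rewrite orbT.
  - by rewrite fN//; move: ai => /orP[|/ltnW ->]; rewrite ?orbT// ltnS => ->.
  - by move: ai => /orP[] /ltnW ->; rewrite ?orbT.
apply/eqP; rewrite -subr_eq0 opprK /dualJn exchange_big /=.
rewrite [X in _ + X]exchange_big -big_split; apply/eqP; apply: big1 => i _ /=.
rewrite -big_split /= -[RHS](@telescope N (fun a => adjD (a.+1, val i) (dA (a, val i) f * v))).
  apply: eq_bigr => a _; rewrite -adjD_DT derM dA_DT /=.
  case: (nat_of_ord a) => [|b] /=.
    by rewrite -adjDD !addr0.
  by rewrite -!adjDD; congr adjD; rewrite mulrDl addrAC.
by rewrite fN ?leqnn// mul0r adjD0.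
Qed.

Lemma dualJ_var00 v : dualJ (var R (Cu (0, 0)%N)) v = v.
Proof.
rewrite (@dualJE 1); last first.
  move=> a i ai; rewrite /dA pdA_var; case: eqP => // -[ea ei]; move: ai.
  by rewrite -?ea -?ei ?ea ?ei.
by rewrite /dualJn !big_ord1 /adjD /= /dA pdA_var eqxx mul1r.
Qed.

Lemma dualJ_iterDX i f v : dualJ (iter i DX f) v = dualJ f (iter i NDX v).
Proof.
elim: i v => //= i ih v; rewrite dualJ_DX ih -dualJ_Nr; congr dualJ.
rewrite -(additiveN _ _); first by rewrite -iterSr.
by elim: (i) => // j ihj a b; rewrite !iterS ihj raddfD opprD.
Qed.

Lemma dualJ_opH k f v : dualJ (adjD k f) v = dualJ f (iter k.1 DT (iter k.2 DX v)).
Proof.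
rewrite /adjD; elim: k.2 v => [|i ih] v /=.
  elim: k.1 v => [|a ih] v //=; rewrite dualJ_Nl dualJ_DT ih opprK.
  by congr dualJ; rewrite -iterSr.
by rewrite dualJ_Nl dualJ_DX opprK ih -iterSr.
Qed.

Definition prJc v (c : J) : B := if c is Cu (a, i) then iter a DT (iter i DX v) else 0.
Notation prJ v := (der (prJc v)).

Lemma prJ_DX v f : prJ v (DX f) = DX (prJ v f).
Proof.
apply: der_commute => -[||[a i]] /=.
- by rewrite !raddf0.
- by rewrite der1 raddf0.
- by rewrite der_var /= iter_DT_DX.
Qed.

Lemma prJ_DT v f : prJ v (DT f) = DT (prJ v f).
Proof.
apply: der_commute => -[||[a i]] /=.
- by rewrite der1 raddf0.
- by rewrite !raddf0.
- by rewrite der_var.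
Qed.

Lemma prJ_opH k v f : prJ v (adjD k f) = adjD k (prJ v f).
Proof.
rewrite /adjD; elim: k.2 => [|i ih] /=; last by rewrite raddfN /= prJ_DX ih.
by elim: k.1 => [|a ih] //=; rewrite raddfN /= prJ_DT ih.
Qed.

Lemma prJE N v f : j_order N f -> prJ v f =
  \sum_(a < N) \sum_(i < N) dA (val a, val i) f * iter a DT (iter i DX v).
Proof.
move=> fN; have [C fC] := supported_ex f.
pose Q (k : 'I_N * 'I_N) : J := Cu (val k.1, val k.2).
pose D := [fset Q k | k in {: 'I_N * 'I_N}]%fset.
have fCD : supported (C `|` D)%fset f by apply: supportedS fC; exact: fsubsetUl.
have QI : injective Q.
  by move=> [a i] [b j] [] /val_inj /= -> /val_inj /= ->.
rewrite (derE _ fCD) pair_bigA /= (bigID (fun c => c \in D)) /= addrC big1_seq.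
  rewrite add0r -big_filter (perm_big [seq Q k | k <- enum {: 'I_N * 'I_N}]).
    by rewrite big_map big_enum /=; apply: eq_bigr => k _; rewrite mulrC.
  apply: uniq_perm; first by rewrite filter_uniq ?fset_uniq.
    by rewrite map_inj_uniq ?enum_uniq.
  move=> c; rewrite mem_filter; apply/andP/mapP.
    by move=> [/imfsetP[/= k _ ->] _]; exists k => //; rewrite mem_enum.
  move=> [k _ ->]; have kD : Q k \in D by apply/imfsetP; exists k.
  by split=> //; rewrite in_fsetU kD orbT.
move=> c /andP[cN cC]; case: c cN cC => [||[a i]] /= cN _; rewrite ?mul0r//.
rewrite [pdA _ f](fN a i) ?mulr0//.
case: (ltnP a N) => //= aN; case: (ltnP i N) => //= iN; case/imfsetP: cN.
by exists (Ordinal aN, Ordinal iN).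
Qed.

Definition EL f := dualJ f 1.

(** Both sides are sums over pairs of indices of the same second derivatives of the
   Lagrangian, taken in opposite order. *)
Lemma helmholtz f v : dualJ (EL f) v = prJ v (EL f).
Proof.
have [N fN] := j_order_ex f; rewrite /EL (dualJE _ fN).
have fN' k : j_order N (dA k f) by move=> a i ai; rewrite dA_comm fN ?dA0.
rewrite /dualJn !dualJ_suml raddf_sum /=.
under eq_bigr => a _.
  rewrite dualJ_suml; under eq_bigr => i _ do rewrite dualJ_opH mulr1 (dualJE _ (fN' _)).
  over.
under [RHS]eq_bigr => a _.
  rewrite raddf_sum /=; under eq_bigr => i _.
    rewrite prJ_opH mulr1 (prJE _ (fN' _)).
    rewrite (additive_sum _ _ (adjDD _)).
    under eq_bigr => b _ do rewrite (additive_sum _ _ (adjDD _)).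
    over.
  over.
rewrite pair_bigA [RHS]pair_bigA /=.
under eq_bigr => k _ do rewrite /dualJn pair_bigA /=.
under [RHS]eq_bigr => k _ do rewrite pair_bigA /=.
rewrite exchange_big; apply: eq_bigr => k _; apply: eq_bigr => l _.
by rewrite dA_comm.
Qed.

Lemma lifts_pr h : lifts (fun w : A => pr w h) (fun w => prJ w (pullA h)).
Proof.
have [C hC] := supported_ex h.
pose F (c : jet_coord nat) (w : A) : A := prc w c * pdA c h.
pose F' (c : jet_coord nat) (w : B) : B := prJc w (emb c) * pullA (pdA c h).
apply: (lifts_ext (lifts_sum (enum_fset C) (F := F) (F' := F') _)) => [c|w|w]; last 2 first.
- by rewrite (derE _ hC).
- by rewrite (der_pull _ hC).
case: c => [||i].
- by apply: (lifts_ext (lifts_0 R)) => w; rewrite /F/F' mul0r.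
- by apply: (lifts_ext (lifts_0 R)) => w; rewrite /F/F' mul0r.
- apply: (lifts_ext (lifts_mul (pdA (Cu i) h) (lifts_iterX i (lifts_id R)))) => w.
    by rewrite /F mulrC.
  by rewrite /F' mulrC.
Qed.

Lemma dualJ_pull N h v : u_order N h ->
  dualJ (pullA h) v = \sum_(l < N) iter l NDX (pullA (pa l h) * v).
Proof.
move=> hN; rewrite (@dualJE N.+1); last first.
  move=> [|a] i ai; last exact: pdA_pull1.
  rewrite /dA -[Cu _]/(emb (Cu i)) pdA_pull [pdA _ _]hN ?raddf0//.
  by move: ai => /orP[//|/ltnW].
rewrite /dualJn big_ord_recl /= [X in _ + X]big1 => [|a _]; last first.
  by apply: big1 => i _; rewrite /dA pdA_pull1 mul0r adjD0.
rewrite addr0 big_ord_recr /= /dA -[Cu (0, N)%N]/(emb (Cu N)) pdA_pull [pdA _ h]hN//.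
rewrite raddf0 mul0r adjD0 addr0; apply: eq_bigr => i _.
by rewrite -[Cu (0, val i)%N]/(emb (Cu (val i))) pdA_pull.
Qed.

Lemma lifts_dual h : lifts (dual h) (dualJ (pullA h)).
Proof.
have [N hN] := u_order_ex h.
apply: lifts_ext (lifts_sum (index_enum 'I_N) (fun l : 'I_N =>
  lifts_iterNX l (lifts_mul (pa l h) (lifts_id R)))) _ _ => w.
  by rewrite (dualE _ hN).
by rewrite (dualJ_pull _ hN).
Qed.

(** The time derivative of a function of (t, x, u, u_1, ...) is affine in the
   derivatives of u_t. *)
Lemma DT_pull h : DT (pullA h) = pullA (tau h) + prJ (ut R) (pullA h).
Proof.
have [C hC] := supported_ex h.
rewrite !(der_pull _ hC) (derE _ hC) raddf_sum -big_split; apply: eq_bigr => c _ /=.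
rewrite pullA_M -mulrDl; congr (_ * _); case: c => [||i] /=.
- by rewrite pullA1 addr0.
- by rewrite raddf0 addr0.
- by rewrite raddf0 add0r iter_DX_ut.
Qed.

End Euler.

(** * Variational operators and the symmetry condition *)

Section Lagrangian.
Variable R : realType.
Local Notation J := (jet_coord (nat * nat)).
Local Notation A := (sfun R (jet_coord nat)).
Local Notation B := (sfun R J).
Local Notation DX := (der (@DXc R)).
Local Notation DT := (der (@DTc R)).
Local Notation NDX := (fun v : B => - DX v).
Local Notation X := (der (@Xc R)).
Local Notation NX := (fun v : A => - X v).
Local Notation tau := (der (@tauc R)).
Local Notation pr v := (der (prc v)).
Local Notation prJ v := (der (prJc v)).
Local Notation u := (uA R).
Local Notation ut := (ut R).
Implicit Types (f g v : B) (h w z K : A) (r : nat -> A).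

Definition opJ N r v : B := \sum_(i < N) pullA (r i) * iter i DX v.
Definition opTJ N r v : B := \sum_(i < N) iter i NDX (pullA (r i) * v).

Lemma lifts_op N r : lifts (op N r) (opJ N r).
Proof.
exact: (lifts_sum (index_enum 'I_N) (fun i : 'I_N =>
  lifts_mul (r i) (lifts_iterX i (lifts_id R)))).
Qed.

Lemma lifts_opT N r : lifts (opT N r) (opTJ N r).
Proof.
exact: (lifts_sum (index_enum 'I_N) (fun i : 'I_N =>
  lifts_iterNX i (lifts_mul (r i) (lifts_id R)))).
Qed.

Lemma lifts_D (F : A -> A) (F' : B -> B) : lifts F F' -> {morph F' : v v' / v + v'}.
Proof.
move=> [s [_ F's]] v v'; rewrite !F's -big_split; apply: eq_bigr => t _ /=.
rewrite -mulrDr; congr (_ * _).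
by elim: t.1 => //= i ->; rewrite raddfD.
Qed.

Lemma lifts_N (F : A -> A) (F' : B -> B) v : lifts F F' -> F' (- v) = - F' v.
Proof. by move=> /lifts_D; exact: additiveN. Qed.

Lemma lifts_comp (F G : A -> A) (F' G' : B -> B) : lifts F F' -> lifts G G' ->
  lifts (fun w => F (G w)) (fun v => F' (G' v)).
Proof.
move=> [s [Fs F's]] GG'.
apply: lifts_ext (lifts_sum s (fun t => lifts_mul t.2 (lifts_iterX t.1 GG'))) _ _.
  by move=> w; rewrite Fs.
by move=> v; rewrite F's.
Qed.

(** The term u B u_t contributes through its dependence on u and through its
   dependence on u_t; the latter is integrated by parts in t and uses that B is
   skew-adjoint. *)
Lemma lagrangian K N r b k : (forall w, opT N b w = - op N b w) ->
  (forall w, dual (u * op N b w) 1 + dual w (op N b u) + pr w (op N b u) = op N r w) ->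
  tau (op N b u) - dual (u * k) 1 = - op N r K ->
  EL (pullA u * (opJ N b ut - pullA k)) = opJ N r (ut - pullA K).
Proof.
move=> bsk blin bcst.
have LE : pullA u * (opJ N b ut - pullA k) =
    \sum_(i < N) pullA (u * b i) * iter i DX ut - pullA (u * k).
  rewrite mulrBr mulr_sumr pullA_M; congr (_ - _); apply: eq_bigr => i _.
  by rewrite pullA_M mulrA.
have utE : ut = DT (var R (Cu (0, 0)%N)) by rewrite der_var.
have AJut v : dualJ ut v = - DT v.
  by rewrite utE dualJ_DT dualJ_var00.
pose F w := \sum_(i < N) dual (u * b i) (iter i X w).
pose F' v := \sum_(i < N) dualJ (pullA (u * b i)) (iter i DX v).
have FF' : lifts F F'.
  apply: (lifts_sum (index_enum 'I_N)) => i.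
  exact: lifts_comp (lifts_dual (u * b i)) (lifts_iterX i (lifts_id R)).
have FE w : F w = dual (u * op N b w) 1 + dual w (op N b u).
  have -> : u * op N b w = \sum_(i < N) (u * b i) * iter i X w.
    by rewrite /op mulr_sumr; apply: eq_bigr => i _; rewrite mulrA.
  rewrite dual_sumf; under eq_bigr do rewrite dual_mul mulr1 dual_iterX mulr1.
  rewrite big_split /= -[LHS]addr0 -addrA; congr (_ + _).
  rewrite -[op N b u]opprK -bsk dualN /opT.
  rewrite -(additive_sum _ _ (dualD w)).
  under [in X in _ - X]eq_bigr => i _ do rewrite mulrC.
  by rewrite subrr.
rewrite /EL LE dualJ_Bl dualJ_suml.
under eq_bigr => i _.
  rewrite dualJ_M mulr1 dualJ_iterDX mulr1 iter_NDX_pull AJut; over.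
rewrite big_split /= sumrN -[\sum_(i < N) dualJ _ _]/(F' ut).
have -> : \sum_(i < N) DT (pullA (iter i NX (u * b i))) = DT (pullA (opT N b u)).
  rewrite -raddf_sum -raddf_sum /opT; congr (DT (pullA _)).
  by apply: eq_bigr => i _; rewrite mulrC.
have -> : dualJ (pullA (u * k)) 1 = pullA (dual (u * k) 1).
  by rewrite -(lifts_pull _ (lifts_dual _)) pullA1.
have -> : DT (pullA (opT N b u)) = - (pullA (tau (op N b u)) + prJ ut (pullA (op N b u))).
  by rewrite bsk raddfN /= raddfN /= DT_pull.
have E : opJ N r ut = F' ut + prJ ut (pullA (op N b u)).
  apply: (lifts_unique (lifts_op N r) (lifts_add FF' (lifts_pr (op N b u)))) => j.
  by rewrite FE blin.
have -> : opJ N r (ut - pullA K) = opJ N r ut - pullA (op N r K).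
  rewrite (lifts_D (lifts_op N r)) (lifts_N _ (lifts_op N r)).
  by rewrite (lifts_pull _ (lifts_op N r)).
have -> : pullA (op N r K) = pullA (dual (u * k) 1) - pullA (tau (op N b u)).
  by rewrite -[op N r K]opprK -bcst opprB raddfB.
rewrite E.
move: (F' ut) => x1; ring.
Qed.

Definition tJ : B := var R Ct.

Lemma iter_DX_t i v : iter i DX (tJ * v) = tJ * iter i DX v.
Proof.
elim: i => //= i ->; rewrite derM.
by rewrite (_ : DX tJ = 0) ?mul0r ?add0r//; exact: der_var.
Qed.

Lemma lifts_t (F : A -> A) (F' : B -> B) v : lifts F F' -> F' (tJ * v) = tJ * F' v.
Proof.
move=> [s [_ F's]]; rewrite !F's mulr_sumr; apply: eq_bigr => t _.
by rewrite iter_DX_t mulrCA.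
Qed.

(** The Helmholtz condition for P = R (u_t - K), sorted so that the terms in which v is
   differentiated in t stand on the left. *)
Lemma helmholtz_evolution K N r L : EL L = opJ N r (ut - pullA K) -> forall v,
  - DT (opTJ N r v) - opJ N r (DT v) =
    \sum_(i < N) prJ v (pullA (r i)) * iter i DX ut - prJ v (pullA (op N r K))
    - \sum_(i < N) dualJ (pullA (r i)) (iter i DX ut * v) + dualJ (pullA (op N r K)) v.
Proof.
move=> EL_L v; have := helmholtz L v; rewrite EL_L.
have -> : opJ N r (ut - pullA K) = opJ N r ut - pullA (op N r K).
  rewrite (lifts_D (lifts_op N r)) (lifts_N _ (lifts_op N r)).
  by rewrite (lifts_pull _ (lifts_op N r)).
have utE : ut = DT (var R (Cu (0, 0)%N)) by rewrite der_var.
have AJut v' : dualJ ut v' = - DT v'.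
  by rewrite utE dualJ_DT dualJ_var00.
have iterprJ i : prJ v (iter i DX ut) = iter i DX (DT v).
  elim: i => [|i ih] /=; last by rewrite prJ_DX ih.
  by rewrite utE prJ_DT der_var.
have -> : dualJ (opJ N r ut - pullA (op N r K)) v =
    \sum_(i < N) dualJ (pullA (r i)) (iter i DX ut * v) - DT (opTJ N r v)
    - dualJ (pullA (op N r K)) v.
  rewrite dualJ_Bl dualJ_suml; congr (_ - _).
  under eq_bigr => i _ do rewrite dualJ_M dualJ_iterDX AJut.
  by rewrite big_split /= sumrN -raddf_sum.
have -> : prJ v (opJ N r ut - pullA (op N r K)) =
    \sum_(i < N) prJ v (pullA (r i)) * iter i DX ut + opJ N r (DT v)
    - prJ v (pullA (op N r K)).
  rewrite raddfB /= raddf_sum /=; congr (_ - _).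
  under eq_bigr => i _ do rewrite derM iterprJ.
  by rewrite big_split.
move: (dualJ _ v) (DT (opTJ _ _ _)) (\sum_(i < N) dualJ _ _) => x1 x2 x3.
move: (\sum_(i < N) _) (opJ _ _ _) => x4 x5.
move=> E; apply/eqP; rewrite -subr_eq0; move/eqP: E; rewrite -subr_eq0 => /eqP E.
by rewrite -[X in _ == X]E; apply/eqP; ring.
Qed.

(** Replace v by t v: only the terms on the left of the previous identity
   differentiate t. *)
Lemma variational_skewJ K N r L : EL L = opJ N r (ut - pullA K) ->
  forall v, opTJ N r v = - opJ N r v.
Proof.
move=> EL_L v; have H := helmholtz_evolution EL_L.
have := H (tJ * v).
have DTt : DT tJ = 1 by exact: der_var.
rewrite (lifts_t _ (lifts_opT N r)) (lifts_t _ (lifts_pr _)).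
rewrite (lifts_t _ (lifts_dual (op N r K))) !derM DTt !mul1r.
rewrite (lifts_D (lifts_op N r)) (lifts_t _ (lifts_op N r)).
under eq_bigr => i _ do rewrite (lifts_t _ (lifts_pr (r i))) -mulrA.
under [X in _ - X + _]eq_bigr => i _ do
  rewrite mulrCA (lifts_t _ (lifts_dual (r i))).
rewrite -!mulr_sumr.
have := H v.
move: (DT (opTJ N r v)) (opJ N r (DT v)) => x1 x2.
move: (\sum_(i < N) _) (\sum_(i < N) _) (dualJ _ _) (prJ v _) => x3 x4 x5 x6.
move: (opTJ N r v) (opJ N r v) tJ => x7 x8 t E E'.
apply/eqP; rewrite -addr_eq0 -oppr_eq0; apply/eqP.
have -> : - (x7 + x8) = - (x7 + t * x1) - (x8 + t * x2) - t * (- x1 - x2) by ring.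
by rewrite E E'; ring.
Qed.

Lemma opTJ_pull N r w : opTJ N r (pullA w) = pullA (opT N r w).
Proof. exact: lifts_pull (lifts_opT N r). Qed.

Lemma opJ_pull N r w : opJ N r (pullA w) = pullA (op N r w).
Proof. exact: lifts_pull (lifts_op N r). Qed.

Lemma skewJ_skew N r : (forall v, opTJ N r v = - opJ N r v) ->
  forall w, opT N r w = - op N r w.
Proof.
by move=> sk w; apply: pullA_inj2; rewrite raddfN /= -opTJ_pull -opJ_pull sk.
Qed.

Lemma skew_skewJ N r : (forall w, opT N r w = - op N r w) ->
  forall v, opTJ N r v = - opJ N r v.
Proof.
move=> sk; apply: (lifts_unique (lifts_opT N r) (lifts_opp (lifts_op N r))) => k.
exact: sk.
Qed.

(** At v = w(t, x, u, u_1, ...) the condition is a linear equation in the derivatives of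
   u_t; all its coefficients vanish. *)
Lemma variational_closed K N r L : EL L = opJ N r (ut - pullA K) -> forall w,
  (forall w', defect (op N r) w' w = 0) /\
  tau (op N r w) - op N r (tau w) + pr w (op N r K) - dual (op N r K) w = 0.
Proof.
move=> EL_L w; have skJ := variational_skewJ EL_L; have sk := skewJ_skew skJ.
have := helmholtz_evolution EL_L (pullA w).
rewrite skJ raddfN opprK /=.
have -> : DT (opJ N r (pullA w)) - opJ N r (DT (pullA w)) =
    pullA (op N (fun i => tau (r i)) w) +
    \sum_(i < N) prJ ut (pullA (r i)) * pullA (iter i X w).
  rewrite /opJ /op !raddf_sum -!big_split; apply: eq_bigr => i _ /=.
  rewrite derM DT_pull pullA_M.
  have -> : DT (iter i DX (pullA w)) = iter i DX (DT (pullA w)).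
    by elim: (nat_of_ord i) => //= j <-; rewrite DT_DX.
  by rewrite addrK iter_DX_pull mulrDl.
have -> : prJ (pullA w) (pullA (op N r K)) = pullA (pr w (op N r K)).
  exact: lifts_pull (lifts_pr _).
have -> : dualJ (pullA (op N r K)) (pullA w) = pullA (dual (op N r K) w).
  exact: lifts_pull (lifts_dual _).
have -> : \sum_(i < N) prJ (pullA w) (pullA (r i)) * iter i DX ut =
    opJ N (fun i => pr w (r i)) ut.
  by apply: eq_bigr => i _; rewrite (lifts_pull _ (lifts_pr _)).
move=> E.
pose F w' := op N (fun i => pr w (r i)) w' - op N (fun i => pr w' (r i)) w
    - \sum_(i < N) dual (r i) (iter i X w' * w).
pose F' v := opJ N (fun i => pr w (r i)) v
    - \sum_(i < N) prJ v (pullA (r i)) * pullA (iter i X w)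
    - \sum_(i < N) dualJ (pullA (r i)) (iter i DX v * pullA w).
have FF' : lifts F F'.
  apply: lifts_sub; first apply: lifts_sub; first exact: lifts_op.
    apply: lifts_ext (lifts_sum (index_enum 'I_N) (fun i : 'I_N =>
      lifts_mul (iter i X w) (lifts_pr (r i)))) _ _ => w' /=.
      by apply: eq_bigr => i _; rewrite mulrC.
    by apply: eq_bigr => i _; rewrite mulrC.
  apply: lifts_ext (lifts_sum (index_enum 'I_N) (fun i : 'I_N =>
    lifts_comp (lifts_dual (r i)) (lifts_mul w (lifts_iterX i (lifts_id R))))) _ _ => w' /=.
    by apply: eq_bigr => i _; rewrite mulrC.
  by apply: eq_bigr => i _; rewrite mulrC.
pose z := op N (fun i => tau (r i)) w + pr w (op N r K) - dual (op N r K) w.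
have F'z : F' ut = pullA z.
  rewrite /F' /z raddfB raddfD /=; move: E; rewrite -/(op N (fun i => tau (r i)) w).
  move: (pullA _) (\sum_(i < N) _) (opJ _ _ _) (pullA _) (pullA _) (\sum_(i < N) _).
  move=> x1 x2 x3 x4 x5 x6 E.
  have -> : x6 = x3 - x4 - x2 + x1 - x5 by rewrite -E; ring.
  ring.
have [F0 z0] := lifts_ut FF' F'z.
split=> [w'|]; first by rewrite (defectE _ _ sk); exact: F0.
by rewrite (der_op _ _ _ (@tau_X R)) addrK; exact: z0.
Qed.

End Lagrangian.

Section Variational.
Variable R : realType.
Local Notation J := (jet_coord (nat * nat)).
Local Notation A := (sfun R (jet_coord nat)).
Local Notation B := (sfun R J).
Local Notation DX := (der (@DXc R)).
Local Notation DT := (der (@DTc R)).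
Local Notation NDX := (fun v : B => - DX v).
Local Notation tau := (der (@tauc R)).
Local Notation pr v := (der (prc v)).
Implicit Types (f g v : B) (h w z : A) (r : nat -> (jet_coord nat -> R) -> R).

Lemma adjDE k f p :
  adjD k f p = (-1) ^+ (k.1 + k.2) * iter k.2 (@Dx R) (iter k.1 (@Dt R) f) p.
Proof.
have signE n g : ((-1) ^+ n * g) p = (-1) ^+ n * g p.
  by rewrite -signr_odd -(signr_odd R); case: odd; rewrite ?mul1r ?expr1 ?mulN1r.
rewrite /adjD (iter_NX (derM _)) (iter_NX (derM _)) iter_DtE iter_DxE.
have -> g : iter k.2 DX ((-1) ^+ k.1 * g) = (-1) ^+ k.1 * iter k.2 DX g.
  rewrite -signr_odd; case: odd; rewrite ?mul1r// expr1 !mulN1r.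
  by elim: k.2 => //= i ->; rewrite raddfN.
by rewrite mulrA -exprD addnC signE.
Qed.

Lemma eulerE f : euler f = EL f.
Proof.
apply/funext => p; have [N fN] := j_order_ex f.
pose D := [fset (val k.1, val k.2) | k in {: 'I_N * 'I_N}]%fset.
rewrite /euler (fsbigTE D); last first.
  move=> [a i] aiD; have -> : pd (Cu (a, i)) f = 0.
    have : dA (a, i) f = 0.
      apply: fN; case: (ltnP a N) => //= aN; case: (ltnP i N) => //= iN.
      by case/imfsetP: aiD; exists (Ordinal aN, Ordinal iN).
    by move=> /(congr1 (@sfun_val R J)).
  by rewrite /Dt /Dx !iter_vact0 mulr0.
rewrite big_imfset/=; last first.
  by move=> [a i] [b j] _ _ /= [] /val_inj -> /val_inj ->.
rewrite /EL (dualJE _ fN) /dualJn pair_bigA /= sfun_sum big_enum /=; apply: eq_bigr => k _.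
by rewrite mulr1 adjDE.
Qed.

Lemma fsbig_nat N (F : nat -> R) : (forall i, (N <= i)%N -> F i = 0) ->
  \sum_(i \in [set: nat]) F i = \sum_(i < N) F i.
Proof.
move=> FN; rewrite (fsbigTE [fset i in iota 0 N]%fset); last first.
  by move=> i; rewrite in_fset mem_iota -leqNgt => /FN.
rewrite (perm_big (iota 0 N)) -?(big_mkord predT F) /index_iota ?subn0//.
apply: uniq_perm; rewrite ?fset_uniq ?iota_uniq// => i.
by rewrite in_fset.
Qed.

Section Operators.
Variables (r : nat -> (jet_coord nat -> R) -> R) (N : nat) (rA : nat -> A).
Hypothesis rE : forall i, r i = rA i.
Hypothesis rN : forall i, (N <= i)%N -> r i = 0.

Let pull_rA i : pull (r i) = pullA (rA i) :> ((J -> R) -> R).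
Proof. by rewrite rE. Qed.

Lemma opactE f : opact r f = opJ N rA f.
Proof.
apply/funext => p; rewrite /opact (@fsbig_nat N) => [|i Ni]; last first.
  by rewrite rN// [X in X * _](_ : _ = 0)// mul0r.
by rewrite sfun_sum; apply: eq_bigr => i _; rewrite pull_rA iter_DxE.
Qed.

Lemma opadjE f : opadj r f = opTJ N rA f.
Proof.
apply/funext => p; rewrite /opadj.
have E i : iter i (fun g : (J -> R) -> R => - Dx g) (pull (r i) * f) =
    iter i NDX (pullA (rA i) * f) :> ((J -> R) -> R).
  rewrite pull_rA -[X in iter i _ X]/(sfun_val (pullA (rA i) * f)).
  move: (pullA _ * f) => g; elim: i => [//|i ih]; rewrite !iterS ih DxE.
  by apply/funext.
rewrite (@fsbig_nat N) => [|i Ni]; last first.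
  rewrite E (_ : rA i = 0); last by apply/val_inj; rewrite /= -rE rN.
  rewrite raddf0 mul0r (_ : iter i NDX 0 = 0)//.
  by elim: (i) => //= j ->; rewrite !raddf0.
by rewrite sfun_sum; apply: eq_bigr => i _; rewrite E.
Qed.

Lemma skew_adjointE : skew_adjoint r <-> (forall f, opTJ N rA f = - opJ N rA f).
Proof.
split=> [H f|H f sf].
  by apply/val_inj; rewrite /= -opadjE -opactE H//; exact: sfun_smooth.
by have := opadjE (mk_sfun sf); rewrite H /= -opactE.
Qed.

Lemma is_variationalE (K : (jet_coord nat -> R) -> R) (KA : A) : K = KA ->
  is_diffop r ->
  is_variational (evolution K) r <-> exists L, EL L = opJ N rA (ut R - pullA KA).
Proof.
move=> -> dr; have evE : evolution KA = (ut R - pullA KA : B) :> ((J -> R) -> R).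
  by apply/funext.
split=> [[_ [L [sL]]]|[L EL_L]].
  by rewrite evE opactE => H; exists (mk_sfun sL); apply/val_inj; rewrite /= H -eulerE.
split=> //; exists L; split; first exact: sfun_smooth.
by rewrite eulerE EL_L evE opactE.
Qed.

End Operators.

Section Equation.
Variables (K : A) (m : nat).
Hypothesis hm : (1 <= m)%N.
Hypothesis K_order : u_order (2 * m).+2 K.
Hypothesis K_top : forall p, pd (Cu (2 * m).+1) K p != 0.

Definition symmetry N (rA : nat -> A) := forall w : A,
  tau (op N rA w) + pr K (op N rA w) + dual K (op N rA w)
    = op N rA (tau w + pr K w - pr w K).

(** For the converse the defect vanishes automatically, and a Lagrangian can be written
   down. *)
Lemma variational_symmetry N (rA : nat -> A) :
  (exists L, EL L = opJ N rA (ut R - pullA K)) <->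
  (forall f, opTJ N rA f = - opJ N rA f) /\ symmetry N rA.
Proof.
split=> [[L EL_L]|[skJ S0]].
  have skJ := variational_skewJ EL_L; split=> // w.
  have [cl res] := variational_closed EL_L w.
  have := symmetry_residue K w (opD N rA); rewrite (cl K) res addr0 => /eqP.
  by rewrite subr_eq0 => /eqP.
have sk := skewJ_skew skJ.
have cl := defect_vanishes hm K_order K_top sk S0.
have res w : tau (op N rA w) - op N rA (tau w) + pr w (op N rA K) - dual (op N rA K) w = 0.
  by rewrite -(symmetry_residue K w (opD N rA)) cl addr0 S0 subrr.
have [b [k [bsk blin bcst]]] := primitive_ex sk cl res.
by eexists; exact: lagrangian bsk blin bcst.
Qed.

End Equation.
End Variational.

(** * Exterior calculus in coordinates *)

Section FormCalculus.
Variables (R : realType) (I : choiceType).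
Local Notation point := (I -> R).
Local Notation form := (dform R I).
Implicit Types (f g : sfun R I) (W : I -> sfun R I).

Lemma fmul_D n f g (w : form n) : fmul (f + g) w = fmul f w + fmul g w.
Proof. by apply/funext => p; apply/funext => v; exact: mulrDl. Qed.

Lemma fmul_Dr n (f : point -> R) (w w' : form n) : fmul f (w + w') = fmul f w + fmul f w'.
Proof. by apply/funext => p; apply/funext => v; exact: mulrDr. Qed.

Lemma fmul_M n f g (w : form n) : fmul f (fmul g w) = fmul (f * g) w.
Proof. by apply/funext => p; apply/funext => v; exact: mulrA. Qed.

Lemma fmul0 n (w : form n) : fmul (0 : sfun R I) w = 0.
Proof. by apply/funext => p; apply/funext => v; exact: mul0r. Qed.

Lemma fmul1 n (w : form n) : fmul (1 : sfun R I) w = w.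
Proof. by apply/funext => p; apply/funext => v; exact: mul1r. Qed.

Lemma wedge_Dr n (e : form 1) (w w' : form n) : wedge1 e (w + w') = wedge1 e w + wedge1 e w'.
Proof. by have := wedge_lin e 1 w w'; rewrite !scale1r. Qed.

Lemma wedge_Nr n (e : form 1) (w : form n) : wedge1 e (- w) = - wedge1 e w.
Proof. by rewrite -scaleN1r wedgeZ scaleN1r. Qed.

Lemma wedge_linl n (a : R) (e e' : form 1) (w : form n) :
  wedge1 (a *: e + e') w = a *: wedge1 e w + wedge1 e' w.
Proof.
apply/funext => p; apply/funext => v.
transitivity (a * wedge1 e w p v + wedge1 e' w p v); last by [].
rewrite /wedge1 mulr_sumr -big_split; apply: eq_bigr => i _ /=.
rewrite (_ : (a *: e + e') p _ = a * e p (fun=> v i) + e' p (fun=> v i))//.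
by move: (e _ _) (e' _ _) (w _ _) => x y z; ring.
Qed.

Lemma wedge_Dl n (e e' : form 1) (w : form n) : wedge1 (e + e') w = wedge1 e w + wedge1 e' w.
Proof. by have := wedge_linl 1 e e' w; rewrite !scale1r. Qed.

Lemma wedge_fmull n (f : point -> R) (e : form 1) (w : form n) :
  wedge1 (fmul f e) w = fmul f (wedge1 e w).
Proof.
apply/funext => p; apply/funext => v; rewrite /fmul /wedge1 mulr_sumr.
by apply: eq_bigr => i _; move: (e _ _) (w _ _) => x y; ring.
Qed.

Lemma wedge_fmulr n (f : point -> R) (e : form 1) (w : form n) :
  wedge1 e (fmul f w) = fmul f (wedge1 e w).
Proof.
apply/funext => p; apply/funext => v; rewrite /fmul /wedge1 mulr_sumr.
by apply: eq_bigr => i _; move: (e _ _) (w _ _) => x y; ring.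
Qed.

Lemma wedge11 (e e' : form 1) p v : wedge1 e e' p v =
  e p (fun=> v ord0) * e' p (fun=> v ord_max) - e p (fun=> v ord_max) * e' p (fun=> v ord0).
Proof.
rewrite /wedge1 big_ord_recl big_ord1 /= expr0 expr1 mul1r mulN1r mulNr.
by congr (e _ _ * e' _ _ - e _ _ * e' _ _); apply/funext => k; rewrite ?ord1//;
  congr v; apply/val_inj; rewrite /= ?ord1.
Qed.

Lemma wedge_anti1 (e e' : form 1) : wedge1 e e' = - wedge1 e' e.
Proof.
apply/funext => p; apply/funext => v; rewrite (_ : (- _) p v = - wedge1 e' e p v)//.
by rewrite !wedge11; ring.
Qed.

Lemma wedge_anti2 (a b : form 1) (w : form 2) :
  wedge1 a (wedge1 b w) + wedge1 b (wedge1 a w) = 0.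
Proof.
apply/funext => p; apply/funext => v.
have w2 x : w p x = w p (fun j => if j == ord0 then x ord0 else x ord_max).
  congr (w p _); apply/funext => j; case: eqP => [->//|/eqP j0].
  by congr x; apply/val_inj; case: j j0 => -[|[|]].
rewrite (_ : (_ + _) p v = wedge1 a (wedge1 b w) p v + wedge1 b (wedge1 a w) p v)//.
rewrite /wedge1 !big_ord_recl !big_ord0 /=.
pose V k := v (inord k); pose W i j := w p (fun l => if l == ord0 then V i else V j).
have E (i : 'I_4) (k : 'I_3) : w p (fun j => v (lift i (lift k j))) =
    W (bump i (bump k 0)) (bump i (bump k 1)).
  rewrite w2 /W /V; congr (w p _); apply/funext => j.
  have inE (l : 'I_4) : v l = v (inord l) by rewrite inord_val.
  by case: ifP => _; rewrite inE.
have Ev i : v i = V (val i) by rewrite /V inord_val.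
rewrite !E !Ev /= /bump /= !(add0n, add1n).
move: (W _ _) (W _ _) (W _ _) (W _ _) (W _ _) (W _ _) => w1 w2' w3 w4 w5 w6.
rewrite [RHS](_ : _ = 0)//.
ring.
Qed.

Lemma wedge_aa (a : form 1) (w : form 2) : wedge1 a (wedge1 a w) = 0.
Proof.
have := wedge_anti2 a a w; move: (wedge1 a _) => z; rewrite -mulr2n -scaler_nat.
by move=> /eqP; rewrite scaler_eq0 pnatr_eq0 /= => /eqP.
Qed.

(** The contraction of w with the vector field H vanishes. *)
Definition kills (H : point -> point) n (w : form n) :=
  forall p v i, v i = H p -> w p v = 0.

Lemma kills_wedge (H : point -> point) n (e : form 1) (w : form n) :
  kills H e -> kills H w -> kills H (wedge1 e w).
Proof.
move=> He Hw p v k vk; apply: big1 => i _; have [->|ik] := eqVneq i k.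
  by rewrite (He p _ ord0)// mulr0 mul0r.
have [l kl|] := unliftP i k; last by move=> e'; rewrite e' eqxx in ik.
by rewrite (Hw p _ l) ?mulr0// -kl.
Qed.

Lemma kills_fmul (H : point -> point) n (f : point -> R) (w : form n) :
  kills H w -> kills H (fmul f w).
Proof. by move=> Hw p v i vi; rewrite /fmul (Hw p v i)// mulr0. Qed.

Lemma kills_D (H : point -> point) n (w w' : form n) :
  kills H w -> kills H w' -> kills H (w + w').
Proof.
move=> Hw Hw' p v i vi; rewrite (_ : (w + w') p v = w p v + w' p v)//.
by rewrite (Hw p v i)// (Hw' p v i)// addr0.
Qed.

Definition vcons n (x : point) (y : 'I_n -> point) : 'I_n.+1 -> point :=
  fun i => if unlift ord0 i is Some j then y j else x.

(** Contraction with H sees only the one-form. *)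
Lemma wedge_contract (H : point -> point) n (e : form 1) (w : form n) p y :
  kills H w -> wedge1 e w p (vcons (H p) y) = e p (fun=> H p) * w p y.
Proof.
move=> Hw; rewrite /wedge1 big_ord_recl /= big1 => [|i _].
  rewrite addr0 expr0 mul1r /vcons unlift_none; congr (_ * w _ _).
  by apply/funext => j; rewrite liftK.
case: n w y Hw i => [w y Hw []//|n w y Hw i].
have Hl : lift (lift ord0 i) (ord0 : 'I_n.+1) = ord0 by apply/val_inj.
by rewrite (Hw p _ ord0) ?mulr0// Hl /vcons unlift_none.
Qed.

Lemma vactM (V : point -> point) (f g : point -> R) p : smooth f -> smooth g ->
  vact V (fun q => f q * g q) p = vact V f p * g p + f p * vact V g p.
Proof.
move=> sf sg; have [C [fC gC]] := smooth_fset2 sf sg.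
rewrite (vactE _ fC) (vactE _ gC) (@vactE _ _ _ (fun q => f q * g q) C); last first.
  by move=> q q' qq'; rewrite (fC q q')// (gC q q').
rewrite !fct_sumE mulr_suml mulr_sumr -big_split; apply: eq_bigr => c _ /=.
rewrite (_ : pd c (fun q => f q * g q) = pd c f * g + f * pd c g); last exact: pdM.
by rewrite !fctE; move: (V p c) (pd c f p) (pd c g p) => x y z; ring.
Qed.

Lemma vact_sum (V : point -> point) (T : Type) (r : seq T) (F : T -> point -> R) :
  (forall t, smooth (F t)) -> vact V (\sum_(t <- r) F t) = \sum_(t <- r) vact V (F t).
Proof.
move=> sF; elim: r => [|t r ih]; first by rewrite !big_nil vact0.
by rewrite !big_cons -{1}[F t]scale1r vact_lin// ?scale1r ?ih//; exact: smooth_sum.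
Qed.

(** The terms in which V is differentiated along the i-th argument go to the factor
   that holds this argument. *)
Lemma lie_wedge n (V : point -> point) (e : form 1) (w : form n) :
  smooth_form e -> smooth_form w ->
  lie V (wedge1 e w) = wedge1 (lie V e) w + wedge1 e (lie V w).
Proof.
move=> se sw; apply/funext => p; apply/funext => v.
rewrite (_ : (_ + _) p v = wedge1 (lie V e) w p v + wedge1 e (lie V w) p v)//.
pose z (u : 'I_n.+1 -> point) j l := if l == j then vderiv V p (v j) else u l.
rewrite {1}/lie.
have -> : (fun q => wedge1 e w q v) = \sum_(i < n.+1)
    (-1) ^+ i *: (fun q => e q (fun=> v i) * w q (fun j => v (lift i j))).
  apply/funext => q; rewrite fct_sumE; apply: eq_bigr => i _ /=.
  by rewrite -mulrA.
have sm i : smooth (fun q => e q (fun=> v i) * w q (fun j => v (lift i j))).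
  exact: smoothM (se _) (sw _).
rewrite vact_sum => [|i]; last exact: smoothZ.
have vactZ c (f : point -> R) : smooth f -> vact V (c *: f) = c *: vact V f.
  move=> sf; have := vact_lin V c sf (@smooth0 R I).
  by rewrite !addr0 vact0 addr0.
rewrite fct_sumE.
under eq_bigr => i _ do rewrite vactZ// (_ : (_ *: vact V _) p = (-1) ^+ i * vact V (fun q => e q (fun=> v i) * w q (fun j => v (lift i j))) p)// (vactM V p (se _) (sw _)).
rewrite exchange_big -big_split /= -big_split; apply: eq_bigr => i _ /=.
rewrite (bigD1_ord i)//= eqxx.
have -> : w p (fun j => if lift i j == i then vderiv V p (v i) else v (lift i j)) =
    w p (fun j => v (lift i j)).
  by congr (w p _); apply/funext => j; rewrite eq_sym (negbTE (neq_lift _ _)).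
under eq_bigr => k _.
  rewrite (negbTE (neq_lift _ _)).
  rewrite (_ : w p _ = w p (fun l => if l == k then vderiv V p (v (lift i k)) else v (lift i l))); last first.
    by congr (w p _); apply/funext => l; rewrite (inj_eq (@lift_inj _ i)).
  over.
rewrite -mulr_sumr /lie big_ord1.
have -> : (fun l : 'I_1 => if l == ord0 then vderiv V p (v i) else v i) = (fun=> vderiv V p (v i)).
  by apply/funext => l; rewrite ord1.
move: (vact V _ p) (vact V _ p) (e p _) (e p _) (w p _) (\sum_(k < n) _) ((-1) ^+ i).
by move=> x1 x2 x3 x4 x5 x6 s; ring.
Qed.

Lemma lie_D n V (w w' : form n) : smooth_form w -> smooth_form w' ->
  lie V (w + w') = lie V w + lie V w'.
Proof. by move=> sw sw'; have := lie_lin V 1 sw sw'; rewrite !scale1r. Qed.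

Lemma lie_fmul n W f (w : form n) : smooth_form w ->
  lie (vf W) (fmul f w) = fmul (der W f) w + fmul f (lie (vf W) w).
Proof.
move=> sw; apply/funext => p; apply/funext => v.
rewrite /lie (_ : (_ + _) p v = der W f p * w p v + f p * lie (vf W) w p v)//.
rewrite /fmul vactM//; last exact: sfun_smooth.
by rewrite -mulr_sumr mulrDr addrA.
Qed.

Lemma smooth_fmul n f (w : form n) : smooth_form w -> smooth_form (fmul f w).
Proof. by move=> sw v; exact: smoothM (sfun_smooth f) (sw v). Qed.

End FormCalculus.

(** * Contact forms as differential operators *)

Section ContactForms.
Variable R : realType.
Local Notation C := (jet_coord nat).
Local Notation A := (sfun R C).
Local Notation point := (C -> R).
Local Notation form := (dform R C).
Local Notation X := (der (@Xc R)).
Local Notation tau := (der (@tauc R)).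
Local Notation pr v := (der (prc v)).
Local Notation adj := (adj X).
Variable K : A.

Transparent der.
Lemma vact_der (J : choiceType) W (f : sfun R J) : vact (vf W) f = der W f.
Proof. by []. Qed.
Opaque der.

Implicit Types (f g h : A) (phi psi : A) (p : point) (W : C -> A) (c : C).
Let XM : forall a b, X (a * b) = X a * b + a * X b := derM (@Xc R).

Definition Tc (c : C) : A := tauc R c + prc K c.
Local Notation T := (der Tc).
Local Notation theta := (theta K).
Local Notation lieX := (lie (@X_vf R)).
Local Notation lieT := (lie (T_vf K)).

Lemma TE f : T f = tau f + pr K f.
Proof. by rewrite (@der_linear _ _ _ _ Tc). Qed.

Lemma TX f : T (X f) = X (T f).
Proof. by rewrite !TE T_X. Qed.

Lemma X_vfE : @X_vf R = vf (@Xc R).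
Proof. by apply/funext => p; apply/funext => -[||i]. Qed.

Lemma iter_vactX i f : iter i (vact (@X_vf R)) f = iter i X f :> (point -> R).
Proof.
elim: i => [//|i ih]; rewrite !iterS ih X_vfE.
by rewrite vact_der.
Qed.

Lemma T_vfE : T_vf K = vf Tc.
Proof.
apply/funext => p; apply/funext => -[||i]; rewrite /vf /Tc sfunD /=.
- by rewrite addr0.
- by rewrite addr0.
- by rewrite iter_vactX add0r.
Qed.

Lemma thetaE i p (v : 'I_1 -> point) :
  theta i p v = v ord0 (Cu i) - iter i X K p * v ord0 Ct - p (Cu i.+1) * v ord0 Cx.
Proof. by rewrite /theta iter_vactX. Qed.

(** The value at p of the evolutionary vector field with characteristic phi. *)
Definition vvec phi p : point := fun c => if c is Cu i then iter i X phi p else 0.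

Lemma theta_vvec i phi p : theta i p (fun=> vvec phi p) = iter i X phi p.
Proof. by rewrite thetaE /= !mulr0 !subr0. Qed.

Lemma kills_theta_X i : kills (@X_vf R) (theta i).
Proof.
move=> p v k; rewrite thetaE ord1 => -> /=.
by rewrite mulr0 mulr1 subr0 subrr.
Qed.

Lemma kills_theta_T i : kills (T_vf K) (theta i).
Proof.
move=> p v k; rewrite thetaE ord1 => -> /=.
by rewrite mulr0 mulr1 subr0 iter_vactX subrr.
Qed.

Lemma kills_dx_T : kills (T_vf K) (@dx R).
Proof. by move=> p v k; rewrite ord1 /dx => ->. Qed.

(** The differential of f at p. *)
Definition dfun f p (v : point) : R := der (fun c => cst_sf C (v c)) f p.

Lemma vderiv_vf W p v c : vderiv (vf W) p v c = dfun (W c) p v.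
Proof. by rewrite /dfun -vact_der. Qed.

Lemma dfun_var c p v : dfun (var R c) p v = v c.
Proof. by rewrite /dfun der_var. Qed.

Lemma dfun_cst W p v c a : W c = cst_sf C a -> dfun (W c) p v = 0.
Proof. by rewrite /dfun => ->; rewrite der_cst. Qed.

Lemma lie_const W (e : form 1) c : (forall p v, e p v = v ord0 c) ->
  (exists a, W c = cst_sf C a) -> lie (vf W) e = 0.
Proof.
move=> ee [a Wa]; apply/funext => p; apply/funext => v; rewrite /lie big_ord1.
rewrite ee /= vderiv_vf (dfun_cst _ _ Wa) addr0.
rewrite (_ : (fun q => _) = cst_sf C (v ord0 c)); last by apply/funext => q; rewrite ee.
by rewrite vact_der der_cst.
Qed.

Lemma lieX_dx : lieX (@dx R) = 0.
Proof.
rewrite X_vfE; apply: (@lie_const _ _ Cx) => //; exists 1.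
by apply/sfunP.
Qed.

Lemma lieX_dt : lieX (@dt R) = 0.
Proof.
rewrite X_vfE; apply: (@lie_const _ _ Ct) => //; exists 0.
by apply/sfunP.
Qed.

Lemma lieT_dx : lieT (@dx R) = 0.
Proof.
rewrite T_vfE; apply: (@lie_const _ _ Cx) => //; exists 0.
by apply/sfunP => p; rewrite /Tc /= addr0.
Qed.

Lemma lieT_dt : lieT (@dt R) = 0.
Proof.
rewrite T_vfE; apply: (@lie_const _ _ Ct) => //; exists 1.
by apply/sfunP => p; rewrite /Tc /= addr0.
Qed.

(** The vertical differential of f. *)
Definition dV f : form 1 :=
  \sum_(l < sval (cid (u_order_ex f))) fmul (pa l f) (theta l).

Lemma form_sumE n (J : Type) (r : seq J) (F : J -> form n) p v :
  (\sum_(j <- r) F j) p v = \sum_(j <- r) F j p v.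
Proof. by elim/big_rec2: _ => // j y1 y2 _ <-. Qed.

(** The differential in the coframe dt, dx, theta^0, theta^1, ..., which is dual to T,
   X and the derivations in the coordinates u_i. *)
Lemma dfunE f p (v : point) :
  dfun f p v = v Ct * T f p + v Cx * X f p + dV f p (fun=> v).
Proof.
rewrite /dV; case: cid => N /= fN; rewrite form_sumE.
have -> : \sum_(l < N) fmul (pa l f) (theta l) p (fun=> v) =
    der (vertc (fun l => cst_sf C (theta l p (fun=> v)))) f p.
  by rewrite (der_vertc _ fN) sfun_sum.
have [D fD] := supported_ex f.
rewrite /dfun !(derE _ fD) !sfun_sum !mulr_sumr -!big_split; apply: eq_bigr => c _.
rewrite !sfunM; move: (pdA c f p) => d; rewrite /= !mulrA -!mulrDl; congr (_ * _).
case: c => [||i]; rewrite /Tc /= ?addr0 ?add0r.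
- by rewrite -[RHS]/(v Ct * 1 + v Cx * 0); ring.
- by rewrite -[RHS]/(v Ct * 0 + v Cx * 1); ring.
- by rewrite thetaE /=; ring.
Qed.

Lemma theta_slice i (v : 'I_1 -> point) : (fun q => theta i q v) =
  (cst_sf C (v ord0 (Cu i)) - iter i X K * cst_sf C (v ord0 Ct)
   - var R (Cu i.+1) * cst_sf C (v ord0 Cx) : A).
Proof. by apply/funext => q; rewrite thetaE. Qed.

Lemma lie_theta W i : W Ct = 1 \/ W Ct = 0 -> W Cx = 1 \/ W Cx = 0 ->
  forall p v, lie (vf W) (theta i) p v =
  dfun (W (Cu i)) p (v ord0) - der W (iter i X K) p * v ord0 Ct
    - W (Cu i.+1) p * v ord0 Cx.
Proof.
move=> Wt Wx p v; rewrite /lie big_ord1 theta_slice.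
rewrite (_ : vact _ _ p = der W (cst_sf C (v ord0 (Cu i)) - iter i X K * cst_sf C (v ord0 Ct)
   - var R (Cu i.+1) * cst_sf C (v ord0 Cx)) p); last first.
  by rewrite vact_der.
have -> : der W (cst_sf C (v ord0 (Cu i)) - iter i X K * cst_sf C (v ord0 Ct)
   - var R (Cu i.+1) * cst_sf C (v ord0 Cx)) =
   0 - der W (iter i X K) * cst_sf C (v ord0 Ct) - W (Cu i.+1) * cst_sf C (v ord0 Cx).
  by rewrite !raddfB /= !derM !der_cst der_var !mulr0 !addr0.
have d1 : dfun 1 p (v ord0) = 0 by rewrite /dfun der1.
have d0 : dfun 0 p (v ord0) = 0 by rewrite /dfun raddf0.
have dt0 : dfun (W Ct) p (v ord0) = 0 by case: Wt => ->.
have dx0 : dfun (W Cx) p (v ord0) = 0 by case: Wx => ->.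
rewrite thetaE eqxx !vderiv_vf dt0 dx0 !mulr0 !subr0 sub0r addrC.
by move: (der _ _) => z; rewrite sfunD !sfunN !sfunM addrA.
Qed.

Lemma lieX_theta i : lieX (theta i) = theta i.+1.
Proof.
apply/funext => p; apply/funext => v; rewrite X_vfE lie_theta; [|by right|by left].
by rewrite thetaE /= dfun_var.
Qed.

(** The Lie derivative along T turns theta^i into the vertical differential of the
   function T u_i = X^i K. *)
Lemma lieT_theta i : lieT (theta i) = dV (iter i X K).
Proof.
apply/funext => p; apply/funext => v; rewrite T_vfE lie_theta; last 2 first.
- by left; rewrite /Tc /= addr0.
- by right; rewrite /Tc /= addr0.
have -> : Tc (Cu i) = iter i X K by rewrite /Tc /= add0r.
have -> : Tc (Cu i.+1) = X (iter i X K) by rewrite /Tc /= add0r.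
rewrite dfunE (_ : (fun=> v ord0) = v); last by apply/funext => j; rewrite (ord1 j).
by move: (T _ p) (X _ p) => x1 x2; ring.
Qed.

(** [rep1 e F]: e is the sum of c_i theta^i and F the sum of c_i X^i, so that F phi is the
   contraction of e with the evolutionary field of phi. *)
Inductive rep1 : form 1 -> (A -> A) -> Prop :=
| rep1_mono f i : rep1 (fmul f (theta i)) (fun phi => f * iter i X phi)
| rep1_add e F e' F' : rep1 e F -> rep1 e' F' ->
    rep1 (e + e') (fun phi => F phi + F' phi).

(** The same correspondence between contact two-forms and alternating bidifferential
   operators. *)
Inductive rep2 : form 2 -> (A -> A -> A) -> Prop :=
| rep2_mono f i j : rep2 (fmul f (wedge1 (theta i) (theta j)))
    (fun phi psi => f * (iter i X phi * iter j X psi - iter i X psi * iter j X phi))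
| rep2_add a Z a' Z' : rep2 a Z -> rep2 a' Z' ->
    rep2 (a + a') (fun phi psi => Z phi psi + Z' phi psi).

Lemma rep1_ext e F F' : rep1 e F -> F =1 F' -> rep1 e F'.
Proof. by move=> eF /funext <-. Qed.

Lemma rep2_ext a Z Z' : rep2 a Z -> (forall phi psi, Z phi psi = Z' phi psi) -> rep2 a Z'.
Proof. by move=> aZ ZZ'; rewrite -(_ : Z = Z')//; apply/funext => phi; apply/funext. Qed.

Lemma rep1_theta i : rep1 (theta i) (fun phi => iter i X phi).
Proof. by rewrite -[theta i]fmul1; apply: rep1_ext (rep1_mono 1 i) _ => phi; rewrite mul1r. Qed.

Lemma rep1_fmul f e F : rep1 e F -> rep1 (fmul f e) (fun phi => f * F phi).
Proof.
elim=> [g i|{}e {}F e' F' _ ih _ ih'].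
  by rewrite fmul_M; apply: rep1_ext (rep1_mono _ i) _ => phi; rewrite mulrA.
by rewrite fmul_Dr; apply: rep1_ext (rep1_add ih ih') _ => phi; rewrite mulrDr.
Qed.

Lemma rep2_fmul f a Z : rep2 a Z -> rep2 (fmul f a) (fun phi psi => f * Z phi psi).
Proof.
elim=> [g i j|{}a {}Z a' Z' _ ih _ ih'].
  by rewrite fmul_M; apply: rep2_ext (rep2_mono _ i j) _ => phi psi; rewrite mulrA.
by rewrite fmul_Dr; apply: rep2_ext (rep2_add ih ih') _ => phi psi; rewrite mulrDr.
Qed.

Lemma rep1_0 : rep1 0 (fun=> 0).
Proof.
by rewrite -(fmul0 (theta 0)); apply: rep1_ext (rep1_mono 0 0) _ => phi; rewrite mul0r.
Qed.

Lemma rep2_0 : rep2 0 (fun _ _ => 0).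
Proof.
rewrite -(fmul0 (wedge1 (theta 0) (theta 0))).
by apply: rep2_ext (rep2_mono 0 0 0) _ => phi psi; rewrite mul0r.
Qed.

Lemma fmulN1 n (w : form n) : fmul (-1 : A) w = - w.
Proof. by apply/funext => p; apply/funext => v; exact: mulN1r. Qed.

Lemma rep1_opp e F : rep1 e F -> rep1 (- e) (fun phi => - F phi).
Proof.
by move=> /(rep1_fmul (-1)); rewrite fmulN1 => h; apply: rep1_ext h _ => phi; rewrite mulN1r.
Qed.

Lemma rep2_opp a Z : rep2 a Z -> rep2 (- a) (fun phi psi => - Z phi psi).
Proof.
move=> /(rep2_fmul (-1)); rewrite fmulN1 => h.
by apply: rep2_ext h _ => phi psi; rewrite mulN1r.
Qed.

Lemma rep1_sum (J : Type) (r : seq J) (e : J -> form 1) (F : J -> A -> A) :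
  (forall j, rep1 (e j) (F j)) ->
  rep1 (\sum_(j <- r) e j) (fun phi => \sum_(j <- r) F j phi).
Proof.
move=> eF; elim: r => [|j r ih].
  by rewrite big_nil; apply: rep1_ext rep1_0 _ => phi; rewrite big_nil.
by rewrite big_cons; apply: rep1_ext (rep1_add (eF j) ih) _ => phi; rewrite big_cons.
Qed.

Lemma rep2_sum (J : Type) (r : seq J) (a : J -> form 2) (Z : J -> A -> A -> A) :
  (forall j, rep2 (a j) (Z j)) ->
  rep2 (\sum_(j <- r) a j) (fun phi psi => \sum_(j <- r) Z j phi psi).
Proof.
move=> aZ; elim: r => [|j r ih].
  by rewrite big_nil; apply: rep2_ext rep2_0 _ => phi psi; rewrite big_nil.
by rewrite big_cons; apply: rep2_ext (rep2_add (aZ j) ih) _ => phi psi; rewrite big_cons.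
Qed.

Lemma rep1_smooth e F : rep1 e F -> smooth_form e.
Proof.
elim=> [f i|{}e {}F e' F' _ ih _ ih'].
  apply: smooth_fmul; exact: (@smooth_theta R (SmoothFun (sfun_smooth K))).
by rewrite -[e]scale1r; exact: smooth_form_lin.
Qed.

Lemma rep2_smooth a Z : rep2 a Z -> smooth_form a.
Proof.
have st i : smooth_form (theta i) by exact: (@smooth_theta R (SmoothFun (sfun_smooth K))).
elim=> [f i j|{}a {}Z a' Z' _ ih _ ih'].
  by apply: smooth_fmul; exact: smooth_wedge.
by rewrite -[a]scale1r; exact: smooth_form_lin.
Qed.

Lemma rep2_wedge e F e' F' : rep1 e F -> rep1 e' F' ->
  rep2 (wedge1 e e') (fun phi psi => F phi * F' psi - F psi * F' phi).
Proof.
move=> eF eF'; elim: eF => {e F} [f i|e1 F1 e2 F2 _ ih1 _ ih2]; last first.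
  by rewrite wedge_Dl; apply: rep2_ext (rep2_add ih1 ih2) _ => phi psi; ring.
elim: eF' => {e' F'} [g j|e1 F1 e2 F2 _ ih1 _ ih2]; last first.
  by rewrite wedge_Dr; apply: rep2_ext (rep2_add ih1 ih2) _ => phi psi; ring.
rewrite wedge_fmull wedge_fmulr fmul_M.
by apply: rep2_ext (rep2_mono _ i j) _ => phi psi; ring.
Qed.

Lemma rep2_adj a Z psi : rep2 a Z -> exists G, adj (Z^~ psi) G.
Proof.
elim=> [f i j|{}a {}Z a' Z' _ [G FG] _ [G' FG']]; last by eexists; exact: adj_add FG FG'.
eexists; apply: adj_ext (adjB XM (adj_mono XM (f * iter j X psi) i)
  (adj_mono XM (f * iter i X psi) j)) _ (fun=> erefl) => phi /=; ring.
Qed.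

Lemma rep1_dV f : rep1 (dV f) (fun phi => pr phi f).
Proof.
rewrite /dV; case: cid => N /= fN.
apply: rep1_ext (rep1_sum (index_enum 'I_N) (fun l : 'I_N => rep1_mono (pa l f) l)) _.
by move=> phi; rewrite (u_order_pr _ fN).
Qed.

Lemma rep1_lieX e F : rep1 e F -> rep1 (lieX e) (fun phi => X (F phi)).
Proof.
elim=> [f i|{}e {}F e' F' eF ih eF' ih'].
  rewrite X_vfE lie_fmul -?X_vfE ?lieX_theta; last first.
    by have := rep1_smooth (rep1_theta i).
  by apply: rep1_ext (rep1_add (rep1_mono _ i) (rep1_mono _ i.+1)) _ => phi; rewrite derM.
rewrite lie_D; [|exact: rep1_smooth eF|exact: rep1_smooth eF'].
by apply: rep1_ext (rep1_add ih ih') _ => phi; rewrite raddfD.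
Qed.

(** The linearized equation. *)
Definition linearized phi := T phi - pr phi K.
Local Notation ell := linearized.

Lemma rep1_lieT e F : rep1 e F -> rep1 (lieT e) (fun phi => T (F phi) - F (ell phi)).
Proof.
elim=> [f i|{}e {}F e' F' eF ih eF' ih'].
  rewrite T_vfE lie_fmul -?T_vfE ?lieT_theta; last first.
    by have := rep1_smooth (rep1_theta i).
  apply: rep1_ext (rep1_add (rep1_mono _ i) (rep1_fmul f (rep1_dV _))) _ => phi.
  rewrite derM (der_iterX _ _ TX) (der_iterX _ _ (pr_X phi)) /linearized.
  rewrite (additiveB _ _ (iterXD XM i)).
  move: (T f) (iter _ _ _) (iter _ _ _) (iter _ _ _) => x1 x2 x3 x4; ring.
rewrite lie_D; [|exact: rep1_smooth eF|exact: rep1_smooth eF'].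
by apply: rep1_ext (rep1_add ih ih') _ => phi; rewrite raddfD /=; ring.
Qed.

Lemma rep2_lieX a Z : rep2 a Z -> rep2 (lieX a) (fun phi psi => X (Z phi psi)).
Proof.
elim=> [f i j|{}a {}Z a' Z' aZ ih aZ' ih'].
  rewrite -wedge_fmull; have h := rep1_mono f i; have h' := rep1_theta j.
  rewrite lie_wedge; [|exact: rep1_smooth h|exact: rep1_smooth h'].
  apply: rep2_ext (rep2_add (rep2_wedge (rep1_lieX h) h')
    (rep2_wedge h (rep1_lieX h'))) _ => phi psi.
  rewrite !derM raddfB /= !derM.
  move: (X f) (iter i X phi) (iter i X psi) (iter j X phi) (iter j X psi) => y b c d e.
  move: (X b) (X c) (X d) (X e) => b' c' d' e'; ring.
rewrite lie_D; [|exact: rep2_smooth aZ|exact: rep2_smooth aZ'].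
by apply: rep2_ext (rep2_add ih ih') _ => phi psi; rewrite raddfD.
Qed.

Lemma rep2_lieT a Z : rep2 a Z -> rep2 (lieT a)
  (fun phi psi => T (Z phi psi) - Z (ell phi) psi - Z phi (ell psi)).
Proof.
elim=> [f i j|{}a {}Z a' Z' aZ ih aZ' ih'].
  rewrite -wedge_fmull; have h := rep1_mono f i; have h' := rep1_theta j.
  rewrite lie_wedge; [|exact: rep1_smooth h|exact: rep1_smooth h'].
  apply: rep2_ext (rep2_add (rep2_wedge (rep1_lieT h) h')
    (rep2_wedge h (rep1_lieT h'))) _ => phi psi.
  rewrite !derM raddfB /= !derM.
  move: (ell phi) (ell psi) => phi' psi'.
  move: (T f) (iter i X phi) (iter i X psi) (iter j X phi) (iter j X psi) => y b c d e.
  move: (T b) (T c) (T d) (T e) => b' c' d' e'.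
  move: (iter i X _) (iter j X _) (iter i X _) (iter j X _) => e1 e2 e3 e4; ring.
rewrite lie_D; [|exact: rep2_smooth aZ|exact: rep2_smooth aZ'].
by apply: rep2_ext (rep2_add ih ih') _ => phi psi; rewrite raddfD /=; ring.
Qed.

(** The operator is recovered by evaluation on evolutionary vector fields. *)
Lemma rep2_ev a Z phi psi p : rep2 a Z ->
  a p (fun k => if k == ord0 then vvec phi p else vvec psi p) = Z phi psi p.
Proof.
elim=> [f i j|{}a {}Z a' Z' _ ih _ ih'].
  by rewrite /fmul wedge11 /= !theta_vvec.
by rewrite sfunD -ih -ih'.
Qed.

Lemma rep2_eq0 a Z : rep2 a Z -> a = 0 -> forall phi psi, Z phi psi = 0.
Proof. by move=> aZ a0 phi psi; apply/sfunP => p; rewrite -(rep2_ev _ _ _ aZ) a0. Qed.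

Lemma rep2_list a Z : rep2 a Z -> exists s : seq ((nat * nat) * A),
  (forall p v, a p v = \sum_(t <- s) t.2 p *
     (theta t.1.1 p (fun=> v ord0) * theta t.1.2 p (fun=> v ord_max))) /\
  (forall phi psi, Z phi psi = \sum_(t <- s) bmono X t.2 t.1.1 t.1.2 phi psi).
Proof.
elim=> [f i j|{}a {}Z a' Z' _ [s [as_ Zs]] _ [s' [as' Zs']]].
  exists [:: ((i, j), f); ((j, i), - f)]; split=> [p v|phi psi].
    rewrite !big_cons big_nil /fmul wedge11 sfunN /=.
    by move: (theta _ _ _) (theta _ _ _) (theta _ _ _) (theta _ _ _) => x1 x2 x3 x4; ring.
  by rewrite !big_cons big_nil /bmono /=; ring.
exists (s ++ s'); split=> [p v|phi psi]; rewrite big_cat /=.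
  by rewrite -as_ -as'.
by rewrite -Zs -Zs'.
Qed.

(** The monomials are separated by powers of x, so the coefficients of the form,
   antisymmetrized, vanish. *)
Lemma rep2_inj a Z : rep2 a Z -> (forall phi psi, Z phi psi = 0) -> a = 0.
Proof.
move=> /rep2_list[s [as_ Zs]] Z0; apply/funext => p; apply/funext => v.
have c0 := bidiff_coef XM (X_x R) (@sfun_torsion _ _)
  (fun k l => etrans (esym (Zs _ _)) (Z0 (xA R ^+ k) (xA R ^+ l))).
pose g (k : nat * nat) := theta k.1 p (fun=> v ord0) * theta k.2 p (fun=> v ord_max).
rewrite as_ -[RHS](_ : \sum_(k <- undup [seq t.1 | t <- s]) (\sum_(t <- s | t.1 == k) t.2) p * g k = 0); last first.
  by apply: big1 => -[i j] _; rewrite c0 sfun0 mul0r.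
have sumE (Q : pred (nat * nat * A)) :
    (\sum_(t <- s | Q t) t.2) p = \sum_(t <- s | Q t) t.2 p.
  by elim/big_rec2: _ => // t y1 y2 _ <-.
under [RHS]eq_bigr do rewrite sumE mulr_suml.
rewrite (exchange_big_dep predT)//= [LHS]big_seq [RHS]big_seq; apply: eq_bigr => t ts.
rewrite -big_filter (_ : [seq _ <- _ | _] = [:: t.1]) ?big_seq1//.
rewrite -(@filter_pred1_uniq _ (undup [seq t.1 | t <- s]) t.1) ?undup_uniq//; last first.
  by rewrite mem_undup map_f.
by apply: eq_filter => -[k l] /=; case: (t.1) => i j; rewrite xpair_eqE (eq_sym i) (eq_sym j).
Qed.

End ContactForms.

(** * The horizontal complex in degree two *)

Opaque pd smooth der upd lie.

Section Bicomplex.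
Variable R : realType.
Local Notation C := (jet_coord nat).
Local Notation A := (sfun R C).
Local Notation point := (C -> R).
Local Notation form := (dform R C).
Local Notation X := (der (@Xc R)).
Local Notation NX := (fun v : A => - X v).
Local Notation pr v := (der (prc v)).
Local Notation adj := (adj X).
Variable K : A.
Local Notation T := (der (Tc K)).
Local Notation theta := (theta K).
Local Notation lieX := (lie (@X_vf R)).
Local Notation lieT := (lie (T_vf K)).
Local Notation rep1 := (rep1 K).
Local Notation rep2 := (rep2 K).
Local Notation ell := (linearized K).
Local Notation dx := (@dx R).
Local Notation dt := (@dt R).
Implicit Types (f h : A) (phi psi : A) (p : point) (n : nat).
Let XM : forall a b, X (a * b) = X a * b + a * X b := derM (@Xc R).

Lemma wedge_0form (e : form 1) f :
  wedge1 e ((fun p _ => f p) : form 0) = fmul f e.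
Proof.
apply/funext => p; apply/funext => v; rewrite /wedge1 big_ord1 expr0 mul1r mulrC /fmul.
by congr (_ * e p _); apply/funext => k; rewrite (ord1 k).
Qed.

Lemma Omega02 (a : form 2) : @Omega R K 0 2 a <-> exists Z, rep2 a Z.
Proof.
split=> [[l [lm ->]]|[Z]].
  elim: l lm => [|w l ih] lm.
    by exists (fun _ _ => 0); rewrite big_nil; exact: rep2_0.
  have [|Z hZ] := ih; first by move=> w' w'l; apply: lm; rewrite inE w'l orbT.
  have [i [w1 [j [w2 [f sf w2E] w1E] wE]]] := lm w (mem_head _ _).
  rewrite big_cons wE w1E w2E (wedge_0form _ (mk_sfun sf)) wedge_fmulr.
  by eexists; exact: rep2_add (rep2_mono _ _ i j) hZ.
elim=> [f i j|{}a {}Z a' Z' _ ih _ ih'].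
  exists [:: fmul f (wedge1 (theta i) (theta j))]; rewrite big_seq1; split=> // w.
  rewrite inE => /eqP ->; exists i; exists (fmul f (theta j)); last by rewrite wedge_fmulr.
  by exists j; exists (fun p _ => f p); [exists f => //; exact: sfun_smooth|rewrite wedge_0form].
by have := @Omega_lin R (SmoothFun (sfun_smooth K)) 0 2 1 a a' ih ih'; rewrite scale1r.
Qed.

Lemma Omega12 (w : form 3) : @Omega R K 1 2 w <->
  exists a b : form 2, [/\ @Omega R K 0 2 a, @Omega R K 0 2 b & w = wedge1 dx a + wedge1 dt b].
Proof.
have O0 := @Omega0 R (SmoothFun (sfun_smooth K)) 0 2.
have OD (a b : form 2) : @Omega R K 0 2 a -> @Omega R K 0 2 b -> @Omega R K 0 2 (a + b).
  by move=> Oa Ob; have := @Omega_lin R (SmoothFun (sfun_smooth K)) 0 2 1 a b Oa Ob; rewrite scale1r.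
have O1 (w' : form 2) : @monomial R K 0 2 w' -> @Omega R K 0 2 w'.
  by move=> mw'; exists [:: w']; rewrite big_seq1; split=> // w''; rewrite inE => /eqP ->.
split=> [[l [lm ->]]|[a [b [[l [lm ->]] [l' [l'm ->]] ->]]]].
  elim: l lm => [|w' l ih] lm.
    by exists 0, 0; split; [exact: O0|exact: O0|rewrite big_nil !wedge0 addr0].
  have [|a [b [Oa Ob E]]] := ih; first by move=> w1 w1l; apply: lm; rewrite inE w1l orbT.
  have [w1 mw1 w'E] := lm w' (mem_head _ _).
  rewrite big_cons E; case: w'E => ->.
    exists a, (w1 + b); split=> //; first exact: OD (O1 _ mw1) Ob.
    by rewrite wedge_Dr addrCA.
  exists (w1 + a), b; split=> //; first exact: OD (O1 _ mw1) Oa.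
  by rewrite wedge_Dr addrA.
have wsum (e : form 1) (s : seq (form 2)) : wedge1 e (\sum_(w <- s) w) = \sum_(w <- s) wedge1 e w.
  by elim: s => [|w' s ih]; rewrite ?big_nil ?wedge0// !big_cons wedge_Dr ih.
exists ([seq wedge1 dx w | w <- l] ++ [seq wedge1 dt w | w <- l']); split.
  move=> w'; rewrite mem_cat => /orP[] /mapP[w1 w1l ->]; exists w1.
  - exact: lm.
  - by right.
  - exact: l'm.
  - by left.
by rewrite !wsum big_cat !big_map.
Qed.

Lemma rep2_kills (H : point -> point) a Z : (forall i, kills H (theta i)) ->
  rep2 a Z -> kills H a.
Proof.
move=> Ht; elim=> [f i j|{}a {}Z a' Z' _ ih _ ih']; last exact: kills_D.
by apply: kills_fmul; apply: kills_wedge.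
Qed.

Lemma rep2_sub a Z a' Z' : rep2 a Z -> rep2 a' Z' ->
  rep2 (a - a') (fun phi psi => Z phi psi - Z' phi psi).
Proof. by move=> aZ /rep2_opp; exact: rep2_add. Qed.

(** Contract with X and with T. *)
Lemma horizontal_free a Z b Z' : rep2 a Z -> rep2 b Z' ->
  wedge1 dx a + wedge1 dt b = 0 -> a = 0 /\ b = 0.
Proof.
move=> aZ bZ' E.
have E' p v : wedge1 dx a p v + wedge1 dt b p v = 0.
  by rewrite -[RHS](_ : (0 : form 3) p v = 0)// -E.
have kX := kills_theta_X K; have kT := kills_theta_T (K := K).
split; apply/funext => p; apply/funext => y.
  have := E' p (vcons (X_vf p) y).
  rewrite !wedge_contract; [|exact: rep2_kills bZ'|exact: rep2_kills aZ].
  by rewrite /Defs.dx /Defs.dt /= mul1r mul0r addr0.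
have := E' p (vcons (T_vf K p) y).
rewrite !wedge_contract; [|exact: rep2_kills bZ'|exact: rep2_kills aZ].
by rewrite /Defs.dx /Defs.dt /= mul1r mul0r add0r.
Qed.

Lemma horizontal_free2 a Z : rep2 a Z -> wedge1 dt (wedge1 dx a) = 0 -> a = 0.
Proof.
move=> aZ E; have kT := kills_theta_T (K := K).
have ka := rep2_kills kT aZ.
suff E1 : wedge1 dx a = 0.
  apply: (horizontal_free aZ (rep2_0 K) _).1.
  by rewrite E1 wedge0 addr0.
apply/funext => p; apply/funext => y.
have := wedge_contract dt p y (kills_wedge (@kills_dx_T R K) ka).
by rewrite E /Defs.dt /= mul1r => <-.
Qed.

Lemma wedge0l n (w : form n) : wedge1 0 w = 0.
Proof.
by rewrite -(fmul0 0) wedge_fmull fmul0.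
Qed.

(** The terms dx /\ dx and dt /\ dt vanish, and dx /\ dt = - dt /\ dx. *)
Lemma dH12 (a b : form 2) : smooth_form a -> smooth_form b ->
  dH K (wedge1 dx a + wedge1 dt b) = wedge1 dt (wedge1 dx (lieT a - lieX b)).
Proof.
move=> sa sb; have sdx := @smooth_dx R; have sdt := @smooth_dt R.
have swx := smooth_wedge sdx sa; have swt := smooth_wedge sdt sb.
have LX : lieX (wedge1 dx a + wedge1 dt b) = wedge1 dx (lieX a) + wedge1 dt (lieX b).
  rewrite (lie_D _ swx swt) (lie_wedge _ sdx sa) (lie_wedge _ sdt sb).
  by rewrite lieX_dx lieX_dt !wedge0l !add0r.
have LT : lieT (wedge1 dx a + wedge1 dt b) = wedge1 dx (lieT a) + wedge1 dt (lieT b).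
  rewrite (lie_D _ swx swt) (lie_wedge _ sdx sa) (lie_wedge _ sdt sb).
  by rewrite lieT_dx lieT_dt !wedge0l !add0r.
rewrite /dH LX LT.
move: (lieX a) (lieX b) (lieT a) (lieT b) => Xa Xb Ta Tb.
rewrite !wedge_Dr !wedge_aa !wedge_Nr add0r addr0 addrC; congr (_ + _).
by apply/eqP; rewrite -addr_eq0 wedge_anti2.
Qed.

Lemma lie_commute a Z : rep2 a Z -> lieT (lieX a) = lieX (lieT a).
Proof.
move=> aZ; apply/eqP; rewrite -subr_eq0; apply/eqP.
apply: rep2_inj (rep2_sub (rep2_lieT (rep2_lieX aZ)) (rep2_lieX (rep2_lieT aZ))) _.
by move=> phi psi; rewrite /= TX -!raddfB /= subrr raddf0.
Qed.

(** Apply [X_inj_op] in the first slot. *)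
Lemma lieX_inj a Z : rep2 a Z -> lieX a = 0 -> a = 0.
Proof.
move=> aZ Xa; apply: (rep2_inj aZ) => phi psi.
have [G ZG] := rep2_adj psi aZ.
apply: (X_inj_op XM (X_x R) (@sfun_torsion _ _) ZG) => v.
exact: rep2_eq0 (rep2_lieX aZ) Xa v psi.
Qed.

Lemma dH_dH a : @Omega R K 0 2 a -> dH K (dH K a) = 0.
Proof.
move=> /Omega02[Z aZ].
rewrite {2}/dH dH12; last 2 first.
- exact: rep2_smooth (rep2_lieX aZ).
- exact: rep2_smooth (rep2_lieT aZ).
by rewrite (lie_commute aZ) subrr !wedge0.
Qed.

(** For fixed psi both sides are operators in phi. At 1 the adjoint of the left-hand
   side is 2 S psi, and that of the right-hand side is 0, as it begins with X. *)
Lemma skew_divergence S a Z : adj S (fun v => - S v) -> rep2 a Z ->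
  (forall phi psi, phi * S psi - psi * S phi = X (Z phi psi)) -> forall psi, S psi = 0.
Proof.
move=> SS aZ E psi; have [G ZG] := rep2_adj psi aZ.
have h1 : adj (fun phi => phi * S psi - psi * S phi) (fun h => S psi * h - - S (psi * h)).
  apply: adj_ext (adjB XM (adj_mul X (S psi)) (adj_comp XM (adj_mul X psi) SS)) _ _ => v //.
  by rewrite [v * _]mulrC.
have h2 := adj_comp XM (adjX X) ZG.
have := adj_unique' h1 h2 (fun phi => E phi psi) 1.
rewrite /= der1 oppr0 (additive0 (adj_D ZG).2) !mulr1 opprK => SS0.
by apply: (@sfun_torsion _ _ 1); rewrite mulr2n mulrDl mul1r.
Qed.

Lemma iterNX_rep1 e F k : rep1 e F ->
  rep1 (iter k (fun e => - lieX e) e) (fun phi => iter k NX (F phi)).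
Proof.
by move=> eF; elim: k => //= k ih; apply: rep1_opp; exact: rep1_lieX.
Qed.

(** The dt-part of omega for a general contact form in place of epsilon. *)
Definition flux n (e : form 1) : form 2 :=
  \sum_(1 <= j < n.+1) \sum_(1 <= a < j.+1)
    wedge1 (iter a.-1 (fun e => - lieX e) (fmul (pd (Cu j) K) e)) (theta (j - a)).

Definition presymplectic n e : form 3 :=
  wedge1 dx (wedge1 (theta 0) e) - wedge1 dt (flux n e).

Definition fluxop n (F : A -> A) phi psi : A :=
  \sum_(1 <= j < n.+1) \sum_(1 <= a < j.+1)
    (iter a.-1 NX (pa j K * F phi) * iter (j - a) X psi
     - iter a.-1 NX (pa j K * F psi) * iter (j - a) X phi).

Lemma flux_rep n e F : rep1 e F -> rep2 (flux n e) (fluxop n F).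
Proof.
move=> eF; apply: rep2_sum => j; apply: rep2_sum => a.
exact: rep2_wedge (iterNX_rep1 _ (rep1_fmul (pa j K) eF)) (rep1_theta K (j - a)).
Qed.

(** Each summand is a difference of consecutive terms. What remains at the ends is the
   linearization of K and its adjoint. *)
Lemma flux_telescope n F phi psi : u_order n.+1 K ->
  X (fluxop n F phi psi) =
  F phi * pr psi K - psi * dual K (F phi) - (F psi * pr phi K - phi * dual K (F psi)).
Proof.
move=> Kn.
have tel j (v w : A) : X (\sum_(1 <= a < j.+1) iter a.-1 NX v * iter (j - a) X w) =
    v * iter j X w - iter j NX v * w.
  rewrite big_add1 /= raddf_sum /=.
  pose G a := - (iter a NX v * iter (j - a) X w).
  rewrite (eq_big_nat _ _ (F2 := fun a => G a.+1 - G a)) => [|a /andP[_ aj]].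
    by rewrite telescope_sumr// /G subnn subn0 /= opprK addrC.
  rewrite derM /G (_ : (j - a)%N = (j - a.+1).+1); last by lia.
  by rewrite !iterS mulNr !opprK.
have half v w : X (\sum_(1 <= j < n.+1) \sum_(1 <= a < j.+1)
      iter a.-1 NX (pa j K * v) * iter (j - a) X w) = v * pr w K - w * dual K v.
  rewrite raddf_sum /=; under eq_bigr do rewrite tel.
  rewrite (u_order_pr _ Kn) (dualE _ Kn) !mulr_sumr -sumrB.
  rewrite -(big_mkord xpredT (fun l => v * (pa l K * iter l X w) - w * iter l NX (pa l K * v))).
  rewrite [RHS]big_ltn//= [X in X + _](_ : _ = 0) ?add0r; last by ring.
  by apply: eq_bigr => j _; move: (iter j _ _) (iter j X w) => b c; ring.
rewrite -!half -raddfB /=; congr (X _); rewrite /fluxop -sumrB.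
by apply: eq_bigr => j _; rewrite -sumrB.
Qed.

(** The defect of the symmetry condition for F. *)
Definition residual (F : A -> A) v := T (F v) + dual K (F v) - F (ell v).

(** The terms in which K is linearized cancel between the two parts, which leaves the
   residual. *)
Lemma presymplectic_defect n e F : u_order n.+1 K -> rep1 e F ->
  rep2 (lieT (wedge1 (theta 0) e) + lieX (flux n e))
    (fun phi psi => phi * residual F psi - psi * residual F phi).
Proof.
move=> Kn eF.
apply: rep2_ext (rep2_add (rep2_lieT (rep2_wedge (rep1_theta K 0) eF))
  (rep2_lieX (flux_rep n eF))) _ => phi psi.
rewrite (flux_telescope _ _ _ Kn) /= raddfB /= !derM /residual.
have -> : pr phi K = T phi - ell phi by rewrite /linearized opprB addrC subrK.
have -> : pr psi K = T psi - ell psi by rewrite /linearized opprB addrC subrK.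
move: (ell phi) (ell psi) => l1 l2.
move: (T phi) (T psi) (T (F _)) (T (F _)) (dual K _) (dual K _) => x1 x2 x3 x4 x5 x6.
move: (F phi) (F psi) (F l1) (F l2) => y1 y2 y3 y4; ring.
Qed.

Lemma lie_opp a Z : rep2 a Z -> lieX (- a) = - lieX a.
Proof.
move=> aZ; rewrite -!fmulN1 X_vfE lie_fmul; last exact: rep2_smooth aZ.
by rewrite raddfN /= der1 oppr0 fmul0 add0r.
Qed.

Lemma dH_presymplectic n e F : rep1 e F ->
  dH K (presymplectic n e) =
  wedge1 dt (wedge1 dx (lieT (wedge1 (theta 0) e) + lieX (flux n e))).
Proof.
move=> eF; have h := rep2_wedge (rep1_theta K 0) eF; have h' := rep2_opp (flux_rep n eF).
rewrite /presymplectic -wedge_Nr dH12; [|exact: rep2_smooth h|exact: rep2_smooth h'].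
by rewrite (lie_opp (flux_rep n eF)) opprK.
Qed.

(** The two sides of the symmetry condition are exchanged by the adjoint. *)
Lemma skew_residual F : adj F (fun v => - F v) -> adj (residual F) (fun v => - residual F v).
Proof.
move=> FF; have FD := (adj_D FF).1.
have h1 := adj_commutator (derM (Tc K)) (TX K) FF.
have h2 := adj_comp XM (adj_sym XM (pr_adj K)) FF.
have h3 := adj_comp XM FF (pr_adj K).
apply: adj_ext (adj_add h1 (adj_add h2 h3)) _ _ => v.
  rewrite /residual /linearized (additiveB _ _ FD).
  by rewrite /=; ring.
rewrite /residual /linearized (additiveB _ _ FD) raddfN /= dualN.
by rewrite /=; ring.
Qed.

Lemma presymplectic_closed n e F : u_order n.+1 K -> rep1 e F -> adj F (fun v => - F v) ->
  dH K (presymplectic n e) = 0 <-> (forall v, residual F v = 0).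
Proof.
move=> Kn eF FF; rewrite (dH_presymplectic n eF); have h := presymplectic_defect Kn eF.
split=> [/(horizontal_free2 h) h0|r0]; last first.
  rewrite (rep2_inj h) ?wedge0// => phi psi; by rewrite !r0 !mulr0 subrr.
apply: (skew_divergence (skew_residual FF) (rep2_0 K)) => phi psi.
by rewrite raddf0; exact: rep2_eq0 h h0 phi psi.
Qed.

Lemma presymplectic_Omega n e F : rep1 e F -> @Omega R K 1 2 (presymplectic n e).
Proof.
move=> eF; apply/Omega12; exists (wedge1 (theta 0) e), (- flux n e); split.
- by apply/Omega02; eexists; exact: rep2_wedge (rep1_theta K 0) eF.
- by apply/Omega02; eexists; exact: rep2_opp (flux_rep n eF).
- by rewrite wedge_Nr.
Qed.

Lemma presymplectic_exact n e F : rep1 e F -> adj F (fun v => - F v) ->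
  @dH_exact R K 1 2 (presymplectic n e) -> forall v, F v = 0.
Proof.
move=> eF FF [g /Omega02[Z gZ] E].
have h := rep2_wedge (rep1_theta K 0) eF; have h' := rep2_opp (flux_rep n eF).
have := horizontal_free (rep2_sub h (rep2_lieX gZ)) (rep2_sub h' (rep2_lieT gZ)).
have -> : wedge1 dx (wedge1 (theta 0) e - lieX g) + wedge1 dt (- flux n e - lieT g) = 0.
  apply/eqP; rewrite !wedge_Dr !wedge_Nr addrACA -opprD.
  by rewrite subr_eq0; apply/eqP.
move=> /(_ erefl)[E1 _].
apply: (skew_divergence FF gZ) => phi psi.
have := rep2_eq0 (rep2_sub h (rep2_lieX gZ)) E1 phi psi => /eqP.
by rewrite subr_eq0 => /eqP <- /=; ring.
Qed.

(** Induction on i: theta^(i+1) /\ e = X (theta^i /\ e) - theta^i /\ X e. *)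
Lemma by_parts i e F : rep1 e F -> exists g Z, rep2 g Z /\
  wedge1 (theta i) e = wedge1 (theta 0) (iter i (fun e => - lieX e) e) + lieX g.
Proof.
elim: i e F => [|i ih] e F eF.
  exists 0, (fun _ _ => 0); split; first exact: rep2_0.
  rewrite -(fmul0 (0 : form 2)) X_vfE lie_fmul; last exact: smooth_form0.
  by rewrite raddf0 !fmul0 !addr0.
have [g [Z [gZ E]]] := ih _ _ (rep1_opp (rep1_lieX eF)).
have h := rep2_wedge (rep1_theta K i) eF.
exists (wedge1 (theta i) e + g); eexists; split; first exact: rep2_add h gZ.
rewrite iterSr lie_D; [|exact: rep2_smooth h|exact: rep2_smooth gZ].
rewrite addrCA -E lie_wedge; [|exact: rep1_smooth (rep1_theta K i)|exact: rep1_smooth eF].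
by rewrite lieX_theta wedge_Nr addrK.
Qed.

Lemma normal_two_form a Z : rep2 a Z -> exists e F g Z', [/\ rep1 e F, rep2 g Z' &
  a = wedge1 (theta 0) e + lieX g].
Proof.
elim=> [f i j|{}a {}Z a' Z' _ [e [F [g [Y [eF gY ->]]]]] _ [e' [F' [g' [Y' [eF' gY' ->]]]]]].
  have h := rep1_mono K f j; have [g [Y [gY E]]] := by_parts i h.
  eexists; eexists; exists g, Y; split; [exact: iterNX_rep1 i h| exact: gY|].
  by rewrite -wedge_fmulr E.
exists (e + e'); eexists; exists (g + g'); eexists; split.
- exact: rep1_add eF eF'.
- exact: rep2_add gY gY'.
- rewrite wedge_Dr lie_D; [|exact: rep2_smooth gY|exact: rep2_smooth gY'].
  by rewrite addrACA.
Qed.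

(** Exchanging the factors of theta^0 /\ f theta^i changes the sign, and integration by
   parts turns the result into the adjoint operator. *)
Lemma adjoint_form e F : rep1 e F -> exists e' G g Z, [/\ rep1 e' G, adj F G, rep2 g Z &
  wedge1 (theta 0) e + wedge1 (theta 0) e' = lieX g].
Proof.
elim=> [f i|{}e {}F e' F' _ [b [G [g [Y [bG FG gY E]]]]] _ [b' [G' [g' [Y' [bG' FG' gY' E']]]]]].
  have h := rep1_mono K f 0; have [g [Y [gY E]]] := by_parts i h.
  eexists; eexists; exists (- g); eexists; split.
  - exact: iterNX_rep1 i h.
  - exact: adj_mono.
  - exact: rep2_opp gY.
  - rewrite (lie_opp gY) wedge_anti1 wedge_fmull -wedge_fmulr E opprD.
    by rewrite addrAC addNr add0r.
exists (b + b'); eexists; exists (g + g'); eexists; split.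
- exact: rep1_add bG bG'.
- exact: adj_add FG FG'.
- exact: rep2_add gY gY'.
- rewrite !wedge_Dr lie_D; [|exact: rep2_smooth gY|exact: rep2_smooth gY'].
  by rewrite -E -E' addrACA.
Qed.

Lemma adj_cst F G (c : R) : adj F G ->
  (forall v, F (cst_sf C c * v) = cst_sf C c * F v) /\
  (forall v, G (cst_sf C c * v) = cst_sf C c * G v).
Proof.
have Xc v : X (cst_sf C c * v) = cst_sf C c * X v by rewrite derM der_cst mul0r add0r.
elim=> [f|{}F {}G _ [ihF ihG]|{}F {}G F' G' _ [ihF ihG] _ [ihF' ihG']]; split=> v.
- by rewrite mulrCA.
- by rewrite mulrCA.
- by rewrite ihF /= Xc.
- by rewrite /= Xc ihG mulrN.
- by rewrite ihF ihF' mulrDr.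
- by rewrite ihG ihG' mulrDr.
Qed.

(** Integrate by parts, then average with minus the adjoint. *)
Lemma skew_two_form a Z : rep2 a Z -> exists e F g Z', [/\ rep1 e F,
  adj F (fun v => - F v), rep2 g Z' & a = wedge1 (theta 0) e + lieX g].
Proof.
move=> /normal_two_form[e [F [g [Y [eF gY ->]]]]].
have [e' [G [g' [Y' [eG FG gY' E]]]]] := adjoint_form eF.
pose c := cst_sf C (2^-1 : R).
have c2 : c + c = 1.
  by apply/sfunP => p; rewrite sfunD /= -[LHS]/(2^-1 + 2^-1 : R) -[RHS]/(1 : R); field.
have h := rep2_fmul c gY'.
exists (fmul c (e - e')); eexists; exists (fmul c g' + g); eexists; split.
- exact: rep1_fmul (rep1_add eF (rep1_opp eG)).
- have H := adjB XM FG (adj_sym XM FG).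
  apply: adj_ext (adj_comp XM (adj_mul X c) H) _ _ => v //=.
  rewrite (adj_cst _ FG).1 (adj_cst _ FG).2.
  by rewrite -/c mulrBr opprB.
- exact: rep2_add h gY.
- rewrite lie_D; [|exact: rep2_smooth h|exact: rep2_smooth gY].
  rewrite [RHS]addrA; congr (_ + _); rewrite X_vfE lie_fmul; last exact: rep2_smooth gY'.
  rewrite der_cst fmul0 add0r -X_vfE -E wedge_fmulr -fmul_Dr wedge_Dr wedge_Nr.
  by rewrite addrACA addNr addr0 fmul_Dr -fmul_D c2 fmul1.
Qed.

Lemma rep1_array e F : rep1 e F -> exists N (c : nat -> A),
  e = \sum_(i < N) fmul (c i) (theta i) /\ forall v, F v = op N c v.
Proof.
move=> eF; have [s [es Fs]] : exists s : seq (nat * A),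
    e = \sum_(t <- s) fmul t.2 (theta t.1) /\
    forall v, F v = \sum_(t <- s) t.2 * iter t.1 X v.
  elim: eF => [f i|{}e {}F e' F' _ [s [-> Fs]] _ [s' [-> Fs']]].
    by exists [:: (i, f)]; split=> [|v]; rewrite big_seq1.
  by exists (s ++ s'); split=> [|v]; rewrite big_cat// Fs Fs'.
have [N sN] := seq_array s; exists N, (fun i => \sum_(t <- s | t.1 == i) t.2); split.
  by rewrite es (sN _ (fun i a => fmul a (theta i)))// => i a b; exact: fmul_D.
by move=> v; rewrite Fs (sN _ (fun i a => a * iter i X v))// => i a b; exact: mulrDl.
Qed.

(** With the dx-part in normal form, closedness says that the residual of F is a
   divergence. Hence it vanishes, and so does the discrepancy of the dt-parts, on which
   X is injective. *)
Lemma closed_normal_form n (w : form 3) : u_order n.+1 K -> @Omega R K 1 2 w -> dH K w = 0 ->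
  exists e F g, [/\ rep1 e F, adj F (fun v => - F v), @Omega R K 0 2 g &
    w = presymplectic n e + dH K g].
Proof.
move=> Kn /Omega12[a [b [/Omega02[Z aZ] /Omega02[Y bY] ->]]] cl.
have [e [F [g [Z' [eF FF gZ' aE]]]]] := skew_two_form aZ.
exists e, F, g; split=> //; first by apply/Omega02; exists Z'.
have h := rep2_wedge (rep1_theta K 0) eF.
have hd := rep2_add (rep2_sub bY (rep2_lieT gZ')) (flux_rep n eF).
suff d0 : b - lieT g + flux n e = 0.
  rewrite /presymplectic /dH aE wedge_Dr addrACA -!addrA; congr (_ + (_ + _)).
  by rewrite -wedge_Nr -wedge_Dr; congr wedge1; apply/eqP; rewrite -subr_eq0 opprD opprK addrCA addrC -d0 addrAC -!addrA.
move: cl; rewrite dH12; [|exact: rep2_smooth aZ|exact: rep2_smooth bY].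
move=> /(horizontal_free2 (rep2_sub (rep2_lieT aZ) (rep2_lieX bY))) cl.
have E : lieT (wedge1 (theta 0) e) + lieX (flux n e) = lieX (b - lieT g + flux n e).
  rewrite lie_D; last 2 first.
  - exact: rep2_smooth (rep2_sub bY (rep2_lieT gZ')).
  - exact: rep2_smooth (flux_rep n eF).
  congr (_ + _); rewrite lie_D; last 2 first.
  - exact: rep2_smooth bY.
  - exact: rep2_smooth (rep2_opp (rep2_lieT gZ')).
  rewrite (lie_opp (rep2_lieT gZ')) -(lie_commute gZ').
  move/eqP: cl; rewrite subr_eq0 => /eqP <-; rewrite aE lie_D ?addrK//.
  - exact: rep2_smooth h.
  - exact: rep2_smooth (rep2_lieX gZ').
have D := presymplectic_defect Kn eF.
have r0 : forall v, residual F v = 0.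
  apply: (skew_divergence (skew_residual FF) hd) => phi psi.
  apply/eqP; rewrite -subr_eq0; apply/eqP.
  apply: (rep2_eq0 (rep2_sub D (rep2_lieX hd)) _ phi psi).
  by rewrite E subrr.
apply: (lieX_inj hd); rewrite -E; apply: (rep2_inj D) => phi psi.
by rewrite !r0 !mulr0 subrr.
Qed.

End Bicomplex.

(** * The form attached to an operator *)

Section VariationalForms.
Variables (R : realType) (K : smooth_fun R (jet_coord nat)) (m : nat).
Local Notation C := (jet_coord nat).
Local Notation A := (sfun R C).
Local Notation point := (C -> R).
Local Notation form := (dform R C).
Local Notation X := (der (@Xc R)).
Local Notation tau := (der (@tauc R)).
Local Notation pr v := (der (prc v)).
Local Notation adj := (adj X).
Let XM : forall a b, X (a * b) = X a * b + a * X b := derM (@Xc R).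

Definition KA : A := mk_sfun (smooth_funP K).
Local Notation n := (2 * m).+1.
Local Notation lieX := (lie (@X_vf R)).
Implicit Types (r : nat -> point -> R) (v : A).

Hypothesis hm : (1 <= m)%N.
Hypothesis hK : forall p q : point, p Ct = q Ct -> p Cx = q Cx ->
  (forall i, (i <= n)%N -> p (Cu i) = q (Cu i)) -> K p = K q.
Hypothesis hK_top : forall p : point, pd (Cu n) K p != 0.

Lemma K_order : u_order n.+1 KA.
Proof.
move=> l nl; apply/sfunP => p; rewrite sfun0 /=.
apply: (@pd_support _ _ _ (Ct :: Cx :: [seq Cu i | i <- iota 0 n.+1])).
  move=> q q' qq'; apply: hK.
  - by apply: qq'; rewrite inE eqxx.
  - by apply: qq'; rewrite !inE eqxx orbT.
  - move=> i iN; apply: qq'; rewrite 2!inE; apply/orP; right; apply/orP; right.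
    by apply: map_f; rewrite mem_iota.
have : Cu l \notin [seq (Cu i : C) | i <- iota 0 n.+1].
  apply/mapP => -[i]; rewrite mem_iota add0n => /andP[_ iN] [li].
  by move: iN; rewrite -li ltnNge nl.
by move: [seq _ | _ <- _] => s ls; rewrite 2!in_cons (negbTE ls).
Qed.

(* the factor -1/2 of epsilon *)
Let c2 : A := cst_sf C (- 2^-1).

Let c2K v : - (c2 * v + c2 * v) = v.
Proof.
apply/sfunP => p; rewrite sfunN sfunD !sfunM /= -[LHS]/(- (- 2^-1 * v p + - 2^-1 * v p)).
by field.
Qed.

Section Operator.
Variables (r : nat -> point -> R) (N : nat) (rA : nat -> A).
Hypothesis rE : forall i, r i = rA i.
Hypothesis rN : forall i, (N <= i)%N -> r i = 0.
Local Notation F := (fun v => c2 * op N rA v).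

Lemma epsilonE : epsilon K r = fmul c2 (\sum_(i < N) fmul (rA i) (theta KA i)).
Proof.
apply/funext => p; apply/funext => v; rewrite /epsilon /fmul; congr (_ * _).
rewrite (@fsbig_nat _ N) => [|i Ni]; last by rewrite rN// mul0r.
by rewrite form_sumE; apply: eq_bigr => i _; rewrite rE.
Qed.

Lemma epsilon_rep : rep1 KA (epsilon K r) F.
Proof.
by rewrite epsilonE; apply: rep1_fmul; apply: rep1_sum => i; exact: rep1_mono.
Qed.

Lemma omegaE : omega K n r = presymplectic KA n (epsilon K r).
Proof. by []. Qed.

Lemma epsilon_skew : (forall v, opT N rA v = - op N rA v) <-> adj F (fun v => - F v).
Proof.
have h := adj_comp XM (adj_mul X c2) (adj_op N rA).
have cT v : opT N rA (c2 * v) = c2 * opT N rA v by exact: (adj_cst _ (adj_op N rA)).2.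
split=> [sk|FF v].
  by apply: adj_ext h _ _ => v //; rewrite cT sk mulrN.
have := adj_unique' h FF (fun=> erefl) v; rewrite cT => E.
by rewrite -[LHS]c2K E -opprD opprK -[in RHS](c2K (op N rA v)) opprK.
Qed.

(** A constant factor does not affect the symmetry condition. *)
Lemma residual_symmetry :
  (forall v, residual KA F v = 0) <-> symmetry KA N rA.
Proof.
have E v : residual KA F v = c2 * (tau (op N rA v) + pr KA (op N rA v) + dual KA (op N rA v)
    - op N rA (tau v + pr KA v - pr v KA)).
  rewrite /residual /linearized (adj_cst _ (pr_adj KA)).2 derM der_cst mul0r add0r !TE.
  by rewrite mulrBr !mulrDr.
split=> [r0 v|S v]; last by rewrite E S subrr mulr0.
apply/eqP; rewrite -subr_eq0; apply/eqP.
by rewrite -[LHS]c2K -E r0 addr0 oppr0.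
Qed.

Lemma variational_omega : is_diffop r ->
  is_variational (evolution K) r <-> skew_adjoint r /\ dH K (omega K n r) = 0.
Proof.
move=> dr.
rewrite (@is_variationalE _ _ _ _ rE rN K KA erefl dr).
rewrite (variational_symmetry hm K_order hK_top).
rewrite (skew_adjointE rE rN) omegaE.
split=> -[sk h]; split=> //; have FF := epsilon_skew.1 (skewJ_skew sk).
  by apply/(presymplectic_closed K_order epsilon_rep FF)/residual_symmetry.
by apply/residual_symmetry/(presymplectic_closed K_order epsilon_rep FF).
Qed.

End Operator.

Lemma diffop_coefs r : is_diffop r -> exists N (rA : nat -> A),
  (forall i, r i = rA i) /\ forall i, (N <= i)%N -> r i = 0.
Proof. by move=> [sr [k rk]]; exists k.+1, (fun i => mk_sfun (sr i)). Qed.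

Lemma epsilon_linear (a : R) r r' : is_diffop r -> is_diffop r' ->
  epsilon K (a *: r + r') = a *: epsilon K r + epsilon K r'.
Proof.
move=> /diffop_coefs[N [rA [_ rN]]] /diffop_coefs[N' [_ [_ rN']]].
have rM i : (N + N' <= i)%N -> r i = 0.
  by move=> Ni; apply: rN; apply: leq_trans Ni; exact: leq_addr.
have rM' i : (N + N' <= i)%N -> r' i = 0.
  by move=> Ni; apply: rN'; apply: leq_trans Ni; exact: leq_addl.
apply/funext => p; apply/funext => v.
rewrite [RHS](_ : _ = a * epsilon K r p v + epsilon K r' p v)// /epsilon.
rewrite !(@fsbig_nat _ (N + N')) => [|i Ni|i Ni|i Ni]; last 3 first.
- by rewrite rM'// mul0r.
- by rewrite rM// mul0r.
- by rewrite addrfctE scalrfctE rM// rM'// scaler0 addr0 mul0r.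
rewrite mulrCA -mulrDr; congr (_ * _); rewrite mulr_sumr -big_split; apply: eq_bigr => i _ /=.
by rewrite -[(a *: r + r') i p]/(a * r i p + r' i p) mulrDl mulrA.
Qed.

Lemma presymplectic_linear (a : R) e F e' F' : rep1 KA e F -> rep1 KA e' F' ->
  presymplectic KA n (a *: e + e') = a *: presymplectic KA n e + presymplectic KA n e'.
Proof.
move=> eF eF'.
have fl f w w' : fmul f (a *: w + w') = a *: fmul f w + fmul f w' :> form 1.
  apply/funext => p; apply/funext => v.
  rewrite -[LHS]/(f p * (a * w p v + w' p v)) -[RHS]/(a * (f p * w p v) + f p * w' p v).
  by ring.
have it k f : iter k (fun e => - lieX e) (fmul (f : A) (a *: e + e')) =
    a *: iter k (fun e => - lieX e) (fmul f e) + iter k (fun e => - lieX e) (fmul f e').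
  rewrite fl; elim: k => //= k ->; rewrite lie_lin.
  - by rewrite opprD scalerN.
  - exact: rep1_smooth (iterNX_rep1 k (rep1_fmul f eF)).
  - exact: rep1_smooth (iterNX_rep1 k (rep1_fmul f eF')).
have fx : flux KA n (a *: e + e') = a *: flux KA n e + flux KA n e'.
  rewrite /flux scaler_sumr -big_split; apply: eq_bigr => j _ /=.
  rewrite scaler_sumr -big_split; apply: eq_bigr => b _ /=.
  by rewrite (it _ (pa j KA)) wedge_linl.
by rewrite /presymplectic fx !wedge_lin opprD scalerBr addrACA.
Qed.

Lemma omega_linear (a : R) r r' : is_diffop r -> is_diffop r' ->
  omega K n (a *: r + r') = a *: omega K n r + omega K n r'.
Proof.
move=> dr dr'; rewrite !omegaE epsilon_linear//.
have [N [rA [rE rN]]] := diffop_coefs dr; have [N' [rA' [rE' rN']]] := diffop_coefs dr'.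
exact: presymplectic_linear (epsilon_rep rE rN) (epsilon_rep rE' rN').
Qed.

Lemma omega_exact r : is_diffop r -> skew_adjoint r ->
  @dH_exact R K 1 2 (omega K n r) -> r = 0.
Proof.
move=> dr sk ex; have [N [rA [rE rN]]] := diffop_coefs dr.
have FF := (epsilon_skew N rA).1 (skewJ_skew ((skew_adjointE rE rN).1 sk)).
have F0 := presymplectic_exact (epsilon_rep rE rN) FF ex.
apply/funext => i; have [Ni|iN] := leqP N i; first exact: rN.
rewrite rE (@op_inj _ N rA)// => k.
by rewrite -[LHS]c2K F0 addr0 oppr0.
Qed.

Lemma omega_Omega r : is_diffop r -> @Omega R K 1 2 (omega K n r).
Proof.
move=> dr; have [N [rA [rE rN]]] := diffop_coefs dr.
exact: presymplectic_Omega (epsilon_rep rE rN).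
Qed.

(** Closedness of the normal form is inherited from w, so its operator is variational. *)
Lemma closed_omega (w : form 3) : @Omega R K 1 2 w -> dH K w = 0 ->
  exists r, is_variational (evolution K) r /\ @dH_exact R K 1 2 (omega K n r - w).
Proof.
move=> Ow cl; have [e [F [g [eF FF Og wE]]]] := closed_normal_form K_order (K := KA) Ow cl.
have [N [c [ec Fc]]] := rep1_array eF.
pose rA i : A := if (i < N)%N then - (c i + c i) else 0.
pose r i : point -> R := rA i.
have rN i : (N <= i)%N -> r i = 0 by rewrite /r /rA ltnNge => ->.
have dr : is_diffop r.
  by split=> [i|]; [exact: sfun_smooth|exists N => i /ltnW/rN].
have rE i : r i = rA i by [].
have er : epsilon K r = e.
  rewrite (epsilonE rE rN) ec; apply/funext => p; apply/funext => v.
  rewrite /fmul !form_sumE mulr_sumr; apply: eq_bigr => i _.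
  rewrite /fmul /rA ltn_ord mulrA; congr (_ * _).
  by rewrite -sfunM mulrN mulrDr c2K.
have sk : adj (fun v => c2 * op N rA v) (fun v => - (c2 * op N rA v)).
  have E v : F v = c2 * op N rA v.
    rewrite Fc /op mulr_sumr; apply: eq_bigr => i _.
    by rewrite /rA ltn_ord mulrA mulrN mulrDr c2K.
  by apply: adj_ext FF _ _ => v; rewrite E.
exists r; split.
  apply/(variational_omega rE rN dr); split.
    by apply/(skew_adjointE rE rN); apply: skew_skewJ; apply/epsilon_skew.
  have -> : omega K n r = (-1) *: dH K g + w.
    by rewrite omegaE er wE scaleN1r addrC addrK.
  rewrite dH_lin ?cl ?addr0.
  - by rewrite (dH_dH (K := KA) Og) scaler0.
  - have [Z gZ] := (Omega02 KA g).1 Og.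
    have sdx := smooth_wedge (@smooth_dx R) (rep2_smooth (rep2_lieX gZ)).
    have sdt := smooth_wedge (@smooth_dt R) (rep2_smooth (rep2_lieT gZ)).
    by have := smooth_form_lin 1 sdx sdt; rewrite scale1r.
  - exact: smooth_Omega Ow.
exists ((-1) *: g + 0); first exact: Omega_lin Og (Omega0 K 0 2).
rewrite dH_lin; [|exact: smooth_Omega Og|exact: smooth_form0].
by rewrite dH0 addr0 omegaE er wE scaleN1r opprD addrA subrr sub0r.
Qed.

End VariationalForms.

(** * Variational operators and cohomology *)

Lemma Vop_variational (R : realType) (D : (jet_coord (nat * nat) -> R) -> R) (E : Vop D) :
  is_variational D (val E).
Proof. by have /asboolP := valP E. Qed.

Lemma Vop_ex (R : realType) (D : (jet_coord (nat * nat) -> R) -> R) r :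
  is_variational D r -> exists E : Vop D, val E = r.
Proof.
move=> vr; have vr' : variational_pred D r by apply/asboolP.
by exists (Sub r vr').
Qed.

Lemma closed_forms_ex (R : realType) (K : smooth_fun R (jet_coord nat)) k l
    (w : dform R (jet_coord nat) (k + l)) :
  Omega K w -> dH K w = 0 -> exists z : closed_forms K k l, val z = w.
Proof.
move=> Ow dw; have cw : closed_pred K w by apply/asboolP.
by exists (Sub w cw).
Qed.

Lemma closed_formsP (R : realType) (K : smooth_fun R (jet_coord nat)) k l
    (z : closed_forms K k l) : Omega K (val z) /\ dH K (val z) = 0.
Proof. by have /asboolP := valP z. Qed.

Lemma cohomology_class_linear (R : realType) (K : smooth_fun R (jet_coord nat)) k l (a : R)
    (z z' : closed_forms K k l) :
  cohomology_class (a *: z + z') = a *: cohomology_class z + cohomology_class z'.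
Proof. by rewrite /cohomology_class pi_quotmodD pi_quotmodZ. Qed.

Theorem theorem1p1 (R : realType) (m : nat) (hm : (1 <= m)%N)
    (K : smooth_fun R (jet_coord nat))
    (hK : forall p q : jet_coord nat -> R, p Ct = q Ct -> p Cx = q Cx ->
       (forall i, (i <= (2 * m).+1)%N -> p (Cu i) = q (Cu i)) -> K p = K q)
    (hK_top : forall p : jet_coord nat -> R, pd (Cu (2 * m).+1%N) K p != 0) :
  (forall r : nat -> (jet_coord nat -> R) -> R, is_diffop r ->
     (is_variational (evolution K) r <->
      skew_adjoint r /\ dH K (omega K (2 * m).+1%N r) = 0))
  /\
  (exists Phi : {linear Vop (evolution K) -> cohomology K 1 2},
     (forall E : Vop (evolution K), exists2 z : closed_forms K 1 2,
        val z = omega K (2 * m).+1%N (val E) & Phi E = cohomology_class z)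
     /\ bijective Phi).
Proof.
have iff r : is_diffop r -> is_variational (evolution K) r <->
    skew_adjoint r /\ dH K (omega K (2 * m).+1%N r) = 0.
  move=> dr; have [N [rA [rE rN]]] := diffop_coefs dr.
  exact (variational_omega hm hK hK_top rE rN dr).
split=> //.
have dr (E : Vop (evolution K)) : is_diffop (val E) := (Vop_variational E).1.
have zE (E : Vop (evolution K)) : exists z : closed_forms K 1 2,
    val z = omega K (2 * m).+1 (val E).
  apply: closed_forms_ex; first exact: omega_Omega.
  by have [] := (iff _ (dr E)).1 (Vop_variational E).
have [zeta zetaE] := choice zE.
pose phi E : cohomology K 1 2 := cohomology_class (zeta E).
have phi_lin : linear phi.
  move=> a E E'; rewrite /phi -[RHS]cohomology_class_linear; congr cohomology_class.
  apply/val_inj; rewrite [RHS]linearP /= !zetaE.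
  have -> : val (a *: E + E') = a *: val E + val E' by rewrite linearP.
  by rewrite omega_linear.
pose lin := GRing.isLinear.Build R (Vop (evolution K)) (cohomology K 1 2) _ phi phi_lin.
pose Phi : {linear Vop (evolution K) -> cohomology K 1 2} := HB.pack phi lin.
exists Phi; split; first by move=> E; exists (zeta E); rewrite ?zetaE.
have inj : injective phi.
  move=> E E' /cohomology_classP; rewrite !zetaE => ex.
  have := (iff _ (dr (E - E'))).1 (Vop_variational _) => -[sk _].
  apply/eqP; rewrite -subr_eq0; apply/eqP/val_inj; rewrite [RHS]raddf0.
  apply: (@omega_exact _ K m) => //.
  have -> : val (E - E') = (-1) *: val E' + val E.
    by rewrite raddfB /= scaleN1r addrC.
  by rewrite omega_linear// scaleN1r addrC.
have surj y : exists E, phi E = y.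
  have [w ->] := quotmodP y.
  have [Ow dw] := closed_formsP w.
  have [r [vr ex]] := closed_omega hm hK hK_top Ow dw.
  have [E Er] := Vop_ex vr; exists E.
  by apply/cohomology_classP; rewrite zetaE Er.
have [inv invE] := choice surj.
by exists inv => [E|y]; [apply: inj; rewrite invE|rewrite /= invE].
Qed.
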